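(* Consider the $K$-user MISO broadcast channel with a random time-varying jammer described in the context, where $\lambda_k$ is the probability that receiver $k$ is not jammed at a given time. For each of the three CSIT-JSIT configurations $\mathsf{PP}$, $\mathsf{PD}$ and $\mathsf{PN}$, the degrees-of-freedom region is the same, and it equals the set of $K$-tuples $(d_1,\dots,d_K)$ of non-negative real numbers satisfying $$d_k\le\lambda_k,\qquad k=1,\dots,K .$$
   Context: **Channel.** A transmitter with $K$ antennas sends independent, uniformly distributed messages $W_1,\dots,W_K$ to $K$ single-antenna receivers. At time $t=1,2,\dots$ receiver $k\in\{1,\dots,K\}$ observes $$Y_k(t)=\mathbf H_k(t)\mathbf X(t)+S_k(t)\,\mathbf G_k(t)\mathbf J(t)+N_k(t),$$ where $\mathbf X(t)\in\mathbb C^{K}$ is the channel input, subject to $E|\mathbf X(t)|^2\le P_T$; $\mathbf H_k(t)\in\mathbb C^{1\times K}$ is the channel from transmitter to receiver $k$; $\mathbf G_k(t)\in\mathbb C^{1\times K}$ is the channel from the jammer to receiver $k$; $\mathbf J(t)\in\mathbb C^K$ is the jammer's signal; $N_k(t)\sim\mathcal{CN}(0,1)$ is noise, i.i.d. over time and independent across receivers. The vectors $\mathbf H_k(t)$, $\mathbf G_k(t)$ have continuous distributions (i.e. with a density) with identity covariance, not depending on $P_T$, are i.i.d. over time and independent across $k$. The entries of $\mathbf J(t)$ are i.i.d. $\mathcal{CN}(0,P_T)$, i.i.d. over time. The processes $\mathbf H$, $\mathbf G$, $\mathbf J$, $S$, $N$ and the messages are mutually independent. **Jammer state.** $S(t)=(S_1(t),\dots,S_K(t))\in\{0,1\}^K$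 is i.i.d. over time, with an arbitrary fixed distribution not depending on $P_T$; $S_k(t)=1$ means receiver $k$ is jammed at time $t$ and $S_k(t)=0$ means it is not. $\lambda_k=\Pr(S_k(t)=0)$. **Information at the terminals.** Write $\mathbf H(t)=(\mathbf H_1(t),\dots,\mathbf H_K(t))$, $\mathbf H^{t}=(\mathbf H(1),\dots,\mathbf H(t))$, $S^{t}=(S(1),\dots,S(t))$. All receivers know $\mathbf H^n$ and $S^n$ (for the whole block of length $n$). Nobody knows $\mathbf G$. The transmitter always knows the statistics of $S(t)$. The input $\mathbf X(t)$ is a function of $(W_1,\dots,W_K)$ together with: $(\mathbf H^t,S^t)$ in configuration $\mathsf{PP}$ (perfect CSIT, perfect JSIT); $(\mathbf H^t,S^{t-1})$ in $\mathsf{PD}$ (perfect CSIT, delayed JSIT); $\mathbf H^t$ in $\mathsf{PN}$ (perfect CSIT, no JSIT). **DoF region.** For fixed $P_T$, a rate tuple $(R_1,\dots,R_K)$, $R_k=\frac1n\log|W_k|$ ($|W_k|$ the number of values of message $W_k$), is achievable if there are encoders (respecting the configuration and the power constraint) and decoders $g_k^{(n)}(Y_k^n,\mathbf H^n,S^n)$ whose error probabilities $\Pr(W_k\ne g_k^{(n)})$ tend to $0$ as $n\to\infty$ for all $k$. The degrees-of-freedom region is the set of all $(d_1,\dots,d_K)$ with $d_k=\lim_{P_T\to\infty}\frac{R_k}{\log P_T}$ for achievable rate tuples $(R_1(P_T),\dots,R_K(P_T))$. *)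

(* Defs.v *)
(* Libraries: MathComp, MathComp-Analysis, and real-closed for the type R[i]
   of complex numbers over a realType R. *)
From HB Require Import structures.
From mathcomp Require Import all_boot all_order all_algebra.
From mathcomp Require Import complex.
From mathcomp Require Import all_classical all_reals all_analysis.

Set Implicit Arguments.
Unset Strict Implicit.
Unset Printing Implicit Defensive.
Import Order.TTheory GRing.Theory Num.Theory.
Import numFieldNormedType.Exports.
Local Open Scope classical_set_scope.
Local Open Scope ring_scope.
Local Open Scope complex_scope.

(* Borel sigma-algebra of C = R^2. *)
Section complex_measurable.
Context {R : realType}.

Definition reim (z : R[i]) : R * R := (complex.Re z, complex.Im z).

HB.instance Definition _ := isPointed.Build R[i] 0.
HB.instance Definition _ :=
  Measurable.copy R[i] (g_sigma_algebra_preimageType reim).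

End complex_measurable.

(* Product sigma-algebra on matrices, generated by the entries. *)
Definition measure_matrix_display : measure_display -> measure_display.
Proof. exact. Qed.

Section matrix_measurable.
Context {d : measure_display} {T : measurableType d} {m n : nat}.

Definition matrix_measurable : set (set 'M[T]_(m, n)) :=
  <<s \bigcup_(ij in [set: 'I_m * 'I_n])
        preimage_set_system setT
          (fun A : 'M[T]_(m, n) => A ij.1 ij.2) measurable >>.

Let matrix_set0 : matrix_measurable set0.
Proof. exact: sigma_algebra0. Qed.

Let matrix_setC A : matrix_measurable A -> matrix_measurable (~` A).
Proof. exact: sigma_algebraC. Qed.

Let matrix_bigcup (F : (set 'M[T]_(m, n))^nat) :
  (forall i, matrix_measurable (F i)) -> matrix_measurable (\bigcup_i F i).
Proof. exact: sigma_algebra_bigcup. Qed.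

HB.instance Definition _ :=
  @isMeasurable.Build (measure_matrix_display d) 'M[T]_(m, n)
    matrix_measurable matrix_set0 matrix_setC matrix_bigcup.

End matrix_measurable.

Section independence.
Context {d : measure_display} {Omega : measurableType d} {R : realType}.
Variable P : probability Omega R.

Definition mutually_independent (I : choiceType)
    (F : I -> set (set Omega)) : Prop :=
  forall (s : seq I) (E : I -> set Omega), uniq s ->
    (forall i, i \in s -> F i (E i)) ->
    P (\bigcap_(i in [set` s]) E i) = (\prod_(i <- s) P (E i))%E.

Definition sigma_of {d' : measure_display} {U : measurableType d'}
    (X : {RV P >-> U}) : set (set Omega) :=
  g_sigma_algebra_preimage X.

Definition sigma_of_process {d' : measure_display} {U : measurableType d'}
    (I : Type) (X : I -> {RV P >-> U}) : set (set Omega) :=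
  <<s \bigcup_(i in [set: I]) sigma_of (X i) >>.

Definition identically_distributed {d' : measure_display}
    {U : measurableType d'} (X Y : {RV P >-> U}) : Prop :=
  forall A, measurable A -> distribution P X A = distribution P Y A.

End independence.

Section complex_random_variables.
Context {d : measure_display} {Omega : measurableType d} {R : realType}.
Variable P : probability Omega R.

Definition sqr_mod (z : R[i]) : R := complex.Re z ^+ 2 + complex.Im z ^+ 2.

Definition sqr_norm {K : nat} (x : 'cV[R[i]]_K) : R :=
  \sum_(j < K) sqr_mod (x j 0).

Definition complex_expectation (f : Omega -> R[i]) : R[i] :=
  fine 'E_P[fun w => complex.Re (f w)] +i* fine 'E_P[fun w => complex.Im (f w)].

Definition complex_covariance (f g : Omega -> R[i]) : R[i] :=
  complex_expectation (fun w => (f w - complex_expectation f) *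
                                conjc (g w - complex_expectation g)).

(* The finiteness clause makes the total [fine] above meaningful. *)
Definition identity_covariance {K : nat} (X : Omega -> 'rV[R[i]]_K) : Prop :=
  (forall j, 'E_P[fun w => sqr_mod (X w 0%R j)] < +oo)%E /\
  (forall i j, complex_covariance (fun w => X w 0 i) (fun w => X w 0 j)
               = (i == j)%:R).

(* CN(0, v): independent real and imaginary parts, each N(0, v/2).  The second
   parameter of [normal_prob] is the standard deviation. *)
Definition circular_gaussian (v : R) (Z : {RV P >-> R[i]}) : Prop :=
  forall A B : set R, measurable A -> measurable B ->
    P [set w | A (complex.Re (Z w)) /\ B (complex.Im (Z w))] =
    (normal_prob 0 (Num.sqrt (v / 2)) A *
     normal_prob 0 (Num.sqrt (v / 2)) B)%E.

(* Integral over C^K with respect to Lebesgue measure on R^(2K), as an iterated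
   integral over real and imaginary parts. *)
Fixpoint lebesgue_integral_CK (K : nat) :
    ('rV[R[i]]_K -> \bar R) -> \bar R :=
  match K with
  | 0%N => fun f => f 0
  | K'.+1 => fun f =>
      (\int[@lebesgue_measure R]_x \int[@lebesgue_measure R]_y
         lebesgue_integral_CK
           (fun v : 'rV_K' => f (row_mx (const_mx (x +i* y) : 'rV_1) v)))%E
  end.

Definition has_density {K : nat} (X : {RV P >-> 'rV[R[i]]_K}) : Prop :=
  exists f : 'rV[R[i]]_K -> R,
    [/\ measurable_fun setT f, (forall v, 0 <= f v) &
        forall A, measurable A ->
          distribution P X A =
          lebesgue_integral_CK (fun v => (f v * \1_A v)%:E)].

End complex_random_variables.

(* Time is indexed from 0.
   bc_J is indexed by the transmit power, because its law depends on it; all other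
   processes do not depend on the power.
   bc_W is indexed by the alphabet sizes: for sizes M, the message bc_W M k takes the
   values 0, ..., M k - 1. *)
Record jammed_broadcast_channel {d : measure_display}
    {Omega : measurableType d} {R : realType} (P : probability Omega R)
    (K : nat) := JammedBroadcastChannel {
  bc_H : nat -> 'I_K -> {RV P >-> 'rV[R[i]]_K} ;
  bc_G : nat -> 'I_K -> {RV P >-> 'rV[R[i]]_K} ;
  bc_J : R -> nat -> 'I_K -> {RV P >-> R[i]} ;
  bc_S : nat -> {RV P >-> K.-tuple bool} ;
  bc_N : nat -> 'I_K -> {RV P >-> R[i]} ;
  bc_W : ('I_K -> nat) -> 'I_K -> {RV P >-> nat} ;

  H_density : forall t k, has_density (bc_H t k) ;
  H_covariance : forall t k, identity_covariance P (bc_H t k) ;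
  H_ident : forall t k, identically_distributed (bc_H t k) (bc_H 0%N k) ;
  H_indep : mutually_independent P
    (fun tk : nat * 'I_K => sigma_of (bc_H tk.1 tk.2)) ;

  G_density : forall t k, has_density (bc_G t k) ;
  G_covariance : forall t k, identity_covariance P (bc_G t k) ;
  G_ident : forall t k, identically_distributed (bc_G t k) (bc_G 0%N k) ;
  G_indep : mutually_independent P
    (fun tk : nat * 'I_K => sigma_of (bc_G tk.1 tk.2)) ;

  J_gaussian : forall PT, 0 < PT -> forall t j, circular_gaussian PT (bc_J PT t j) ;
  J_indep : forall PT, 0 < PT -> mutually_independent P
    (fun tj : nat * 'I_K => sigma_of (bc_J PT tj.1 tj.2)) ;

  S_ident : forall t, identically_distributed (bc_S t) (bc_S 0%N) ;
  S_indep : mutually_independent P (fun t => sigma_of (bc_S t)) ;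

  N_gaussian : forall t k, circular_gaussian 1 (bc_N t k) ;
  N_indep : mutually_independent P
    (fun tk : nat * 'I_K => sigma_of (bc_N tk.1 tk.2)) ;

  W_uniform : forall M, (forall k, 0 < M k)%N -> forall k m, (m < M k)%N ->
    P (bc_W M k @^-1` [set m]) = ((M k)%:R^-1)%:E ;
  W_indep : forall M, (forall k, 0 < M k)%N ->
    mutually_independent P (fun k => sigma_of (bc_W M k)) ;

  processes_indep : forall PT M, 0 < PT -> (forall k, 0 < M k)%N ->
    mutually_independent P (tnth
      [tuple sigma_of_process (fun tk : nat * 'I_K => bc_H tk.1 tk.2);
             sigma_of_process (fun tk : nat * 'I_K => bc_G tk.1 tk.2);
             sigma_of_process (fun tj : nat * 'I_K => bc_J PT tj.1 tj.2);
             sigma_of_process bc_S;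
             sigma_of_process (fun tk : nat * 'I_K => bc_N tk.1 tk.2);
             sigma_of_process (bc_W M)])
}.

Inductive configuration := PP | PD | PN.

(* At time index t the transmitter knows S(0), ..., S(l - 1), l = jsit c t. *)
Definition jsit (c : configuration) (t : nat) : nat :=
  match c with PP => t.+1 | PD => t | PN => 0 end.

Record broadcast_code (R : realType) (K : nat) (c : configuration) (n : nat) := BroadcastCode {
  sizes : 'I_K -> nat ;
  encoder : forall t : nat,
    K.-tuple nat * (t.+1).-tuple 'M[R[i]]_K * (jsit c t).-tuple (K.-tuple bool)
    -> 'cV[R[i]]_K ;
  decoder : 'I_K ->
    n.-tuple R[i] * n.-tuple 'M[R[i]]_K * n.-tuple (K.-tuple bool) -> nat ;
  sizes_gt0 : forall k, (0 < sizes k)%N ;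
  encoder_measurable : forall t, measurable_fun setT (@encoder t) ;
  decoder_measurable : forall k, measurable_fun setT (decoder k)
}.

Section transmission.
Context {d : measure_display} {Omega : measurableType d} {R : realType}
        {P : probability Omega R} {K : nat}.
Variable ch : jammed_broadcast_channel P K.

(* H(t), with k-th row H_k(t). *)
Definition csi (t : nat) (w : Omega) : 'M[R[i]]_K :=
  \matrix_(k, j) bc_H ch t k w 0 j.

Definition csi_upto (n : nat) (w : Omega) : n.-tuple 'M[R[i]]_K :=
  [tuple csi t w | t < n].

Definition jsi_upto (n : nat) (w : Omega) : n.-tuple (K.-tuple bool) :=
  [tuple bc_S ch t w | t < n].

Section one_code.
Context {c : configuration} {n : nat}.
Variables (PT : R) (C : broadcast_code R K c n).

Definition messages (w : Omega) : K.-tuple nat :=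
  [tuple bc_W ch (sizes C) k w | k < K].

Definition channel_input (t : nat) (w : Omega) : 'cV[R[i]]_K :=
  encoder C (messages w, csi_upto t.+1 w, jsi_upto (jsit c t) w).

Definition jammer_signal (t : nat) (w : Omega) : 'cV[R[i]]_K :=
  \col_j bc_J ch PT t j w.

Definition channel_output (k : 'I_K) (t : nat) (w : Omega) : R[i] :=
  (bc_H ch t k w *m channel_input t w) 0 0
  + (tnth (bc_S ch t w) k)%:R * (bc_G ch t k w *m jammer_signal t w) 0 0
  + bc_N ch t k w.

Definition decoded (k : 'I_K) (w : Omega) : nat :=
  decoder C k ([tuple channel_output k t w | t < n], csi_upto n w, jsi_upto n w).

Definition power_constraint : Prop :=
  forall t, (t < n)%N ->
    ('E_P[fun w => sqr_norm (channel_input t w)] <= PT%:E)%E.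

Definition error_probability (k : 'I_K) : \bar R :=
  P [set w | bc_W ch (sizes C) k w <> decoded k w].

Definition rate (k : 'I_K) : R := ln (sizes C k)%:R / n%:R.

End one_code.

Definition achievable (c : configuration) (PT : R) (r : 'I_K -> R) : Prop :=
  exists C : forall n, broadcast_code R K c n,
    [/\ forall n, power_constraint PT (C n),
        forall k, rate (C n) k @[n --> \oo] --> r k &
        forall k, error_probability PT (C n) k @[n --> \oo] --> 0%E].

Definition dof_region (c : configuration) : set ('I_K -> R) :=
  [set dof | exists r : R -> 'I_K -> R,
     (forall PT : R, 0 < PT -> achievable c PT (r PT)) /\
     (forall k, r PT k / ln PT @[PT --> +oo] --> dof k)].

End transmission.

(* Main.v *)
(* Converse, one receiver k at a time.  A slot with S_k = 1 carries almost nothing: given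
   everything but J_k, the output divided by G_kk is a complex Gaussian of variance P_T
   with an unknown mean.  Replacing the outputs one after the other by dummy variables
   with a product of Cauchy densities of scale sqrt(P_T) costs, per slot, the ratio of
   the two densities.  The logarithm of that ratio has mean O(1), or ln P_T + O(1) when
   the slot is unjammed (or G_kk is tiny) and the Gaussian is the receiver noise.  After
   the last replacement the decoder guesses W_k blindly, so Markov's inequality for the
   total cost bounds the rate by (lambda_k + eta) ln P_T + O(1).

   Achievability, without any jammer information.  Zero forcing with the adjugate of H
   gives every receiver its own QAM symbol, lost when it is jammed and, rarely, when H is
   ill-conditioned or the noise is large.  Gilbert-Varshamov codebooks over the QAM
   alphabet are decoded by maximal agreement with the output, and the weak law counts the
   losses; the margin in the degrees of freedom then shrinks as P_T grows. *)
Require Import Defs.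
From HB Require Import structures.
From mathcomp Require Import all_boot all_order all_algebra.
From mathcomp Require Import complex.
From mathcomp Require Import all_classical all_reals all_analysis.
From mathcomp Require Import measurable_realfun.
From mathcomp Require Import zify ring lra.

Set Implicit Arguments.
Unset Strict Implicit.
Unset Printing Implicit Defensive.
Import Order.TTheory GRing.Theory Num.Theory.
Import numFieldNormedType.Exports.
Local Open Scope classical_set_scope.
Local Open Scope ring_scope.

(** * Independence *)

Section independence.
Context {d : measure_display} {Omega : measurableType d} {R : realType}.
Variable P : probability Omega R.
Local Open Scope ereal_scope.

(** What shapes the converse is that the input may depend on [H], while [H] and [X] are only
    controlled in second moment, so the mean energy of [H X] need not be finite. A Gaussian dummy
    would charge that energy. Minus the logarithm of a Cauchy density grows only like the logarithm
    of the energy, which turns products into sums, and then second moments of the separate factors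
    suffice. The scale is the same in every slot, whichever Gaussian is replaced, so the two kinds
    of slot recombine after each replacement. The amount of jammer information does not matter
    there: an input is a function of messages, [H] and [S], never of the Gaussian being replaced. In
    the direct part the losses are of two kinds. Jammed or ill-conditioned slots are known to the
    receiver and act as erasures; a large noise goes undetected and may support a wrong symbol, so
    it is counted twice. The thresholds on [H] and on the noise are fixed before the power grows:
    they cost a small fraction of the slots and a bounded factor of power, and the crude counting of
    the codebooks costs [ln 2] per slot, negligible against [ln PT]. *)

Definition independent_systems (F G : set (set Omega)) : Prop :=
  forall A B, F A -> G B -> P (A `&` B) = P A * P B.

Lemma independent_systemsC F G :
  independent_systems F G -> independent_systems G F.
Proof. by move=> FG A B GA FB; rewrite setIC FG// muleC. Qed.

Lemma g_sigma_algebra_sub_measurable (F : set (set Omega)) :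
  F `<=` measurable -> <<s F >> `<=` @measurable _ Omega.
Proof.
move=> FG; apply: smallest_sub => //; exact: sigma_algebra_measurable.
Qed.

(** For fixed [B] the finite measures sending [A] to [P (A & B)] and to [P A * P B] agree on the
    pi-system [F], hence on the sigma-algebra it generates. *)
Lemma independent_g_sigma_algebral (F G : set (set Omega)) :
  setI_closed F -> F `<=` measurable -> G `<=` measurable -> F setT ->
  independent_systems F G -> independent_systems <<s F >> G.
Proof.
move=> FI mF mG FT FG A B sA GB.
have PB0 : (0 <= fine (P B))%R by exact: fine_ge0.
have PBE : (NngNum PB0)%:num%:E = P B.
  by rewrite /= fineK// fin_num_measure//; exact: mG.
pose m1 := mrestr P (mG _ GB).
pose m2 := mscale (NngNum PB0) P.
transitivity (m1 A); first by [].
transitivity (m2 A); last by rewrite /m2/= /mscale PBE muleC.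
apply: (@g_sigma_algebra_measure_unique _ _ _ F _ (fun=> setT)) => //.
- by rewrite bigcup_const.
- by move=> C FC; rewrite /m1 /m2 /= /mrestr /mscale PBE muleC FG.
- move=> _; rewrite /m1 /= /mrestr setTI.
  by rewrite ltey_eq fin_num_measure//; exact: (mG _ GB).
Qed.

Lemma independent_g_sigma_algebra (F G : set (set Omega)) :
  setI_closed F -> setI_closed G ->
  F `<=` measurable -> G `<=` measurable -> F setT -> G setT ->
  independent_systems F G -> independent_systems <<s F >> <<s G >>.
Proof.
move=> FI GI mF mG FT GT FG.
apply: independent_g_sigma_algebral => //.
  exact: g_sigma_algebra_sub_measurable.
apply: independent_systemsC; apply: independent_g_sigma_algebral => //.
exact: independent_systemsC.
Qed.

Section grouping.
Context {I : choiceType} (F : I -> set (set Omega)).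
Hypotheses (mF : forall i, F i `<=` measurable) (FI : forall i, setI_closed (F i))
  (FT : forall i, F i setT).
Hypothesis indepF : mutually_independent P F.

(** The pi-system on which independence of groups is tested; it contains every [F i] with [i] in [B]
    and stays inside the sigma-algebra they generate. *)
Let finite_inter (B : set I) : set (set Omega) :=
  [set A | exists s : seq I, exists E : I -> set Omega,
    [/\ uniq s, {in s, forall i, B i}, forall i, F i (E i) &
        A = \bigcap_(i in [set` s]) E i]].

Let finite_interI B : setI_closed (finite_inter B).
Proof.
move=> _ _ [s [E [us sB FE ->]]] [t [H [ut tB FH ->]]].
exists (undup (s ++ t)).
exists (fun i => (if i \in s then E i else setT) `&`
                 (if i \in t then H i else setT)); split.
- exact: undup_uniq.
- by move=> i; rewrite mem_undup mem_cat => /orP[/sB|/tB].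
- move=> i; apply: FI; case: ifP => // _.
- apply/seteqP; split=> w /=.
    move=> [Ew Hw] i /=; rewrite mem_undup mem_cat => _.
    by split; case: ifP => // ?; [exact: Ew|exact: Hw].
  move=> EHw; split=> i /= si.
    by have /= := EHw i; rewrite mem_undup mem_cat si => /(_ isT)[].
  by have /= := EHw i; rewrite mem_undup mem_cat si orbT => /(_ isT)[_].
Qed.

Let finite_inter_measurable B : finite_inter B `<=` measurable.
Proof.
move=> _ [s [E [us sB FE ->]]].
apply: fin_bigcap_measurable; first exact: finite_seq.
by move=> i _; apply: mF; exact: FE.
Qed.

Let finite_interT B : finite_inter B setT.
Proof.
exists [::], (fun=> setT); split => //.
by apply/esym/seteqP; split.
Qed.

Let sub_finite_inter B : \bigcup_(i in B) F i `<=` finite_inter B.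
Proof.
move=> A [i Bi FA].
exists [:: i], (fun j => if j == i then A else setT); split => //.
- by move=> j; rewrite inE => /eqP ->.
- by move=> j; case: eqP => [->|].
- apply/seteqP; split=> w /=.
    by move=> Aw j /=; rewrite inE => ->.
  by move=> /(_ i) /=; rewrite inE eqxx; exact.
Qed.

(** Finite intersections over two disjoint groups merge into one intersection along the concatenated
    index list, where the product formula splits in two; uniqueness of measures extends this to the
    generated sigma-algebras. *)
Lemma mutually_independent_group (B1 B2 : set I) : B1 `&` B2 = set0 ->
  independent_systems <<s \bigcup_(i in B1) F i >> <<s \bigcup_(i in B2) F i >>.
Proof.
move=> B12.
suff H : independent_systems <<s finite_inter B1 >> <<s finite_inter B2 >>.
  move=> A B sA sB; apply: H.
  - exact: sub_smallest2r (@sub_finite_inter B1) _ sA.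
  - exact: sub_smallest2r (@sub_finite_inter B2) _ sB.
apply: independent_g_sigma_algebra => //.
move=> _ _ [s [E [us sB FE ->]]] [t [H [ut tB FH ->]]].
have st : uniq (s ++ t).
  rewrite cat_uniq us ut andbT /=; apply/hasPn => i ti; apply/negP => si.
  have : (B1 `&` B2) i by split; [exact: sB|exact: tB].
  by rewrite B12.
have nst i : i \in t -> (i \in s) = false.
  move=> ti; apply/negP => si.
  have : (B1 `&` B2) i by split; [exact: sB|exact: tB].
  by rewrite B12.
pose EH i := if i \in s then E i else H i.
have -> : \bigcap_(i in [set` s]) E i `&` \bigcap_(i in [set` t]) H i =
          \bigcap_(i in [set` s ++ t]) EH i.
  apply/seteqP; split=> w /=.
    move=> [Ew Hw] i /=; rewrite mem_cat /EH.
    by case: ifP => [si _|_ ti]; [exact: Ew|exact: Hw].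
  move=> EHw; split=> i /= si.
    have := EHw i; rewrite /EH /= si; apply.
    by rewrite mem_cat si.
  have := EHw i; rewrite /EH /= nst//; apply.
  by rewrite mem_cat si orbT.
rewrite !indepF//; last by move=> i _; rewrite /EH; case: ifP.
rewrite big_cat /=; congr (_ * _).
  by apply: eq_big_seq => i; rewrite /EH => ->.
by apply: eq_big_seq => i; rewrite /EH => /nst ->.
Qed.

End grouping.

(** Padding with the trivial system [[set setT]], whose only event has probability 1, lets families
    with different index types share a single one. *)
Lemma mutually_independent_extend (I J : choiceType) (F : J -> set (set Omega))
    (g : I -> option J) (f : J -> I) :
  ocancel g f -> mutually_independent P F ->
  mutually_independent P
    (fun i => if g i is Some j then F j else [set setT]).
Proof.
move=> gK indF s E us sE.
have Egj i : i \in s -> g i = None -> E i = setT.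
  by move=> /sE; case: (g i).
have gf i j : g i = Some j -> f j = i by move=> gi; have := gK i; rewrite gi.
have -> : \bigcap_(i in [set` s]) E i =
          \bigcap_(j in [set` pmap g s]) E (f j).
  apply/seteqP; split=> w /= Ew i /=.
    by rewrite mem_pmap => /mapP[j js gj]; rewrite (gf j)//; exact: Ew.
  move=> si; case gi : (g i) => [j|]; last by rewrite Egj.
  rewrite -(gf _ _ gi); apply: Ew => /=; rewrite mem_pmap.
  by apply/mapP; exists i.
rewrite indF.
- elim: s us sE Egj => [|i s ih] /= us sE Egj; first by rewrite !big_nil.
  move: us => /andP[si us].
  have {ih} := ih us (fun j js => sE j (mem_behead (s := i :: s) js))
     (fun j js => Egj j (mem_behead (s := i :: s) js)).
  rewrite [X in _ -> _ = X]big_cons => <-.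
  case gi : (g i) => [j|] /=; first by rewrite big_cons (gf i).
  by rewrite (Egj i)// ?inE ?eqxx// probability_setT mul1e.
- exact: (pmap_uniq gK).
- move=> j; rewrite mem_pmap => /mapP[i si gi].
  by have := sE _ si; rewrite -gi (gf i)//.
Qed.

(** Sorting a finite intersection by its first index, independence between the processes gives a
    product over [a], and independence inside each process expands every factor. *)
Lemma mutually_independent_pair (A : finType) (T : choiceType)
    (F : A -> T -> set (set Omega)) :
  (forall a t, F a t `<=` measurable) ->
  (forall a, mutually_independent P (F a)) ->
  mutually_independent P (fun a => <<s \bigcup_(t in [set: T]) F a t >>) ->
  mutually_independent P (fun at_ : A * T => F at_.1 at_.2).
Proof.
move=> mF inF outF s E us sE.
pose sa a := [seq i.2 | i <- s & i.1 == a].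
have usa a : uniq (sa a).
  rewrite map_inj_in_uniq ?filter_uniq//.
  move=> [x1 x2] [y1 y2]; rewrite !mem_filter/= => /andP[/eqP -> _].
  by move=> /andP[/eqP -> _] ->.
have msa a t : (t \in sa a) = ((a, t) \in s).
  apply/mapP/idP.
    by move=> [[x1 x2]]; rewrite mem_filter/= => /andP[/eqP -> xs] ->.
  by move=> ats; exists (a, t) => //; rewrite mem_filter eqxx.
have -> : \bigcap_(i in [set` s]) E i =
    \bigcap_(a in [set` index_enum A]) \bigcap_(t in [set` sa a]) E (a, t).
  apply/seteqP; split=> w /= Ew.
    by move=> a _ t /=; rewrite msa => /Ew.
  move=> [a t] /= ats; apply: (Ew a) => /=; first by rewrite mem_index_enum.
  by rewrite msa.
rewrite outF ?index_enum_uniq//; last first.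
  move=> a _; have [->|sa0] := eqVneq (sa a) [::].
    have -> : \bigcap_(t in [set` [::]]) E (a, t) = setT.
      by apply/seteqP; split.
    exact: (@measurableT _ (g_sigma_algebraType (\bigcup_(t in [set: T]) F a t))).
  apply: (@fin_bigcap_measurable _
    (g_sigma_algebraType (\bigcup_(t in [set: T]) F a t))).
    exact: finite_seq.
  move=> t /=; rewrite msa => ats; apply: sub_sigma_algebra.
  by exists t => //; exact: (sE _ ats).
rewrite [RHS](partition_big (fun i => i.1) xpredT)//=.
apply: eq_bigr => a _.
rewrite (inF a (sa a) (fun t => E (a, t)))//; last by move=> t; rewrite msa => /sE.
rewrite /sa big_map big_filter big_seq_cond [RHS]big_seq_cond.
apply: eq_bigr => -[x1 x2] /= /andP[_ /eqP ->] //.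
Qed.

End independence.

(** * Fubini for a variable and a sigma-algebra independent of it *)

Section independent_fubini.
Context {d : measure_display} {Omega : measurableType d} {R : realType}.
Variable P : probability Omega R.
Variable G : set (set Omega).
Hypothesis mG : G `<=` measurable.
Context {d' : measure_display} {T : measurableType d'} (X : {RV P >-> T}).
Local Open Scope ereal_scope.

(** The identity, seen as a random variable with values in the sample space with the coarse
    sigma-algebra. Conditioning on everything but [X] thereby becomes Tonelli on a product space. *)
Definition coarsen (w : Omega) : g_sigma_algebraType G := w.

Lemma measurable_coarsen : measurable_fun setT coarsen.
Proof.
move=> _ A mA; rewrite setTI.
exact: (g_sigma_algebra_sub_measurable mG).
Qed.

HB.instance Definition _ := isMeasurableFun.Build _ _ _ _ coarsen measurable_coarsen.

Let coarse : {RV P >-> g_sigma_algebraType G} := coarsen.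
Let joint (w : Omega) : T * g_sigma_algebraType G := (X w, coarsen w).

Let measurable_joint : measurable_fun setT joint.
Proof. by apply: measurable_fun_pair => //; exact: measurable_coarsen. Qed.

HB.instance Definition _ := isMeasurableFun.Build _ _ _ _ joint measurable_joint.

Let jointRV : {RV P >-> (T * g_sigma_algebraType G)%type} := joint.

Hypothesis XG : independent_systems P (sigma_of X) <<s G >>.

Let joint_distribution A : measurable A ->
  (distribution P X \x distribution P coarse) A = distribution P jointRV A.
Proof.
apply: product_measure_unique => B C mB mC.
rewrite /distribution /pushforward.
transitivity (P (X @^-1` B `&` C)); first by [].
rewrite XG//.
by exists B => //; rewrite setTI.
Qed.

Variable f : T * g_sigma_algebraType G -> \bar R.
Hypotheses (mf : measurable_fun setT f) (f0 : forall z, 0 <= f z).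

Let inner x : \int[P]_w f (x, w) = \int[distribution P coarse]_w f (x, w).
Proof.
rewrite ge0_integral_distribution//.
exact: measurableT_comp.
Qed.

Lemma measurable_independent_inner :
  measurable_fun setT (fun x => \int[P]_w f (x, w)).
Proof.
rewrite (_ : (fun _ => _) = fubini_F (distribution P coarse) f).
  exact: measurable_fun_fubini_tonelli_F.
by apply/funext => x; rewrite inner.
Qed.

(** The law of the pair [(X, coarsen)] is the product of its marginals, so Tonelli integrates [X]
    out first with the rest of the sample frozen. This stands in for a conditional expectation
    throughout. *)
Lemma independent_fubini_swap :
  \int[P]_w f (X w, w) = \int[P]_w \int[distribution P X]_x f (x, w).
Proof.
transitivity (\int[distribution P jointRV]_z f z).
  by rewrite ge0_integral_distribution.
transitivity (\int[distribution P X \x distribution P coarse]_z f z).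
  apply: eq_measure_integral => A mA _; exact/esym/joint_distribution.
rewrite fubini_tonelli2//.
rewrite (@ge0_integral_distribution _ _ _ _ _ P coarse
  (fubini_G (distribution P X) f))//.
- exact: measurable_fun_fubini_tonelli_G.
- by move=> w; apply: integral_ge0.
Qed.

End independent_fubini.

Lemma independent_null_sections {d : measure_display} {Omega : measurableType d}
    {R : realType} (P : probability Omega R) (G : set (set Omega))
    {d' : measure_display} {T : measurableType d'} (X : {RV P >-> T})
    (A : set (T * g_sigma_algebraType G)) :
  G `<=` measurable -> independent_systems P (sigma_of X) <<s G >> ->
  measurable A ->
  (forall w, distribution P X [set x | A (x, w)] = 0%E) ->
  P [set w | A (X w, w)] = 0%E.
Proof.
move=> mG XG mA A0.
pose f (z : T * g_sigma_algebraType G) := (\1_A z)%:E : \bar R.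
have mf : measurable_fun setT f.
  by apply/measurable_EFinP; exact: measurable_indic.
have f0 z : (0 <= f z)%E by rewrite lee_fin.
have mAX : measurable [set w | A (X w, w)].
  rewrite -[X in measurable X]setTI.
  have mj : measurable_fun setT (fun w : Omega => (X w, w : g_sigma_algebraType G)).
    by apply: measurable_fun_pair => //; exact: measurable_coarsen.
  exact: mj.
rewrite -(setIT [set w | _]) -integral_indic//.
transitivity (\int[P]_w f (X w, w))%E; first by apply: eq_integral => w _.
rewrite (independent_fubini_swap mG XG mf f0).
apply: integral0_eq => w _.
under eq_integral.
  move=> x _.
  rewrite (_ : f (x, w) = (\1_[set x | A (x, w)] x)%:E); first over.
  by rewrite /f !indicE; congr (_%:R%:E); apply/idP/idP; rewrite !inE.
have mAw : measurable [set x | A (x, w)].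
  rewrite (_ : [set x | _] = ysection A w); first exact: measurable_ysection.
  by apply/seteqP; split=> x /=; rewrite /ysection/= inE.
by rewrite integral_indic// setIT; exact: A0.
Qed.

(** * Joint independence of all the channel variables *)

Section channel_independence.
Context {d : measure_display} {Omega : measurableType d} {R : realType}
        {P : probability Omega R} {K : nat}.
Variable ch : jammed_broadcast_channel P K.
Variables (PT : R) (M : 'I_K -> nat).
Hypotheses (PT_gt0 : 0 < PT) (M_gt0 : forall k, (0 < M k)%N).

Lemma mutually_independent_sub (I : choiceType) (F F' : I -> set (set Omega)) :
  (forall i, F i `<=` F' i) -> mutually_independent P F' ->
  mutually_independent P F.
Proof. by move=> FF' indF s E us sE; apply: indF => // i /sE /FF'. Qed.

(* A single index type for all the variables: antenna processes live at
   [(t, Some k)], the jammer state at [(t, None)], the messages at [(0, Some k)]. *)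
Definition antenna_index (i : nat * option 'I_K) : option (nat * 'I_K) :=
  omap (pair i.1) i.2.
Definition state_index (i : nat * option 'I_K) : option nat :=
  if i.2 is Some _ then None else Some i.1.
Definition message_index (i : nat * option 'I_K) : option 'I_K :=
  if i.1 is 0%N then i.2 else None.

Definition antenna_family (X : nat -> 'I_K -> set (set Omega)) i :=
  if antenna_index i is Some tk then X tk.1 tk.2 else [set setT].
Definition state_family (X : nat -> set (set Omega)) i :=
  if state_index i is Some t then X t else [set setT].
Definition message_family (X : 'I_K -> set (set Omega)) i :=
  if message_index i is Some k then X k else [set setT].

Definition channel_variables : 'I_6 * (nat * option 'I_K) -> set (set Omega) :=
  fun ai => tnth
    [tuple antenna_family (fun t k => sigma_of (bc_H ch t k));
           antenna_family (fun t k => sigma_of (bc_G ch t k));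
           antenna_family (fun t j => sigma_of (bc_J ch PT t j));
           state_family (fun t => sigma_of (bc_S ch t));
           antenna_family (fun t k => sigma_of (bc_N ch t k));
           message_family (fun k => sigma_of (bc_W ch M k))] ai.1 ai.2.

Definition index_H t k : 'I_6 * (nat * option 'I_K) := (@Ordinal 6 0 isT, (t, Some k)).
Definition index_G t k : 'I_6 * (nat * option 'I_K) := (@Ordinal 6 1 isT, (t, Some k)).
Definition index_J t j : 'I_6 * (nat * option 'I_K) := (@Ordinal 6 2 isT, (t, Some j)).
Definition index_S t : 'I_6 * (nat * option 'I_K) := (@Ordinal 6 3 isT, (t, None)).
Definition index_N t k : 'I_6 * (nat * option 'I_K) := (@Ordinal 6 4 isT, (t, Some k)).
Definition index_W k : 'I_6 * (nat * option 'I_K) := (@Ordinal 6 5 isT, (0%N, Some k)).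

Let antenna_indexK : ocancel antenna_index (fun tk => (tk.1, Some tk.2)).
Proof. by case=> t [k|]. Qed.

Let state_indexK : ocancel state_index (fun t => (t, None)).
Proof. by case=> t [k|]. Qed.

Let message_indexK : ocancel message_index (fun k => (0%N, Some k)).
Proof. by case=> -[|t] [k|]. Qed.

Lemma sigma_of_measurable {d'} {U : measurableType d'} (X : {RV P >-> U}) :
  sigma_of X `<=` measurable.
Proof.
move=> _ [B mB <-]; rewrite setTI -[X in measurable X]setTI.
exact: measurable_funPT.
Qed.

Lemma sigma_of_setI {d'} {U : measurableType d'} (X : {RV P >-> U}) :
  setI_closed (sigma_of X).
Proof.
move=> _ _ [B mB <-] [C mC <-]; exists (B `&` C); first exact: measurableI.
by rewrite !setTI.
Qed.

Lemma sigma_of_setT {d'} {U : measurableType d'} (X : {RV P >-> U}) :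
  sigma_of X setT.
Proof. by exists setT => //; rewrite setTI. Qed.

Ltac case_variables :=
  case=> -[[|[|[|[|[|[|//]]]]]] ?] [[|?] [?|]];
  rewrite /channel_variables (tnth_nth (fun=> set0))/=;
  rewrite ?/antenna_family ?/state_family ?/message_family /=.

Lemma channel_variables_measurable i : channel_variables i `<=` measurable.
Proof.
move: i; case_variables; try exact: sigma_of_measurable;
  by move=> _ ->; exact: measurableT.
Qed.

Lemma channel_variables_setI i : setI_closed (channel_variables i).
Proof.
move: i; case_variables; try exact: sigma_of_setI;
  by move=> _ _ -> ->; rewrite setIT.
Qed.

Lemma channel_variables_setT i : channel_variables i setT.
Proof.
move: i; case_variables; try exact: sigma_of_setT; by [].
Qed.

Lemma channel_variables_independent : mutually_independent P channel_variables.
Proof.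
apply: (@mutually_independent_pair _ _ _ P _ _
  (fun a i => channel_variables (a, i))).
- by move=> a i; exact: channel_variables_measurable.
- case=> -[|[|[|[|[|[|//]]]]]] ?; rewrite /channel_variables.
  + exact: mutually_independent_extend antenna_indexK (@H_indep _ _ _ _ _ ch).
  + exact: mutually_independent_extend antenna_indexK (@G_indep _ _ _ _ _ ch).
  + exact: mutually_independent_extend antenna_indexK (@J_indep _ _ _ _ _ ch _ PT_gt0).
  + exact: mutually_independent_extend state_indexK (@S_indep _ _ _ _ _ ch).
  + exact: mutually_independent_extend antenna_indexK (@N_indep _ _ _ _ _ ch).
  + exact: mutually_independent_extend message_indexK (@W_indep _ _ _ _ _ ch _ M_gt0).
- apply: mutually_independent_sub (@processes_indep _ _ _ _ _ ch _ _ PT_gt0 M_gt0) => a.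
  have sT (G : set (set Omega)) : <<s G >> setT.
    exact: (@measurableT _ (g_sigma_algebraType G)).
  have sub (Q : set (set Omega)) (X : nat * option 'I_K -> set (set Omega)) :
      (forall i, X i `<=` <<s Q >>) -> <<s \bigcup_(i in [set: _]) X i >> `<=` <<s Q >>.
    move=> XQ; apply: smallest_sub; first exact: smallest_sigma_algebra.
    by move=> A [i _ XA]; exact: XQ XA.
  move: a; case=> -[|[|[|[|[|[|//]]]]]] ?; rewrite !(tnth_nth (set0))/=;
    apply: sub => -[[|t] [k|]];
    rewrite /channel_variables (tnth_nth (fun=> set0))/=;
    rewrite ?/antenna_family ?/state_family ?/message_family /=;
    try (by move=> _ ->; exact: sT);
    move=> A FA; apply: sub_sigma_algebra;
    first [by exists (0%N, k)|by exists (t.+1, k)|by exists 0%N|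
           by exists t.+1|by exists k].
Qed.

(** Generators of the information carried by the coordinates in [B]. The converse takes for [B] all
    coordinates but one, the one about to be integrated out. *)
Definition generated_by (B : set ('I_6 * (nat * option 'I_K))) : set (set Omega) :=
  \bigcup_(i in B) channel_variables i.

Lemma generated_by_measurable B : generated_by B `<=` measurable.
Proof. by move=> A [i _ XA]; exact: channel_variables_measurable XA. Qed.

Lemma generated_by_independent B1 B2 : B1 `&` B2 = set0 ->
  independent_systems P <<s generated_by B1 >> <<s generated_by B2 >>.
Proof.
apply: mutually_independent_group.
- exact: channel_variables_measurable.
- exact: channel_variables_setI.
- exact: channel_variables_setT.
- exact: channel_variables_independent.
Qed.

Lemma sub_generated_by B (F : set (set Omega)) i : B i ->
  channel_variables i = F -> F `<=` <<s generated_by B >>.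
Proof. by move=> Bi <- A FA; apply: sub_sigma_algebra; exists i. Qed.

Lemma measurable_sub_sigma {d'} {U : measurableType d'} (X : {RV P >-> U})
    (G : set (set Omega)) : sigma_of X `<=` <<s G >> ->
  measurable_fun setT (X : g_sigma_algebraType G -> U).
Proof.
move=> XG _ A mA; rewrite setTI; apply: XG.
by exists A => //; rewrite setTI.
Qed.

End channel_independence.

(** * Measurability over the complex numbers *)

Section complex_measurability.
Context {R : realType} {d : measure_display} {T : measurableType d}.
Implicit Types f g : T -> R[i].

Lemma ReD (x y : R[i]) : complex.Re (x + y) = complex.Re x + complex.Re y.
Proof. by case: x y => [a b] [c e]. Qed.
Lemma ImD (x y : R[i]) : complex.Im (x + y) = complex.Im x + complex.Im y.
Proof. by case: x y => [a b] [c e]. Qed.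
Lemma ReM (x y : R[i]) : complex.Re (x * y) =
  complex.Re x * complex.Re y - complex.Im x * complex.Im y.
Proof. by case: x y => [a b] [c e]. Qed.
Lemma ImM (x y : R[i]) : complex.Im (x * y) =
  complex.Re x * complex.Im y + complex.Im x * complex.Re y.
Proof. by case: x y => [a b] [c e]. Qed.

Lemma measurable_Re : measurable_fun setT (@complex.Re R).
Proof.
move=> _ A mA; rewrite setTI.
exists (fst @^-1` A); first by rewrite -[X in measurable X]setTI; exact: measurable_fst.
by rewrite setTI.
Qed.

Lemma measurable_Im : measurable_fun setT (@complex.Im R).
Proof.
move=> _ A mA; rewrite setTI.
exists (snd @^-1` A); first by rewrite -[X in measurable X]setTI; exact: measurable_snd.
by rewrite setTI.
Qed.

Lemma measurable_complexP f : measurable_fun setT f <->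
  measurable_fun setT (@complex.Re R \o f) /\ measurable_fun setT (@complex.Im R \o f).
Proof.
split=> [mf|[mr mi] _ A [B mB <-]].
  by split; apply: measurableT_comp => //; [exact: measurable_Re|exact: measurable_Im].
rewrite setTI -[X in measurable X]setTI.
have mri : measurable_fun setT (fun x => (complex.Re (f x), complex.Im (f x))).
  exact: measurable_fun_pair.
by have := mri measurableT _ mB; rewrite !setTI.
Qed.

Lemma measurable_RefT f : measurable_fun setT f ->
  measurable_fun setT (fun x => complex.Re (f x)).
Proof. by move=> /measurable_complexP[]. Qed.

Lemma measurable_ImfT f : measurable_fun setT f ->
  measurable_fun setT (fun x => complex.Im (f x)).
Proof. by move=> /measurable_complexP[]. Qed.

Lemma measurable_complex (f g : T -> R) : measurable_fun setT f ->
  measurable_fun setT g ->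
  measurable_fun setT (fun x => (f x +i* g x)%C).
Proof. by move=> mf mg; apply/measurable_complexP; split. Qed.

Lemma measurable_complexD f g : measurable_fun setT f -> measurable_fun setT g ->
  measurable_fun setT (fun x => f x + g x).
Proof.
move=> mf mg; apply/measurable_complexP; split.
  rewrite (_ : _ \o _ = fun x => complex.Re (f x) + complex.Re (g x)); last first.
    by apply/funext => x /=; rewrite ReD.
  by apply: measurable_funD; exact: measurable_RefT.
rewrite (_ : _ \o _ = fun x => complex.Im (f x) + complex.Im (g x)); last first.
  by apply/funext => x /=; rewrite ImD.
by apply: measurable_funD; exact: measurable_ImfT.
Qed.

Lemma measurable_complexM f g : measurable_fun setT f -> measurable_fun setT g ->
  measurable_fun setT (fun x => f x * g x).
Proof.
move=> mf mg; apply/measurable_complexP; split.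
  rewrite (_ : _ \o _ = fun x => complex.Re (f x) * complex.Re (g x) -
     complex.Im (f x) * complex.Im (g x)); last first.
    by apply/funext => x /=; rewrite ReM.
  by apply: measurable_funB; apply: measurable_funM;
    by [exact: measurable_RefT|exact: measurable_ImfT].
rewrite (_ : _ \o _ = fun x => complex.Re (f x) * complex.Im (g x) +
   complex.Im (f x) * complex.Re (g x)); last first.
  by apply/funext => x /=; rewrite ImM.
by apply: measurable_funD; apply: measurable_funM;
  by [exact: measurable_RefT|exact: measurable_ImfT].
Qed.

Lemma measurable_complex_conj f : measurable_fun setT f ->
  measurable_fun setT (fun x => conjc (f x)).
Proof.
move=> mf; apply/measurable_complexP; split.
  rewrite (_ : _ \o _ = fun x => complex.Re (f x)); first exact: measurable_RefT.
  by apply/funext => x /=; case: (f x).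
rewrite (_ : _ \o _ = fun x => - complex.Im (f x)); last first.
  by apply/funext => x /=; case: (f x).
by apply: measurable_funN; exact: measurable_ImfT.
Qed.

Lemma measurable_complex_sum (I : Type) (s : seq I) (p : pred I) (f : I -> T -> R[i]) :
  (forall i, measurable_fun setT (f i)) ->
  measurable_fun setT (fun x => \sum_(i <- s | p i) f i x).
Proof.
move=> mf; elim: s => [|i s ih].
  by under eq_fun do rewrite big_nil; exact: measurable_cst.
under eq_fun do rewrite big_cons.
by case: (p i) => //; exact: measurable_complexD.
Qed.

Lemma measurable_complex_prod (I : Type) (s : seq I) (p : pred I) (f : I -> T -> R[i]) :
  (forall i, measurable_fun setT (f i)) ->
  measurable_fun setT (fun x => \prod_(i <- s | p i) f i x).
Proof.
move=> mf; elim: s => [|i s ih].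
  by under eq_fun do rewrite big_nil; exact: measurable_cst.
under eq_fun do rewrite big_cons.
by case: (p i) => //; exact: measurable_complexM.
Qed.

Lemma measurable_sqr_mod f : measurable_fun setT f ->
  measurable_fun setT (fun x => sqr_mod (f x)).
Proof.
move=> mf; apply: measurable_funD; apply: measurable_funX.
  exact: measurable_RefT.
exact: measurable_ImfT.
Qed.

Lemma sqr_mod_ge0 (z : R[i]) : 0 <= sqr_mod z.
Proof. by rewrite addr_ge0// sqr_ge0. Qed.

Lemma measurable_complexV f : measurable_fun setT f ->
  measurable_fun setT (fun x => (f x)^-1).
Proof.
move=> mf.
have mV : measurable_fun setT (fun x => (sqr_mod (f x))^-1).
  under eq_fun => x do rewrite -powR_inv1 ?sqr_mod_ge0//.
  exact: (measurableT_comp (@measurable_powR R (-1)) (measurable_sqr_mod mf)).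
apply/measurable_complexP; split.
  rewrite (_ : _ \o _ = fun x => complex.Re (f x) * (sqr_mod (f x))^-1); last first.
    by apply/funext => x /=; case: (f x).
  by apply: measurable_funM => //; exact: measurable_RefT.
rewrite (_ : _ \o _ = fun x => - (complex.Im (f x) * (sqr_mod (f x))^-1)); last first.
  by apply/funext => x /=; case: (f x).
by apply: measurable_funN; apply: measurable_funM => //; exact: measurable_ImfT.
Qed.

End complex_measurability.

Section matrix_measurability.
Context {d d' : measure_display} {T : measurableType d} {U : measurableType d'}.

Lemma measurable_mx_entry m n (i : 'I_m) (j : 'I_n) :
  measurable_fun setT (fun A : 'M[U]_(m, n) => A i j).
Proof.
move=> _ B mB; apply: sub_sigma_algebra.
by exists (i, j) => //; exists B.
Qed.

Lemma measurable_mxP m n (f : T -> 'M[U]_(m, n)) : measurable_fun setT f <->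
  forall i j, measurable_fun setT (fun x => f x i j).
Proof.
split=> [mf i j|mf].
  exact: (measurableT_comp (@measurable_mx_entry _ _ i j) mf).
move=> _ A mA; rewrite setTI.
have : <<s \bigcup_(ij in [set: 'I_m * 'I_n])
    preimage_set_system setT (fun A : 'M[U]_(m, n) => A ij.1 ij.2) measurable >>
  `<=` [set B | d.-measurable (f @^-1` B)].
  apply: smallest_sub.
    split => /=.
    - by rewrite preimage_set0; exact: measurable0.
    - by move=> B mB; rewrite setTD preimage_setC; exact: measurableC.
    - by move=> F mF; rewrite preimage_bigcup; exact: bigcup_measurable.
  move=> _ [[i j] _ [B mB <-]] /=; rewrite setTI.
  by have := mf i j measurableT _ mB; rewrite setTI.
exact.
Qed.

End matrix_measurability.

Section matrix_functions.
Context {R : realType} {d : measure_display} {T : measurableType d}.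

Lemma measurable_mulmx m n p (f : T -> 'M[R[i]]_(m, n)) (g : T -> 'M[R[i]]_(n, p)) :
  measurable_fun setT f -> measurable_fun setT g ->
  measurable_fun setT (fun x => f x *m g x).
Proof.
move=> mf mg; apply/measurable_mxP => i j.
under eq_fun do rewrite mxE.
apply: measurable_complex_sum => k.
by apply: measurable_complexM; [move/measurable_mxP: mf|move/measurable_mxP: mg].
Qed.

Lemma measurable_det n (f : T -> 'M[R[i]]_n) : measurable_fun setT f ->
  measurable_fun setT (fun x => \det (f x)).
Proof.
move=> mf; rewrite /determinant.
apply: measurable_complex_sum => s; apply: measurable_complexM => //.
by apply: measurable_complex_prod => i; move/measurable_mxP: mf.
Qed.

Lemma measurable_cofactor n (f : T -> 'M[R[i]]_n) i j : measurable_fun setT f ->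
  measurable_fun setT (fun x => cofactor (f x) i j).
Proof.
move=> mf; rewrite /cofactor; apply: measurable_complexM => //.
apply: measurable_det; apply/measurable_mxP => k l.
under eq_fun do rewrite !mxE.
exact: (measurable_mxP f).1 mf _ _.
Qed.

End matrix_functions.

(** The value depends on finitely many Boolean tests only, so a preimage is the finite union, over
    the accepted truth tables, of finite intersections of test outcomes. This covers the decoder and
    the search over cofactors. *)
Lemma measurable_finite_tests {d d' : measure_display} {T : measurableType d}
    {U : measurableType d'} (I : finType) (b : I -> T -> bool) (h : {ffun I -> bool} -> U) :
  (forall i, measurable_fun setT (b i)) ->
  measurable_fun setT (fun x => h [ffun i => b i x]).
Proof.
move=> mb _ A _; rewrite setTI.
rewrite (_ : _ @^-1` A =
  \bigcup_(v in [set v : {ffun I -> bool} | A (h v)])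
    \bigcap_(i in [set: I]) (b i @^-1` [set v i])); last first.
  apply/seteqP; split=> x /=.
    by move=> Ax; exists [ffun i => b i x] => // i _ /=; rewrite ffunE.
  move=> [v /= Av bv]; rewrite (_ : [ffun i => b i x] = v)//.
  by apply/ffunP => i; rewrite ffunE; exact: bv.
apply: fin_bigcup_measurable; first exact: finite_finset.
move=> v _; apply: fin_bigcap_measurable; first exact: finite_finset.
by move=> i _; rewrite -[X in measurable X]setTI; exact: mb.
Qed.

(** * Almost sure non-degeneracy of the channel *)

Section null_hyperplanes.
Context {R : realType}.

Lemma lebesgue_integral_CK_eq0 (K : nat) (f : 'rV[R[i]]_K -> \bar R) :
  (forall v, f v = 0%E) -> lebesgue_integral_CK f = 0%E.
Proof.
elim: K f => [|K ih] f f0 /=; first exact: f0.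
apply: integral0_eq => x _; apply: integral0_eq => y _.
exact: ih.
Qed.

Lemma integral_eq0_outside_point (r : R) (f : R -> \bar R) :
  (forall x, x != r -> f x = 0%E) -> (\int[@lebesgue_measure R]_x f x = 0)%E.
Proof.
move=> f0; rewrite -(integral_set1 f r) [RHS]integral_mkcond.
apply: eq_integral => x _; rewrite patchE; case: ifPn => //.
by rewrite notin_setE /= => /eqP/f0.
Qed.

(** Induction on the dimension. If some later coefficient is nonzero, the inner integral vanishes
    for every first coordinate. Otherwise the equation fixes the first coordinate, and for each real
    part the integrand lives on a single imaginary part. *)
Lemma lebesgue_integral_CK_hyperplane (K : nat) (a : 'cV[R[i]]_K) (b : R[i])
    (f : 'rV[R[i]]_K -> \bar R) :
  a != 0 -> (forall v, (v *m a) 0 0 != b -> f v = 0%E) ->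
  lebesgue_integral_CK f = 0%E.
Proof.
elim: K a b f => [|K ih] a b f; first by rewrite flatmx0 eqxx.
pose a1 : 'cV_1 := @usubmx _ 1 K 1 a; pose a2 : 'cV_K := @dsubmx _ 1 K 1 a.
have -> : a = col_mx a1 a2 by exact/esym/(@vsubmxK _ 1 K 1).
move=> a0 f0.
have dotE z (v : 'rV_K) :
    (row_mx (const_mx z : 'rV[R[i]]_1) v *m col_mx a1 a2) 0 0 =
    z * a1 0 0 + (v *m a2) 0 0.
  by rewrite mul_row_col mxE mxE big_ord1 mxE.
have [a20|a20] := eqVneq a2 0; last first.
  rewrite /=; apply: integral0_eq => x _; apply: integral0_eq => y _.
  apply: (ih a2 (b - (x +i* y)%C * a1 0 0)) => // v vb.
  by apply: f0; rewrite dotE; apply: contra_neq vb => <-; rewrite addrAC subrr add0r.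
have a10 : a1 0 0 != 0.
  apply: contra_neq a0 => a10.
  rewrite a20 (_ : a1 = 0) ?col_mx0//.
  by apply/matrixP => i j; rewrite !ord1 a10 mxE.
pose z := b / a1 0 0.
rewrite /=; apply: integral0_eq => x _.
apply: (@integral_eq0_outside_point (complex.Im z)) => y yz.
apply: lebesgue_integral_CK_eq0 => v; apply: f0.
rewrite dotE a20 mulmx0 [X in _ + X]mxE addr0.
apply: contra_neq yz => zb.
by rewrite /z -zb mulfK.
Qed.

Lemma measurable_complex_eq {d : measure_display} {T : measurableType d}
    (f g : T -> R[i]) : measurable_fun setT f -> measurable_fun setT g ->
  measurable [set x | f x = g x].
Proof.
move=> mf mg.
rewrite (_ : [set _ | _] = [set x | complex.Re (f x) == complex.Re (g x)] `&`
   [set x | complex.Im (f x) == complex.Im (g x)]); last first.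
  apply/seteqP; split=> x /=; first by move=> ->; rewrite !eqxx.
  by case: (f x) (g x) => [a b] [c e] /= [/eqP -> /eqP ->].
apply: measurableI; rewrite -[X in measurable X]setTI.
  by apply: (measurable_fun_eqr (measurable_RefT mf) (measurable_RefT mg) measurableT _) => //.
by apply: (measurable_fun_eqr (measurable_ImfT mf) (measurable_ImfT mg) measurableT _) => //.
Qed.

Lemma density_null_hyperplane {d : measure_display} {Omega : measurableType d}
    (P : probability Omega R) (K : nat) (X : {RV P >-> 'rV[R[i]]_K})
    (a : 'cV[R[i]]_K) (b : R[i]) :
  has_density X -> a != 0 ->
  distribution P X [set v | (v *m a) 0 0 = b] = 0%E.
Proof.
move=> [f [mf f0 fX]] a0.
have mA : measurable [set v : 'rV[R[i]]_K | (v *m a) 0 0 = b].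
  apply: measurable_complex_eq => //.
  have m1 : measurable_fun setT (fun v : 'rV[R[i]]_K => v *m a).
    by apply: measurable_mulmx.
  exact: (measurable_mxP _).1 m1 0 0.
rewrite fX//; apply: (lebesgue_integral_CK_hyperplane (b := b) a0) => v vb.
rewrite indicE memNset ?mulr0//=.
exact/eqP.
Qed.

End null_hyperplanes.

Section channel_nondegenerate.
Context {d : measure_display} {Omega : measurableType d} {R : realType}
        {P : probability Omega R} {K : nat}.
Variable ch : jammed_broadcast_channel P K.

(** The hyperplane normal to a basis vector. Consequently a small direct jamming coefficient has
    small probability, whatever the density. *)
Lemma null_G_entry t k j : P [set w | bc_G ch t k w 0 j = 0] = 0%E.
Proof.
have e0 : (delta_mx j 0 : 'cV[R[i]]_K) != 0.
  by apply/eqP => /matrixP/(_ j 0); rewrite !mxE !eqxx => /eqP; rewrite oner_eq0.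
have := density_null_hyperplane 0 (G_density ch t k) e0.
rewrite /distribution /pushforward => <-; congr (P _).
apply/seteqP; split=> w /=; rewrite -colE mxE //.
Qed.

(** Interpolates between the identity, of determinant 1, and the channel matrix, exposing one random
    row at a time. *)
Definition partial_csi t (i : nat) (w : Omega) : 'M[R[i]]_K :=
  \matrix_(k, j) if (k < i)%N then bc_H ch t k w 0 j else (k == j)%:R.

Let cofactor_partial_csi t (i : 'I_K) w j :
  cofactor (partial_csi t i.+1 w) i j = cofactor (partial_csi t i w) i j.
Proof.
rewrite /cofactor; congr (_ * \det _); apply/matrixP => k l; rewrite !mxE.
by rewrite ltnS leq_eqVlt (negbTE (_ : (lift i k != i :> nat)))// eq_sym neq_lift.
Qed.

Lemma measurable_bc_H_entry t k j :
  measurable_fun setT (fun w => bc_H ch t k w 0 j).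
Proof. exact: (measurableT_comp (@measurable_mx_entry _ _ _ _ 0 j)). Qed.

(** After exposing row [i] the determinant is a linear form in that row, with cofactors independent
    of it as coefficients. If the previous determinant is nonzero, these do not all vanish, and the
    row avoids their hyperplane almost surely. *)
Lemma null_det_csi t : P [set w | \det (csi ch t w) = 0] = 0%E.
Proof.
have mpart i : measurable_fun setT (partial_csi t i).
  apply/measurable_mxP => k j; under eq_fun do rewrite mxE.
  by case: (k < i)%N; [exact: measurable_bc_H_entry|exact: measurable_cst].
have mdet i : measurable [set w | \det (partial_csi t i w) = 0].
  by apply: measurable_complex_eq => //; exact: measurable_det.
have -> : csi ch t = partial_csi t K.
  by apply/funext => w; apply/matrixP => k j; rewrite !mxE ltn_ord.
suff H i : (i <= K)%N -> P [set w | \det (partial_csi t i w) = 0] = 0%E by exact: H.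
elim: i => [_|i ih iK].
  rewrite (_ : [set w | _] = set0) ?measure0//.
  apply/seteqP; split=> w //=.
  rewrite (_ : partial_csi t 0 w = 1%:M) ?det1; first by move/eqP; rewrite oner_eq0.
  by apply/matrixP => k j; rewrite !mxE.
pose r := Ordinal iK.
pose B := ~` [set index_H t r].
(* The power 1 and the alphabet sizes 1 are placeholders: the law of [H] involves neither. *)
pose G := generated_by ch 1 (fun=> 1%N) B.
have mG : G `<=` measurable by exact: generated_by_measurable.
have rG : independent_systems P (sigma_of (bc_H ch t r)) <<s G >>.
  move=> A C XA GC.
  apply: (@generated_by_independent _ _ _ _ _ ch 1 (fun=> 1%N) ltr01 (fun=> isT)
    [set index_H t r] B (setICr _)) => //.
  exact: (sub_generated_by (i := index_H t r)) XA.
pose cof w : 'cV[R[i]]_K := \col_j cofactor (partial_csi t i w) r j.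
have mcof : measurable_fun setT (cof : g_sigma_algebraType G -> _).
  apply/measurable_mxP => j l; under eq_fun do rewrite mxE.
  apply: measurable_cofactor; apply/measurable_mxP => k m.
  under eq_fun do rewrite mxE.
  have [ki|_] := boolP (k < i)%N; last exact: measurable_cst.
  apply: (measurableT_comp (@measurable_mx_entry _ _ _ _ 0 m)).
  apply: measurable_sub_sigma; apply: (sub_generated_by (i := index_H t k)) => //.
  by move=> [kr]; move: ki; rewrite kr ltnn.
pose A := [set xw : 'rV[R[i]]_K * g_sigma_algebraType G |
   (xw.1 *m cof xw.2) 0 0 = 0 /\ cof xw.2 != 0].
have mA : measurable A.
  have -> : A = [set xw | (xw.1 *m cof xw.2) 0 0 = 0] `&`
      (\bigcup_(j in [set: 'I_K]) ~` [set xw | cof xw.2 j 0 = 0]).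
    apply/seteqP; split=> -[x w] /= [xw0 c0]; split => //.
      apply: contrapT => c0'; move/eqP: c0; apply.
      apply/matrixP => j l; rewrite ord1 [RHS]mxE; apply: contrapT => cj.
      by apply: c0'; exists j.
    move: c0 => [j _ /= cj]; apply/eqP => c0; apply: cj.
    by rewrite c0 mxE.
  have mc2 : measurable_fun setT
      (fun xw : 'rV[R[i]]_K * g_sigma_algebraType G => cof xw.2).
    exact: (measurableT_comp mcof).
  apply: measurableI.
    apply: measurable_complex_eq => //.
    have m1 : measurable_fun setT
        (fun xw : 'rV[R[i]]_K * g_sigma_algebraType G => xw.1 *m cof xw.2).
      exact: measurable_mulmx.
    exact: (measurable_mxP _).1 m1 0 0.
  apply: fin_bigcup_measurable; first exact: finite_finset.
  move=> j _; apply: measurableC; apply: measurable_complex_eq => //.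
  exact: (measurable_mxP _).1 mc2 j 0.
have A0 : P [set w | A (bc_H ch t r w, w)] = 0%E.
  apply: independent_null_sections => // w.
  have [c0|c0] := eqVneq (cof w) 0.
    rewrite (_ : [set x | _] = set0) ?measure0//.
    by apply/seteqP; split=> x //= []; rewrite c0 eqxx.
  rewrite (_ : [set x | _] = [set x | (x *m cof w) 0 0 = 0]).
    exact: density_null_hyperplane (H_density ch t r) c0.
  by apply/seteqP; split=> x //= [].
have mAw : measurable [set w | A (bc_H ch t r w, w)].
  rewrite -[X in measurable X]setTI.
  have mj : measurable_fun setT (fun w : Omega => (bc_H ch t r w, w : g_sigma_algebraType G)).
    by apply: measurable_fun_pair => //; exact: measurable_coarsen.
  exact: mj.
apply/eqP; rewrite eq_le measure_ge0 andbT.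
apply: (@le_trans _ _ (P ([set w | \det (partial_csi t i w) = 0] `|`
                          [set w | A (bc_H ch t r w, w)]))).
  apply: le_measure; rewrite ?inE//; first exact: measurableU.
  move=> w /= det0.
  have [di|di] := eqVneq (\det (partial_csi t i w)) 0; [by left|right].
  split.
    rewrite -det0 (expand_det_row _ r) mxE; apply: eq_bigr => j _.
    by have /= -> := cofactor_partial_csi t r w j; rewrite !mxE /= ltnSn.
  apply: contra_neq di => c0; rewrite (expand_det_row _ r).
  apply: big1 => j _; have /matrixP/(_ j 0) := c0.
  by rewrite !mxE /= => ->; rewrite mulr0.
have U : (P [set w | (\det (partial_csi t i w) = 0)%R] +
          P [set w | A (bc_H ch t r w, w)] <= 0)%E.
  by rewrite A0 adde0 ih// ltnW.
by apply: le_trans U; exact: measureU2.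
Qed.

End channel_nondegenerate.

(** * Replacing a Gaussian by a Cauchy dummy variable *)

Section integral_comparison.
Context {R : realType}.
Local Open Scope ereal_scope.

Import HBNNSimple.

Lemma le_measure_integral {d : measure_display} {T : measurableType d}
    (m1 m2 : {measure set T -> \bar R}) (f : T -> \bar R) :
  (forall A, measurable A -> m1 A <= m2 A) -> (forall x, 0 <= f x) ->
  \int[m1]_x f x <= \int[m2]_x f x.
Proof.
move=> m12 f0; rewrite !ge0_integralTE//.
apply: ge_ereal_sup => _ [h hf <-].
apply: (@le_trans _ _ (sintegral m2 h)); last by apply: ereal_sup_ubound; exists h.
rewrite !sintegralE; apply: lee_fsum => // r [x _ <-].
by rewrite lee_wpmul2l ?lee_fin//; exact: m12.
Qed.

(* Unlike [ge0_le_integral], this needs no measurability. *)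
Lemma ge0_le_integralT {d : measure_display} {T : measurableType d}
    (m : {measure set T -> \bar R}) (f g : T -> \bar R) :
  (forall x, 0 <= f x) -> (forall x, f x <= g x) ->
  \int[m]_x f x <= \int[m]_x g x.
Proof.
move=> f0 fg; rewrite !ge0_integralTE//; last by move=> x; exact: le_trans (fg x).
apply: ereal_sup_le => _ [h hf <-]; exists h => // x.
exact: le_trans (fg x).
Qed.

Lemma lebesgue_integral_shift (f : R -> \bar R) (b : R) :
  measurable_fun setT f -> (forall x, 0 <= f x) ->
  \int[lebesgue_measure]_x f (x + b)%R = \int[lebesgue_measure]_x f x.
Proof.
move=> mf f0.
pose shift (x : R) : measurableTypeR R := (x + b)%R.
have mshift : measurable_fun setT shift by exact: measurable_funD.
have shiftE (A : set R) : measurable A ->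
    pushforward lebesgue_measure shift A = lebesgue_measure A.
  move=> mA; apply/esym/lebesgue_measure_unique => //= _ [[x y]] _ <-.
  rewrite /pushforward (_ : _ @^-1` _ = `]x - b, y - b]%classic%R); last first.
    apply/seteqP; split=> z /=; rewrite /shift !in_itv/= => /andP[? ?];
      by apply/andP; split; lra.
  rewrite !lebesgue_measure_itv/= !lte_fin ltrD2r.
  by case: ifP => // _; rewrite -!EFinD; congr EFin; lra.
transitivity (\int[pushforward lebesgue_measure shift]_x f x).
  by rewrite ge0_integral_pushforward.
by apply: eq_measure_integral => //= A mA _; exact: shiftE.
Qed.

Definition cauchy_density (a x : R) : R := (a / (pi * (a ^+ 2 + x ^+ 2)))%R.

Lemma cauchy_density_ge0 a x : (0 < a)%R -> (0 <= cauchy_density a x)%R.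
Proof.
move=> a0; rewrite /cauchy_density divr_ge0 ?(ltW a0)// mulr_ge0 ?pi_ge0//.
by rewrite addr_ge0 ?sqr_ge0.
Qed.

Lemma measurable_cauchy_density a : (0 < a)%R ->
  measurable_fun setT (cauchy_density a).
Proof.
move=> a0; apply: continuous_measurable_fun => x.
apply: cvgM; first exact: cvg_cst.
apply: cvgV.
  by rewrite gt_eqF// mulr_gt0 ?pi_gt0// ltr_wpDr ?sqr_ge0 ?exprn_gt0.
apply: cvgM; first exact: cvg_cst.
apply: (@cvgD _ R^o); first exact: cvg_cst.
exact: sqr_continuous.
Qed.

Lemma integral_cauchy_density a : (0 < a)%R ->
  \int[lebesgue_measure]_x (cauchy_density a x)%:E = 1.
Proof.
move=> a0.
pose F (x : R^o) := (x / a)%R : R^o.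
have dF x : derivable F x 1 by [].
have F'E : F^`()%classic = cst a^-1%R.
  apply/funext => x; rewrite /F derive1E deriveM// derive_id derive_cst scaler0 add0r.
  by rewrite scaler1.
have oneD_T : \int[lebesgue_measure]_x ((oneDsqr x)^-1)%:E = (pi : R)%:E.
  rewrite (@ge0_symfun_integralT _ (fun x => (oneDsqr x)^-1%R)).
  - rewrite -set_itvcy integral0y_oneDsqr -EFinM; congr EFin.
    by field.
  - by move=> x; rewrite invr_ge0.
  - exact: continuous_oneDsqrV.
  - by move=> x /=; rewrite /oneDsqr sqrrN.
transitivity (\int[lebesgue_measure]_x
   ((pi^-1)%:E * ((((fun x => (oneDsqr x)^-1%R) \o F) * (F^`())%classic)%R x)%:E)).
  apply: eq_integral => x _; rewrite -EFinM; congr EFin.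
  rewrite F'E /cauchy_density /oneDsqr /F /= !fctE/=.
  have := pi_gt0 R; move: (pi : R) => p p0; field.
  by rewrite !gt_eqF// ltr_wpDr ?sqr_ge0 ?exprn_gt0.
rewrite ge0_integralZl//=.
- rewrite -increasing_ge0_integration_by_substitutionT//.
  + by rewrite oneD_T -EFinM mulVf// gt_eqF ?pi_gt0.
  + by move=> x y xy; rewrite /F ltr_pM2r ?invr_gt0.
  + by rewrite F'E => ?; exact: cvg_cst.
  + by rewrite F'E; exact: is_cvg_cst.
  + by rewrite F'E; exact: is_cvg_cst.
  + by apply/gt0_cvgMlNy; rewrite ?invr_gt0//; exact: cvg_id.
  + by apply/gt0_cvgMly; rewrite ?invr_gt0//; exact: cvg_id.
  + exact: continuous_oneDsqrV.
- apply/measurable_EFinP; rewrite F'E; apply: measurable_funM => //.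
  apply: (@measurableT_comp _ _ _ _ _ _ (fun x : R => (oneDsqr x)^-1%R)).
    by apply: continuous_measurable_fun; exact: continuous_oneDsqrV.
  exact: measurable_funM.
- by move=> x _; rewrite F'E lee_fin /= mulr_ge0 ?invr_ge0// ltW.
- by rewrite lee_fin invr_ge0 pi_ge0.
Qed.

Lemma normal_prob_le_lebesgue (s : R) (A : set R) : (s != 0)%R -> measurable A ->
  normal_prob 0 s A <= (normal_peak s)%:E * lebesgue_measure A.
Proof.
move=> s0 mA; rewrite -integral_cst//=.
apply: ge0_le_integral => //=.
- by move=> x _; rewrite lee_fin normal_pdf_ge0.
- by apply/measurable_EFinP/measurable_funTS; exact: measurable_normal_pdf.
- by move=> x _; rewrite lee_fin normal_pdf_ub.
Qed.

Lemma integral_normal_prob_le (s : R) (f : R -> \bar R) : (s != 0)%R ->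
  measurable_fun setT f -> (forall x, 0 <= f x) ->
  \int[normal_prob 0 s]_x f x <= (normal_peak s)%:E * \int[lebesgue_measure]_x f x.
Proof.
move=> s0 mf f0.
pose c := NngNum (normal_peak_ge0 s).
rewrite (_ : (normal_peak s)%:E = c%:num%:E)// -ge0_integral_mscale//.
by apply: le_measure_integral => // A mA; exact: normal_prob_le_lebesgue.
Qed.

End integral_comparison.

Section gaussian_step.
Context {d : measure_display} {Omega : measurableType d} {R : realType}.
Variable P : probability Omega R.
Local Open Scope ereal_scope.

Local Notation leb := (@lebesgue_measure R).

Lemma measurable_mkcomplex :
  measurable_fun setT (fun xy : R * R => (xy.1 +i* xy.2)%C).
Proof. exact: measurable_complex. Qed.

Lemma circular_gaussian_integral (v : R) (Z : {RV P >-> R[i]}) (f : R[i] -> \bar R) :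
  circular_gaussian v Z -> measurable_fun setT f -> (forall z, 0 <= f z) ->
  \int[distribution P Z]_z f z =
  \int[normal_prob 0 (Num.sqrt (v / 2))]_x \int[normal_prob 0 (Num.sqrt (v / 2))]_y
    f (x +i* y)%C.
Proof.
move=> gZ mf f0.
pose Zri (w : Omega) : measurableTypeR R * measurableTypeR R :=
  (complex.Re (Z w), complex.Im (Z w)).
have mZri : measurable_fun setT Zri.
  by apply: measurable_fun_pair; [exact: measurable_RefT|exact: measurable_ImfT].
pose Zc : {RV P >-> (measurableTypeR R * measurableTypeR R)%type} := HB.pack Zri (isMeasurableFun.Build _ _ _ _ _ mZri).
pose g (xy : measurableTypeR R * measurableTypeR R) := f (xy.1 +i* xy.2)%C.
have mg : measurable_fun setT g by exact: (measurableT_comp mf measurable_mkcomplex).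
have g0 z : 0 <= g z by exact: f0.
rewrite ge0_integral_distribution//.
transitivity (\int[distribution P Zc]_z g z).
  rewrite (ge0_integral_distribution _ mg g0); apply: eq_integral => w _ /=.
  by rewrite /g /= /Zri /=; congr f; case: (Z w).
pose N : probability (measurableTypeR R) R := normal_prob 0 (Num.sqrt (v / 2)).
transitivity (\int[N \x N]_z g z).
  have NE A : measurable A -> (N \x N) A = distribution P Zc A.
    refine (@product_measure_unique _ _ _ _ _ N N (distribution P Zc) _ A) => B C mB mC.
    by rewrite /distribution /pushforward -gZ.
  by apply: eq_measure_integral => A mA _; exact/esym/NE.
by rewrite fubini_tonelli1.
Qed.

(** The density of the Gaussian is at most [(pi * v)^-1], the square of the one-dimensional peak at
    deviation [sqrt (v / 2)], and Lebesgue measure is translation invariant: the unknown mean [b]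
    disappears. *)
Lemma circular_gaussian_translate_le (v : R) (Z : {RV P >-> R[i]}) (b : R[i])
    (f : R[i] -> \bar R) :
  (0 < v)%R -> circular_gaussian v Z ->
  measurable_fun setT f -> (forall z, 0 <= f z) ->
  \int[distribution P Z]_z f (z + b)%R <=
  ((pi * v)^-1)%:E * \int[leb]_x \int[leb]_y f (x +i* y)%C.
Proof.
move=> v0 gZ mf f0.
set s := Num.sqrt (v / 2).
have s0 : (s != 0)%R by rewrite gt_eqF// sqrtr_gt0 divr_gt0.
have c0 : (0 <= normal_peak s)%R by exact: normal_peak_ge0.
have cc : (normal_peak s * normal_peak s = (pi * v)^-1)%R.
  rewrite -expr2 /normal_peak exprVn sqr_sqrtr; last first.
    by rewrite mulrn_wge0// mulr_ge0 ?sqr_ge0 ?pi_ge0.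
  rewrite /s sqr_sqrtr ?divr_ge0 ?(ltW v0)//.
  by congr (_^-1)%R; have := pi_gt0 R; move: (pi : R) => p p0; field.
case: b => b1 b2.
have mfb : measurable_fun setT (fun z : R[i] => f (z + (b1 +i* b2)%C)%R).
  apply: measurableT_comp => //; exact: measurable_complexD.
rewrite (circular_gaussian_integral gZ)//.
pose g (xy : measurableTypeR R * measurableTypeR R) := f (xy.1 +i* xy.2)%C.
have mg : measurable_fun setT g by exact: (measurableT_comp mf measurable_mkcomplex).
have g0 z : 0 <= g z by exact: f0.
have mg1 x : measurable_fun setT (fun y => g (x, y)) by exact: measurable_fun_pair2.
pose F x := \int[leb]_y g (x, y).
have mF : measurable_fun setT F by exact: (measurable_fun_fubini_tonelli_F (m2 := leb) g mg g0).
have F0 x : 0 <= F x by apply: integral_ge0.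
have inner (x : R) : \int[normal_prob 0 s]_y f ((x +i* (y : R))%C + (b1 +i* b2)%C)%R <=
    (normal_peak s)%:E * F (x + b1)%R.
  apply: (le_trans (integral_normal_prob_le s0 (f := fun y : R => g ((x + b1)%R, (y + b2)%R)) _ _)) => //.
    apply: (measurableT_comp (mg1 _)); exact: measurable_funD.
  rewrite (lebesgue_integral_shift b2 (f := fun y : R => g ((x + b1)%R, y)) (mg1 _) (fun=> g0 _)).
  exact: lexx.
have mFb : measurable_fun setT (fun x : R => F (x + b1)%R).
  apply: (measurableT_comp mF); exact: measurable_funD.
apply: (@le_trans _ _ (\int[normal_prob 0 s]_x ((normal_peak s)%:E * F ((x : R) + b1)%R))).
  apply: ge0_le_integralT => // x; exact: integral_ge0.
rewrite ge0_integralZl//.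
rewrite -cc EFinM -muleA lee_wpmul2l//.
apply: (le_trans (integral_normal_prob_le s0 mFb _)) => //.
by rewrite lebesgue_integral_shift.
Qed.

Variable G : set (set Omega).
Hypothesis mG : G `<=` measurable.

(** A product over real and imaginary parts rather than a rotation-invariant law, so that iterated
    integrals reduce its mass to the one-dimensional case. *)
Definition cauchy2 (a : R) (z : R[i]) : R :=
  (cauchy_density a (complex.Re z) * cauchy_density a (complex.Im z))%R.

Lemma cauchy2_ge0 a z : (0 < a)%R -> (0 <= cauchy2 a z)%R.
Proof. by move=> a0; rewrite mulr_ge0// cauchy_density_ge0. Qed.

Lemma measurable_cauchy2 a : (0 < a)%R -> measurable_fun setT (cauchy2 a).
Proof.
move=> a0; apply: measurable_funM.
  exact: (measurableT_comp (measurable_cauchy_density a0) measurable_Re).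
exact: (measurableT_comp (measurable_cauchy_density a0) measurable_Im).
Qed.

(* Replaces a Gaussian coordinate, independent of the coarse sigma-algebra, by a
   dummy variable integrated against the product of two Cauchy densities; the price
   is the ratio between the Gaussian density bound [(pi v)^-1] and that product. *)
Lemma gaussian_step (v a : R) (Z : {RV P >-> R[i]})
    (b : g_sigma_algebraType G -> R[i])
    (f : R[i] * g_sigma_algebraType G -> \bar R) :
  (0 < v)%R -> (0 < a)%R -> circular_gaussian v Z ->
  independent_systems P (sigma_of Z) <<s G >> ->
  measurable_fun setT b -> measurable_fun setT f -> (forall z, 0 <= f z) ->
  \int[P]_w (f ((Z w + b w)%R, w) * ((pi * v) * cauchy2 a (Z w + b w))%:E) <=
  \int[leb]_x \int[leb]_y ((cauchy2 a (x +i* y)%C)%:E * \int[P]_w f ((x +i* y)%C, w)).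
Proof.
move=> v0 a0 gZ ZG mb mf f0.
have pv0 : (0 < pi * v :> R)%R by rewrite mulr_gt0 ?pi_gt0.
pose h (zw : R[i] * g_sigma_algebraType G) : \bar R :=
  f ((zw.1 + b zw.2)%R, zw.2) * ((pi * v) * cauchy2 a (zw.1 + b zw.2))%:E.
have mzb : measurable_fun setT
    (fun zw : R[i] * g_sigma_algebraType G => (zw.1 + b zw.2)%R).
  apply: measurable_complexD => //; exact: measurableT_comp.
have mh : measurable_fun setT h.
  apply: emeasurable_funM.
    by apply: (measurableT_comp mf); exact: measurable_fun_pair.
  apply/measurable_EFinP; apply: measurable_funM => //.
  exact: (measurableT_comp (measurable_cauchy2 a0) mzb).
have h0 zw : 0 <= h zw.
  by rewrite mule_ge0 ?f0// lee_fin mulr_ge0 ?cauchy2_ge0// ltW.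
rewrite (independent_fubini_swap mG ZG mh h0).
have mfw w : measurable_fun setT (fun z => f (z, w)).
  exact: (measurable_fun_pair1 (f := f) w mf).
pose k (x y : R) (w : Omega) : \bar R :=
  (cauchy2 a (x +i* y)%C)%:E * f ((x +i* y)%C, w).
have k0 x y w : 0 <= k x y w by rewrite mule_ge0// lee_fin cauchy2_ge0.
have mk (d' : measure_display) (T : measurableType d') (x y : T -> R) (w : T -> Omega) :
    measurable_fun setT x -> measurable_fun setT y -> measurable_fun setT w ->
    measurable_fun setT (fun t => k (x t) (y t) (w t)).
  move=> mx my mw; have mxy := measurable_complex mx my.
  apply: emeasurable_funM.
    apply/measurable_EFinP.
    exact: (measurableT_comp (measurable_cauchy2 a0) mxy).
  apply: (measurableT_comp mf); apply: measurable_fun_pair => //.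
  exact: (measurableT_comp (measurable_coarsen mG) mw).
(* For a frozen [w] the shift [b w] is a constant, so the translation bound applies and its factor
   cancels [pi * v]. It then remains to move the expectation inside by Tonelli. *)
apply: (@le_trans _ _ (\int[P]_w \int[leb]_x \int[leb]_y k x y w)).
  apply: ge0_le_integralT => [w|w]; first exact: integral_ge0.
  pose g z := f (z, w) * ((pi * v) * cauchy2 a z)%:E.
  have mg : measurable_fun setT g.
    apply: emeasurable_funM => //; apply/measurable_EFinP.
    by apply: measurable_funM => //; exact: measurable_cauchy2.
  have g0 z : 0 <= g z.
    by rewrite mule_ge0// lee_fin mulr_ge0 ?cauchy2_ge0// ltW.
  apply: (le_trans (circular_gaussian_translate_le (b w) v0 gZ mg g0)).
  have gk x y : g (x +i* y)%C = (pi * v)%:E * k x y w.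
    by rewrite /g /k EFinM muleCA [in LHS](muleC (f _)).
  under eq_integral => x _.
    under eq_integral do rewrite gk.
    rewrite ge0_integralZl//; last 2 first.
      by apply: mk.
      by rewrite lee_fin ltW.
    over.
  rewrite ge0_integralZl//; last 3 first.
  - pose k' (xy : measurableTypeR R * measurableTypeR R) := k xy.1 xy.2 w.
    have mk' : measurable_fun setT k' by exact: mk.
    exact: (measurable_fun_fubini_tonelli_F (m2 := leb) k' mk' (fun=> k0 _ _ _)).
  - by move=> x _; exact: integral_ge0.
  - by rewrite lee_fin ltW.
  by rewrite muleA -EFinM mulVf ?mul1e// gt_eqF.
rewrite le_eqVlt; apply/orP; left; apply/eqP.
pose k2 (xw : measurableTypeR R * Omega) := \int[leb]_y k xw.1 y xw.2.
have mk2 : measurable_fun setT k2.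
  pose k' (xwy : (measurableTypeR R * Omega) * measurableTypeR R) :=
    k xwy.1.1 xwy.2 xwy.1.2.
  have mk' : measurable_fun setT k' by apply: mk => //; exact: measurableT_comp.
  exact: (measurable_fun_fubini_tonelli_F (m2 := leb) k' mk' (fun=> k0 _ _ _)).
have k20 xw : 0 <= k2 xw by exact: integral_ge0.
transitivity (\int[leb]_x \int[P]_w k2 (x, w)).
  exact/esym/(fubini_tonelli (m1 := leb) (m2 := P) k2 mk2 k20).
apply: eq_integral => x _.
pose k3 (yw : measurableTypeR R * Omega) := k x yw.1 yw.2.
have mk3 : measurable_fun setT k3 by apply: mk.
transitivity (\int[leb]_y \int[P]_w k3 (y, w)).
  exact/esym/(fubini_tonelli (m1 := leb) (m2 := P) k3 mk3 (fun=> k0 _ _ _)).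
apply: eq_integral => y _; rewrite /k3 /k /=.
rewrite ge0_integralZl//.
  apply: (measurableT_comp mf); apply: measurable_fun_pair => //.
  exact: measurable_coarsen.
by rewrite lee_fin cauchy2_ge0.
Qed.

Lemma integral_cauchy2_le (a c : R) (f : R[i] -> \bar R) : (0 < a)%R -> (0 <= c)%R ->
  (forall z, 0 <= f z) -> (forall z, f z <= c%:E) ->
  \int[leb]_x \int[leb]_y ((cauchy2 a (x +i* y)%C)%:E * f (x +i* y)%C) <= c%:E.
Proof.
move=> a0 c0 f0 fc.
have mC : measurable_fun setT (fun y => (cauchy_density a y)%:E).
  by apply/measurable_EFinP; exact: measurable_cauchy_density.
have C0 y : 0 <= (cauchy_density a y)%:E by rewrite lee_fin cauchy_density_ge0.
apply: (@le_trans _ _ (\int[leb]_x ((cauchy_density a x)%:E * c%:E))); last first.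
  by rewrite ge0_integralZr// integral_cauchy_density// mul1e.
apply: ge0_le_integralT => x.
  by apply: integral_ge0 => y _; rewrite mule_ge0// lee_fin cauchy2_ge0.
apply: (@le_trans _ _ (\int[leb]_y
    ((cauchy_density a y)%:E * ((cauchy_density a x)%:E * c%:E)))); last first.
  by rewrite ge0_integralZr// ?integral_cauchy_density ?mul1e// mule_ge0.
apply: ge0_le_integralT => y; first by rewrite mule_ge0// lee_fin cauchy2_ge0.
rewrite /cauchy2 /= [leRHS]muleA (muleC (cauchy_density a y)%:E) -[X in _ <= X * _]EFinM.
apply: lee_wpmul2l => //.
by rewrite lee_fin mulr_ge0// cauchy_density_ge0.
Qed.

End gaussian_step.

Lemma measurable_from_bool {d d' : measure_display} {T : measurableType d}
    {U : measurableType d'} (h : bool -> U) (f : T -> bool) :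
  measurable_fun setT f -> measurable_fun setT (fun x => h (f x)).
Proof. by move=> mf; apply: (measurableT_comp (f := h)). Qed.

Lemma measurable_from_nat {d d' : measure_display} {T : measurableType d}
    {U : measurableType d'} (h : nat -> U) (f : T -> nat) :
  measurable_fun setT f -> measurable_fun setT (fun x => h (f x)).
Proof. by move=> mf; apply: (measurableT_comp (f := h)). Qed.

(* Measurability of the channel quantities seen through a map [rho] from some
   measurable space: the sample space itself, the sample space with a coarser
   sigma-algebra, or a product of the latter with the complex plane. *)
Section channel_measurability.
Context {d : measure_display} {Omega : measurableType d} {R : realType}
        {P : probability Omega R} {K : nat}.
Variable ch : jammed_broadcast_channel P K.
Context {d' : measure_display} {T : measurableType d'} (rho : T -> Omega).
Hypothesis mH : forall t k, measurable_fun setT (fun x => bc_H ch t k (rho x)).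
Hypothesis mS : forall t, measurable_fun setT (fun x => bc_S ch t (rho x)).

Lemma measurable_csi t : measurable_fun setT (fun x => csi ch t (rho x)).
Proof.
apply/measurable_mxP => k j; under eq_fun do rewrite mxE.
exact: (measurable_mxP _).1 (mH t k) 0 j.
Qed.

Lemma measurable_csi_upto n : measurable_fun setT (fun x => csi_upto ch n (rho x)).
Proof.
apply/measurable_fun_tnthP => i.
rewrite (_ : _ \o _ = fun x => csi ch i (rho x)); first exact: measurable_csi.
by apply/funext => x /=; rewrite tnth_mktuple.
Qed.

Lemma measurable_jsi_upto n : measurable_fun setT (fun x => jsi_upto ch n (rho x)).
Proof.
apply/measurable_fun_tnthP => i.
rewrite (_ : _ \o _ = fun x => bc_S ch i (rho x)); first exact: mS.
by apply/funext => x /=; rewrite tnth_mktuple.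
Qed.

Lemma measurable_jammed t k :
  measurable_fun setT (fun x => tnth (bc_S ch t (rho x)) k).
Proof. exact: (measurableT_comp (@measurable_tnth _ _ _ k) (mS t)). Qed.

Context {c : configuration} {n : nat} (C : broadcast_code R K c n) (PT : R).
Hypothesis mW : forall k, measurable_fun setT (fun x => bc_W ch (sizes C) k (rho x)).

Lemma measurable_channel_input t :
  measurable_fun setT (fun x => channel_input ch C t (rho x)).
Proof.
apply: (measurableT_comp (@encoder_measurable _ _ _ _ C t)).
apply: measurable_fun_pair; last exact: measurable_jsi_upto.
apply: measurable_fun_pair; last exact: measurable_csi_upto.
apply/measurable_fun_tnthP => i.
rewrite (_ : _ \o _ = fun x => bc_W ch (sizes C) i (rho x)); first exact: mW.
by apply/funext => x /=; rewrite tnth_mktuple.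
Qed.

Lemma measurable_useful_signal t k :
  measurable_fun setT (fun x => (bc_H ch t k (rho x) *m channel_input ch C t (rho x)) 0 0).
Proof.
exact: (measurable_mxP _).1 (measurable_mulmx (mH t k) (measurable_channel_input t)) 0 0.
Qed.

Lemma measurable_channel_output t k :
  measurable_fun setT (fun x => bc_G ch t k (rho x)) ->
  (forall j, measurable_fun setT (fun x => bc_J ch PT t j (rho x))) ->
  measurable_fun setT (fun x => bc_N ch t k (rho x)) ->
  measurable_fun setT (fun x => channel_output ch PT C k t (rho x)).
Proof.
move=> mG mJ mN; apply: measurable_complexD => //.
apply: measurable_complexD; first exact: measurable_useful_signal.
apply: measurable_complexM.
  exact: (measurable_from_bool (fun b : bool => b%:R : R[i]) (measurable_jammed t k)).
apply: (measurable_mxP _).1; apply: measurable_mulmx => //.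
apply/measurable_mxP => i j.
rewrite (_ : (fun x => _) = fun x => bc_J ch PT t i (rho x)) => [|]; first exact: mJ.
by apply/funext => x; rewrite mxE.
Qed.

End channel_measurability.

(** * Converse *)

Section converse_core.
Context {d : measure_display} {Omega : measurableType d} {R : realType}
        {P : probability Omega R} {K : nat}.
Variable ch : jammed_broadcast_channel P K.
Context {c : configuration} {n : nat} (C : broadcast_code R K c n).
Variables (PT : R) (k : 'I_K) (delta : R).
Hypotheses (PT_gt0 : 0 < PT) (delta_gt0 : 0 < delta).

Local Notation leb := (@lebesgue_measure R).
Local Notation Y := (channel_output ch PT C k).

(* The receiver is charged a full slot when it is not jammed or when the jammer's
   direct coefficient is small; otherwise the jamming symbol drowns the input. *)
Definition costly t w : bool :=
  ~~ tnth (bc_S ch t w) k || (sqr_mod (bc_G ch t k w 0 k) < delta).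

(** Chosen so that the Gaussian to be replaced enters [Y t w / gain t w] with coefficient 1: the
    noise in a costly slot, the jamming symbol of antenna [k] in the others. *)
Definition gain t w : R[i] := if costly t w then 1 else bc_G ch t k w 0 k.

(** The dummy density at the rescaled output, divided by the peak [(pi * v)^-1] of the Gaussian
    replaced in this slot: variance 1 for the noise, [PT] for the jamming symbol. *)
Definition weight t w : R :=
  pi * (if costly t w then 1 else PT) * cauchy2 (Num.sqrt PT) (Y t w / gain t w).

Lemma gain_neq0 t w : gain t w != 0.
Proof.
rewrite /gain /costly; case: ifPn => [_|]; first exact: oner_neq0.
rewrite negb_or -leNgt => /andP[_ dG]; apply/eqP => G0; move: dG.
by rewrite G0 /sqr_mod /= expr0n /= addr0 leNgt delta_gt0.
Qed.

Let sqrtPT_gt0 : 0 < Num.sqrt PT. Proof. by rewrite sqrtr_gt0. Qed.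

Lemma weight_ge0 t w : 0 <= weight t w.
Proof.
apply: mulr_ge0; last exact: cauchy2_ge0.
by apply: mulr_ge0; [exact: pi_ge0|case: ifP => // _; exact: ltW].
Qed.

(* In slots before [j] the rescaled output is replaced by the dummy value [y t]. *)
Definition hybrid_output j (y : nat -> R[i]) t w : R[i] :=
  gain t w * (if (t < j)%N then y t else Y t w / gain t w).

Definition hybrid_decoded j y w : nat :=
  decoder C k ([tuple hybrid_output j y t w | t < n], csi_upto ch n w, jsi_upto ch n w).

(** Success of the decoder in the hybrid experiment, weighted by the slots still to be replaced:
    [j = 0] is the true channel with all weights, [j = n] a decoder fed with dummies only. *)
Definition hybrid_correct j y w : R :=
  (hybrid_decoded j y w == bc_W ch (sizes C) k w)%:R *
  \prod_(t < n | (j <= t)%N) weight t w.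

Definition update (y : nat -> R[i]) j z : nat -> R[i] :=
  fun t => if t == j then z else y t.

Lemma hybrid_correct_ge0 j y w : 0 <= hybrid_correct j y w.
Proof. by rewrite mulr_ge0// prodr_ge0// => t _; exact: weight_ge0. Qed.

Section measurability.
Context {d' : measure_display} {T : measurableType d'} (rho : T -> Omega).
Hypothesis mH : forall t k, measurable_fun setT (fun x => bc_H ch t k (rho x)).
Hypothesis mS : forall t, measurable_fun setT (fun x => bc_S ch t (rho x)).
Hypothesis mG : forall t, measurable_fun setT (fun x => bc_G ch t k (rho x)).
Hypothesis mW : forall k, measurable_fun setT (fun x => bc_W ch (sizes C) k (rho x)).

Lemma measurable_costly t : measurable_fun setT (fun x => costly t (rho x)).
Proof.
apply: measurable_or.
  apply: measurable_neg; exact: measurable_jammed.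
apply: measurable_fun_ltr => //; apply: measurable_sqr_mod.
exact: (measurable_mxP _).1 (mG t) 0 k.
Qed.

Lemma measurable_gain t : measurable_fun setT (fun x => gain t (rho x)).
Proof.
apply: measurable_fun_ifT => //; first exact: measurable_costly.
exact: (measurable_mxP _).1 (mG t) 0 k.
Qed.

Let measurable_Y t :
  (forall j, measurable_fun setT (fun x => bc_J ch PT t j (rho x))) ->
  measurable_fun setT (fun x => bc_N ch t k (rho x)) ->
  measurable_fun setT (fun x => Y t (rho x)).
Proof. by move=> mJ mN; exact: measurable_channel_output. Qed.

Lemma measurable_weight t :
  (forall j, measurable_fun setT (fun x => bc_J ch PT t j (rho x))) ->
  measurable_fun setT (fun x => bc_N ch t k (rho x)) ->
  measurable_fun setT (fun x => weight t (rho x)).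
Proof.
move=> mJ mN; apply: measurable_funM.
  apply: measurable_funM => //.
  exact: (measurable_from_bool (fun b : bool => if b then 1 else PT) (measurable_costly t)).
apply: (measurableT_comp (measurable_cauchy2 sqrtPT_gt0)).
apply: measurable_complexM; first exact: measurable_Y.
exact/measurable_complexV/measurable_gain.
Qed.

Variable j : nat.
Hypothesis mJ : forall t l, (j <= t)%N -> measurable_fun setT (fun x => bc_J ch PT t l (rho x)).
Hypothesis mN : forall t, (j <= t)%N -> measurable_fun setT (fun x => bc_N ch t k (rho x)).

(** Jammer and noise enter only from time [j] on: earlier outputs are dummies, and there is no
    feedback through which they could reach the later inputs. *)
Lemma measurable_hybrid_correct (y : T -> nat -> R[i]) :
  (forall t, measurable_fun setT (y ^~ t)) ->
  measurable_fun setT (fun x => hybrid_correct j (y x) (rho x)).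
Proof.
move=> my; apply: measurable_funM.
  apply: (measurable_from_bool (fun b : bool => b%:R : R)).
  apply: measurable_fun_eqn => //.
  apply: (measurableT_comp (@decoder_measurable _ _ _ _ C k)).
  apply: measurable_fun_pair; last exact: measurable_jsi_upto.
  apply: measurable_fun_pair; last exact: measurable_csi_upto.
  apply/measurable_fun_tnthP => i.
  rewrite (_ : _ \o _ = fun x => hybrid_output j (y x) i (rho x)); last first.
    by apply/funext => x /=; rewrite tnth_mktuple.
  apply: measurable_complexM; first exact: measurable_gain.
  have [ij|ji] := ltnP i j; first exact: my.
  apply: measurable_complexM.
    by apply: measurable_Y => [l|]; [exact: mJ|exact: mN].
  exact/measurable_complexV/measurable_gain.
rewrite (_ : (fun x => _) = (fun x => \prod_(t < n)
    (if (j <= t)%N then weight t (rho x) else 1))); last first.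
  by apply/funext => x; rewrite -big_mkcond.
elim: (index_enum _) => [|i s ih].
  by under eq_fun do rewrite big_nil; exact: measurable_cst.
under eq_fun do rewrite big_cons.
apply: measurable_funM => //; have [ji|_] := boolP (j <= i)%N; last exact: measurable_cst.
by apply: measurable_weight => [l|]; [exact: mJ|exact: mN].
Qed.

End measurability.

(** Taking the true rescaled output as the dummy value of slot [j] leaves the decoder's data
    unchanged and splits off the weight of that slot. *)
Lemma hybrid_correct_update j y w : (j < n)%N ->
  hybrid_correct j y w =
  hybrid_correct j.+1 (update y j (Y j w / gain j w)) w * weight j w.
Proof.
move=> jn; rewrite /hybrid_correct -mulrA; congr ((_ == _)%:R * _).
  rewrite /hybrid_decoded; congr (decoder C k (_, _, _)).
  apply: eq_from_tnth => i; rewrite !tnth_mktuple /hybrid_output /update.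
  by rewrite ltnS [(i <= j)%N]leq_eqVlt; case: eqP => [->|_] //=; rewrite ltnn.
rewrite (bigD1 (Ordinal jn))//= mulrC; congr (_ * _).
by apply: eq_bigl => i; rewrite -val_eqE /= andbC ltn_neqAle eq_sym.
Qed.

End converse_core.

(** * Replacement of one output *)

Section converse_step.
Context {d : measure_display} {Omega : measurableType d} {R : realType}
        {P : probability Omega R} {K : nat}.
Variable ch : jammed_broadcast_channel P K.
Context {c : configuration} {n : nat} (C : broadcast_code R K c n).
Variables (PT : R) (k : 'I_K) (delta : R).
Hypotheses (PT_gt0 : 0 < PT) (delta_gt0 : 0 < delta).

Local Notation leb := (@lebesgue_measure R).
Local Notation Y := (channel_output ch PT C k).
Local Notation costly := (costly ch k delta).
Local Notation gain := (gain ch k delta).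
Local Notation weight := (weight ch C PT k delta).
Local Notation hybrid_correct := (hybrid_correct ch C PT k delta).
Local Notation generated := (generated_by ch PT (sizes C)).
Local Notation index := ('I_6 * (nat * option 'I_K))%type.

Let sqrtPT_gt0 : 0 < Num.sqrt PT. Proof. by rewrite sqrtr_gt0. Qed.

Lemma measurable_generated (B : set index) i d1 (U : measurableType d1)
    (X : {RV P >-> U}) d2 (T : measurableType d2)
    (rho : T -> g_sigma_algebraType (generated B)) :
  measurable_fun setT rho -> B i ->
  channel_variables ch PT (sizes C) i = sigma_of X ->
  measurable_fun setT (fun x => X (rho x)).
Proof.
move=> mrho Bi iX; have mX := measurable_sub_sigma (sub_generated_by Bi iX).
exact: (measurableT_comp mX mrho).
Qed.

Section one_case.
Variables (j : nat) (jn : (j < n)%N) (y : nat -> R[i]) (beta : bool).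
Variables (i0 : index) (Z : {RV P >-> R[i]}) (v : R).
Hypothesis i0_noise : i0 = index_N j k \/ i0 = index_J j k.
Hypothesis i0Z : channel_variables ch PT (sizes C) i0 = sigma_of Z.
Hypotheses (v_gt0 : 0 < v) (gZ : circular_gaussian v Z).

Let G := generated [set~ i0].

Variable b : g_sigma_algebraType G -> R[i].
Hypothesis mb : measurable_fun setT b.
Hypothesis rescaled : forall w, costly j w = beta -> Y j w / gain j w = Z w + b w.
Hypothesis v_cost : v = if beta then 1 else PT.

(** The indicator separates the two kinds of slot, since a different Gaussian is integrated out in
    each; whether the slot is costly is itself determined by the remaining coordinates. *)
Definition case_correct z w : \bar R :=
  ((costly j w == beta)%:R * hybrid_correct j.+1 (update y j z) w)%:E.

Lemma case_correct_ge0 z w : (0 <= case_correct z w)%E.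
Proof. by rewrite lee_fin mulr_ge0// hybrid_correct_ge0. Qed.

Let mcase : measurable_fun setT
  (fun zw : R[i] * g_sigma_algebraType G => case_correct zw.1 zw.2).
Proof.
have mG (i : index) d1 (U : measurableType d1) (X : {RV P >-> U}) :
    i <> i0 -> channel_variables ch PT (sizes C) i = sigma_of X ->
    measurable_fun setT (fun zw : R[i] * g_sigma_algebraType G => X zw.2).
  by move=> ii0; apply: measurable_generated.
have ndiff t l : (t.+1 <= l)%N -> t <> l by move=> + tl; rewrite tl ltnn.
have mH t l : measurable_fun setT
    (fun zw : R[i] * g_sigma_algebraType G => bc_H ch t l zw.2).
  by apply: (mG (index_H t l)) => //; case: i0_noise => ->.
have mS t : measurable_fun setT
    (fun zw : R[i] * g_sigma_algebraType G => bc_S ch t zw.2).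
  by apply: (mG (@index_S K t)) => //; case: i0_noise => ->.
have mGk t : measurable_fun setT
    (fun zw : R[i] * g_sigma_algebraType G => bc_G ch t k zw.2).
  by apply: (mG (index_G t k)) => //; case: i0_noise => ->.
have mW l : measurable_fun setT
    (fun zw : R[i] * g_sigma_algebraType G => bc_W ch (sizes C) l zw.2).
  by apply: (mG (index_W l)) => //; case: i0_noise => ->.
apply/measurable_EFinP; apply: measurable_funM.
  apply: (measurable_from_bool (fun e : bool => (e == beta)%:R : R)).
  exact: measurable_costly.
apply: measurable_hybrid_correct => //.
- move=> t l jt; apply: (mG (index_J t l)) => //.
  by case: i0_noise => -> // -[tj _]; move: jt; rewrite tj ltnn.
- move=> t jt; apply: (mG (index_N t k)) => //.
  by case: i0_noise => -> // -[tj]; move: jt; rewrite tj ltnn.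
- move=> t; rewrite /update; case: (t == j); last exact: measurable_cst.
  exact: measurable_fst.
Qed.

Let mG : G `<=` measurable. Proof. exact: generated_by_measurable. Qed.

Let ZG : independent_systems P (sigma_of Z) <<s G >>.
Proof.
move=> A D ZA GD.
apply: (@generated_by_independent _ _ _ _ _ ch PT (sizes C) PT_gt0 (sizes_gt0 C)
  [set i0] [set~ i0] (setICr _)) => //.
exact: (sub_generated_by _ i0Z ZA).
Qed.

Lemma measurable_case_integral :
  measurable_fun setT (fun z => \int[P]_w case_correct z w)%E.
Proof.
exact: (measurable_independent_inner P mG mcase (fun=> case_correct_ge0 _ _)).
Qed.

(** On the event singled out by [beta] the weight of slot [j] is exactly the factor
    [pi * v * cauchy2] demanded by the Gaussian replacement. *)
Lemma case_step :
  (\int[P]_w ((costly j w == beta)%:R * hybrid_correct j y w)%:E <=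
   \int[leb]_x \int[leb]_u ((cauchy2 (Num.sqrt PT) (x +i* u)%C)%:E *
      \int[P]_w case_correct (x +i* u)%C w))%E.
Proof.
apply: le_trans (gaussian_step mG v_gt0 sqrtPT_gt0 gZ ZG mb mcase
  (fun=> case_correct_ge0 _ _)).
rewrite le_eqVlt; apply/orP; left; apply/eqP.
apply: eq_integral => w _; rewrite /case_correct /= -EFinM; congr EFin.
have [cb|] := eqVneq (costly j w) beta; last by rewrite !mul0r.
rewrite !mul1r hybrid_correct_update// -rescaled//; congr (_ * _).
by rewrite /weight cb v_cost.
Qed.

End one_case.

End converse_step.

(** The [M k] values each have mass [1 / M k] and exhaust the probability, so the integer-valued
    message lies in its alphabet almost surely. *)
Lemma message_lt_size {d : measure_display} {Omega : measurableType d} {R : realType}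
    {P : probability Omega R} {K : nat} (ch : jammed_broadcast_channel P K)
    (M : 'I_K -> nat) (M_gt0 : forall k, (0 < M k)%N) (k : 'I_K) :
  P (bc_W ch M k @^-1` [set i | (i < M k)%N]) = 1%E.
Proof.
have mW A : measurable (bc_W ch M k @^-1` A).
  by rewrite -[X in measurable X]setTI; exact: measurable_funPT.
have -> : bc_W ch M k @^-1` [set i | (i < M k)%N] =
    \big[setU/set0]_(i < M k) (bc_W ch M k @^-1` [set (i : nat)]).
  rewrite -(bigcup_mkord (M k) (fun i => bc_W ch M k @^-1` [set i])); apply/seteqP; split=> w /=.
    by move=> wM; exists (bc_W ch M k w).
  by move=> [i /= iM ->].
rewrite (@measure_semi_additive_ord _ _ _ P (M k)
  (fun i : 'I_(M k) => bc_W ch M k @^-1` [set (i : nat)])); first last.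
- by apply: bigsetU_measurable => i _; exact: mW.
- apply/trivIsetP => i j _ _ ij; apply/seteqP; split=> w //= [] -> /val_inj /eqP.
  by rewrite (negbTE ij).
- by move=> i; exact: mW.
rewrite (eq_bigr (fun=> ((M k)%:R^-1)%:E)); last first.
  by move=> i _; exact: (W_uniform ch (M_gt0) (ltn_ord i)).
rewrite sumEFin sumr_const card_ord -[X in X%:E]mulr_natr mulVf//.
by rewrite pnatr_eq0 -lt0n.
Qed.

(** * From the true outputs to a blind guess *)

Section converse_bound.
Context {d : measure_display} {Omega : measurableType d} {R : realType}
        {P : probability Omega R} {K : nat}.
Variable ch : jammed_broadcast_channel P K.
Context {c : configuration} {n : nat} (C : broadcast_code R K c n).
Variables (PT : R) (k : 'I_K) (delta : R).
Hypotheses (PT_gt0 : 0 < PT) (delta_gt0 : 0 < delta).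

Local Notation leb := (@lebesgue_measure R).
Local Notation Y := (channel_output ch PT C k).
Local Notation costly := (costly ch k delta).
Local Notation gain := (gain ch k delta).
Local Notation weight := (weight ch C PT k delta).
Local Notation hybrid_correct := (hybrid_correct ch C PT k delta).
Local Notation hybrid_decoded := (hybrid_decoded ch C PT k delta).
Local Notation generated := (generated_by ch PT (sizes C)).
Local Notation index := ('I_6 * (nat * option 'I_K))%type.

Let sqrtPT_gt0 : 0 < Num.sqrt PT. Proof. by rewrite sqrtr_gt0. Qed.

Lemma measurable_hybrid_correct_id j y :
  measurable_fun setT (fun w => hybrid_correct j y w).
Proof.
by apply: (@measurable_hybrid_correct _ _ _ _ _ ch c n C PT k delta PT_gt0 _ Omega id
  _ _ _ _ j _ _ (fun=> y)).
Qed.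

Let costly_step j y beta z : \bar R :=
  (\int[P]_w case_correct ch C PT k delta j y beta z w)%E.

Lemma uncostly_true j w : costly j w = false ->
  tnth (bc_S ch j w) k = true /\ gain j w = bc_G ch j k w 0 k.
Proof.
move=> cj; rewrite /gain cj; split => //.
by move: cj; rewrite /costly; case: (tnth _ _).
Qed.

(** The shift [b] retains the jamming term, because a costly slot may still be jammed, through a
    small coefficient. *)
Lemma noise_step j y : (j < n)%N ->
  (\int[P]_w ((costly j w == true)%:R * hybrid_correct j y w)%:E <=
   \int[leb]_x \int[leb]_u ((cauchy2 (Num.sqrt PT) (x +i* u)%C)%:E *
      costly_step j y true (x +i* u)%C))%E /\
  measurable_fun setT (costly_step j y true).
Proof.
move=> jn; pose i0 := index_N j k; pose G := generated [set~ i0].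
pose b (w : g_sigma_algebraType G) : R[i] :=
  (bc_H ch j k w *m channel_input ch C j w) 0 0
  + (tnth (bc_S ch j w) k)%:R * (bc_G ch j k w *m jammer_signal ch PT j w) 0 0.
have mGi (i : index) d1 (U : measurableType d1) (X : {RV P >-> U}) :
    i <> i0 -> channel_variables ch PT (sizes C) i = sigma_of X ->
    measurable_fun setT (fun w : g_sigma_algebraType G => X w).
  by move=> ii0; apply: measurable_generated.
have mH t l : measurable_fun setT (fun w : g_sigma_algebraType G => bc_H ch t l w).
  exact: (mGi (index_H t l)).
have mS t : measurable_fun setT (fun w : g_sigma_algebraType G => bc_S ch t w).
  exact: (mGi (@index_S K t)).
have mW l : measurable_fun setT (fun w : g_sigma_algebraType G => bc_W ch (sizes C) l w).
  exact: (mGi (index_W l)).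
have mb : measurable_fun setT b.
  apply: measurable_complexD; first exact: (measurable_useful_signal mH mS mW).
  apply: measurable_complexM.
    apply: (measurable_from_bool (fun e : bool => e%:R : R[i])).
    exact: (measurable_jammed mS).
  apply: (measurable_mxP _).1; apply: measurable_mulmx.
    exact: (mGi (index_G j k)).
  apply/measurable_mxP => l m.
  rewrite (_ : (fun x => _) = fun w => bc_J ch PT j l w) => [|].
    exact: (mGi (index_J j l)).
  by apply/funext => w; rewrite mxE.
split.
  apply: (@case_step _ _ _ _ _ ch _ _ C PT k delta PT_gt0 j jn y true
    i0 (bc_N ch j k) 1 _ _ ltr01 _ b) => //.
  - by left.
  - exact: N_gaussian.
  - move=> w cw; by rewrite /channel_output /gain cw divr1 addrC.
apply: (@measurable_case_integral _ _ _ _ _ ch _ _ C PT k delta PT_gt0 j y true i0).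
by left.
Qed.

(** Dividing by the direct jamming coefficient leaves the jamming symbol plus a shift [b] built from
    the signal, the other jammer antennas and the noise, all independent of it. *)
Lemma jammer_step j y : (j < n)%N ->
  (\int[P]_w ((costly j w == false)%:R * hybrid_correct j y w)%:E <=
   \int[leb]_x \int[leb]_u ((cauchy2 (Num.sqrt PT) (x +i* u)%C)%:E *
      costly_step j y false (x +i* u)%C))%E /\
  measurable_fun setT (costly_step j y false).
Proof.
move=> jn; pose i0 := index_J j k; pose G := generated [set~ i0].
pose b (w : g_sigma_algebraType G) : R[i] :=
  ((bc_H ch j k w *m channel_input ch C j w) 0 0
  + \sum_(l < K | l != k) bc_G ch j k w 0 l * bc_J ch PT j l w + bc_N ch j k w)
  * (bc_G ch j k w 0 k)^-1.
have mGi (i : index) d1 (U : measurableType d1) (X : {RV P >-> U}) :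
    i <> i0 -> channel_variables ch PT (sizes C) i = sigma_of X ->
    measurable_fun setT (fun w : g_sigma_algebraType G => X w).
  by move=> ii0; apply: measurable_generated.
have mH t l : measurable_fun setT (fun w : g_sigma_algebraType G => bc_H ch t l w).
  exact: (mGi (index_H t l)).
have mS t : measurable_fun setT (fun w : g_sigma_algebraType G => bc_S ch t w).
  exact: (mGi (@index_S K t)).
have mW l : measurable_fun setT (fun w : g_sigma_algebraType G => bc_W ch (sizes C) l w).
  exact: (mGi (index_W l)).
have mGe l : measurable_fun setT (fun w : g_sigma_algebraType G => bc_G ch j k w 0 l).
  exact: (measurable_mxP _).1 (mGi (index_G j k) _ _ (bc_G ch j k) _ _) 0 l.
have mb : measurable_fun setT b.
  apply: measurable_complexM; last exact: measurable_complexV.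
  apply: measurable_complexD; last exact: (mGi (index_N j k)).
  apply: measurable_complexD; first exact: (measurable_useful_signal mH mS mW).
  rewrite (_ : (fun x => _) = (fun w => \sum_(l < K)
    (if l != k then bc_G ch j k w 0 l * bc_J ch PT j l w else 0))); last first.
    by apply/funext => w; rewrite big_mkcond.
  apply: measurable_complex_sum => l.
  have [->|lk] := eqVneq l k; first exact: measurable_cst.
  apply: measurable_complexM => //; apply: (mGi (index_J j l)) => //.
  by case => /eqP; rewrite (negbTE lk).
split.
  apply: (@case_step _ _ _ _ _ ch _ _ C PT k delta PT_gt0 j jn y false
    i0 (bc_J ch PT j k) PT _ _ PT_gt0 _ b) => //.
  - by right.
  - exact: J_gaussian.
  - move=> w cw; have [Sw gw] := uncostly_true cw.
    have := gain_neq0 ch k delta_gt0 j w.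
    rewrite gw => G0; rewrite /channel_output Sw mul1r /b.
    have -> : (bc_G ch j k w *m jammer_signal ch PT j w) 0 0 =
        bc_G ch j k w 0 k * bc_J ch PT j k w +
        \sum_(l < K | l != k) bc_G ch j k w 0 l * bc_J ch PT j l w.
      rewrite mxE (bigD1 k)//= mxE; congr (_ + _).
      by apply: eq_bigr => l _; rewrite mxE.
    by field.
apply: (@measurable_case_integral _ _ _ _ _ ch _ _ C PT k delta PT_gt0 j y false i0).
by right.
Qed.

Lemma integral_costly_split j j' y :
  (\int[P]_w (hybrid_correct j' y w)%:E =
   \int[P]_w ((costly j w == true)%:R * hybrid_correct j' y w)%:E +
   \int[P]_w ((costly j w == false)%:R * hybrid_correct j' y w)%:E)%E.
Proof.
have mc : measurable_fun setT (costly j) by exact: (@measurable_costly _ _ _ _ _ ch k delta _ Omega id).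
have mbeta beta : measurable_fun setT
    (fun w => ((costly j w == beta)%:R * hybrid_correct j' y w)%:E : \bar R).
  apply/measurable_EFinP; apply: measurable_funM.
    exact: (measurable_from_bool (fun e : bool => (e == beta)%:R : R)).
  exact: measurable_hybrid_correct_id.
rewrite -ge0_integralD//.
- apply: eq_integral => w _; rewrite -EFinD -mulrDl.
  by case: (costly j w); rewrite /= ?addr0 ?add0r mul1r.
- by move=> w _; rewrite lee_fin mulr_ge0// hybrid_correct_ge0.
- by move=> w _; rewrite lee_fin mulr_ge0// hybrid_correct_ge0.
Qed.

(** Both kinds of slot are integrated against the same dummy density, so their contributions
    recombine, for each dummy value, into the next hybrid expectation. That is at most [e], and the
    density has mass 1. *)
Lemma hybrid_step j y (e : R) : (j < n)%N -> 0 <= e ->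
  (forall z, \int[P]_w (hybrid_correct j.+1 (update y j z) w)%:E <= e%:E)%E ->
  (\int[P]_w (hybrid_correct j y w)%:E <= e%:E)%E.
Proof.
move=> jn e0 He.
have [le1 m1] := noise_step y jn; have [le2 m2] := jammer_step y jn.
rewrite (integral_costly_split j).
apply: (le_trans (leeD le1 le2)).
pose F1 := costly_step j y true; pose F2 := costly_step j y false.
have F10 z : (0 <= F1 z)%E by apply: integral_ge0 => w _; exact: case_correct_ge0.
have F20 z : (0 <= F2 z)%E by apply: integral_ge0 => w _; exact: case_correct_ge0.
have C0 z : (0 <= (cauchy2 (Num.sqrt PT) z)%:E)%E by rewrite lee_fin cauchy2_ge0.
have mk (F : R[i] -> \bar R) : measurable_fun setT F ->
    measurable_fun setT (fun xu : measurableTypeR R * measurableTypeR R =>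
      (cauchy2 (Num.sqrt PT) (xu.1 +i* xu.2)%C)%:E * F (xu.1 +i* xu.2)%C)%E.
  move=> mF; apply: emeasurable_funM; last exact: (measurableT_comp mF measurable_mkcomplex).
  apply/measurable_EFinP.
  exact: (measurableT_comp (measurable_cauchy2 sqrtPT_gt0) measurable_mkcomplex).
rewrite -ge0_integralD//; first last.
- exact: (measurable_fun_fubini_tonelli_F (m2 := leb) _ (mk _ m2)
    (fun=> mule_ge0 (C0 _) (F20 _))).
- by move=> x _; apply: integral_ge0 => u _; exact: mule_ge0 (C0 _) (F20 _).
- exact: (measurable_fun_fubini_tonelli_F (m2 := leb) _ (mk _ m1)
    (fun=> mule_ge0 (C0 _) (F10 _))).
- by move=> x _; apply: integral_ge0 => u _; exact: mule_ge0 (C0 _) (F10 _).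
apply: le_trans (integral_cauchy2_le (f := fun z => (F1 z + F2 z)%E) sqrtPT_gt0 e0 _ _).
- apply: ge0_le_integralT => x.
    by apply: adde_ge0; apply: integral_ge0 => u _;
      [exact: mule_ge0 (C0 _) (F10 _)|exact: mule_ge0 (C0 _) (F20 _)].
  rewrite -ge0_integralD//; first last.
  + exact: measurable_fun_pair2 (mk _ m2).
  + by move=> u _; exact: mule_ge0 (C0 _) (F20 _).
  + exact: measurable_fun_pair2 (mk _ m1).
  + by move=> u _; exact: mule_ge0 (C0 _) (F10 _).
  apply: ge0_le_integralT => u.
    by apply: adde_ge0; [exact: mule_ge0 (C0 _) (F10 _)|exact: mule_ge0 (C0 _) (F20 _)].
  by rewrite (ge0_muleDr _ (F10 _) (F20 _)).
- by move=> z; exact: adde_ge0 (F10 _) (F20 _).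
- by move=> z; apply: le_trans (He z); rewrite (integral_costly_split j).
Qed.

Lemma message_probability_le m :
  (P [set w | bc_W ch (sizes C) k w = m] <= ((sizes C k)%:R^-1)%:E)%E.
Proof.
set M := sizes C k.
have M0 : (0 < M)%N by exact: sizes_gt0.
have mW A : measurable (bc_W ch (sizes C) k @^-1` A).
  by rewrite -[X in measurable X]setTI; exact: measurable_funPT.
have [mM|Mm] := ltnP m M.
  by rewrite -(W_uniform ch (sizes_gt0 C) mM).
have PM : P (bc_W ch (sizes C) k @^-1` [set i | (i < M)%N]) = 1%E.
  exact: (message_lt_size ch (sizes_gt0 C) k).
suff -> : P [set w | bc_W ch (sizes C) k w = m] = 0%E by rewrite lee_fin invr_ge0.
have : (P [set w | bc_W ch (sizes C) k w = m] +
        P (bc_W ch (sizes C) k @^-1` [set i | (i < M)%N]) <= 1)%E.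
  have mm : measurable [set w | bc_W ch (sizes C) k w = m] by exact: (mW [set m]).
  have mM : measurable (bc_W ch (sizes C) k @^-1` [set i | (i < M)%N]) by exact: mW.
  rewrite -measureU//; first by apply: probability_le1; exact: measurableU.
  by apply/seteqP; split=> w //= [] ->; rewrite ltnNge Mm.
rewrite PM -leeBrDr// subee// => le0.
by apply/eqP; rewrite eq_le le0 measure_ge0.
Qed.

(** With only dummies left, the guess is a function of [H], [S] and, through the gains, of [G]. All
    of these are independent of the message, whose values have probability at most
    [1 / sizes C k]. *)
Lemma hybrid_last y :
  (\int[P]_w (hybrid_correct n y w)%:E <= ((sizes C k)%:R^-1)%:E)%E.
Proof.
pose i0 : index := index_W k; pose G := generated [set~ i0].
have mG : G `<=` measurable by exact: generated_by_measurable.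
have WG : independent_systems P (sigma_of (bc_W ch (sizes C) k)) <<s G >>.
  move=> A D WA GD.
  apply: (@generated_by_independent _ _ _ _ _ ch PT (sizes C) PT_gt0 (sizes_gt0 C)
    [set i0] [set~ i0] (setICr _)) => //.
  exact: (sub_generated_by (i := i0) _ _ WA).
pose f (mw : nat * g_sigma_algebraType G) : \bar R :=
  ((hybrid_decoded n y mw.2 == mw.1)%:R)%:E.
have f0 mw : (0 <= f mw)%E by rewrite lee_fin.
have mGi (i : index) d1 (U : measurableType d1) (X : {RV P >-> U}) :
    i <> i0 -> channel_variables ch PT (sizes C) i = sigma_of X ->
    measurable_fun setT (fun mw : nat * g_sigma_algebraType G => X mw.2).
  by move=> ii0; apply: measurable_generated.
have mH t l : measurable_fun setT (fun mw : nat * g_sigma_algebraType G => bc_H ch t l mw.2).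
  exact: (mGi (index_H t l)).
have mS t : measurable_fun setT (fun mw : nat * g_sigma_algebraType G => bc_S ch t mw.2).
  exact: (mGi (@index_S K t)).
have mGk t : measurable_fun setT (fun mw : nat * g_sigma_algebraType G => bc_G ch t k mw.2).
  exact: (mGi (index_G t k)).
have mf : measurable_fun setT f.
  apply/measurable_EFinP.
  apply: (measurable_from_bool (fun b : bool => b%:R : R)).
  apply: measurable_fun_eqn => //.
  apply: (measurableT_comp (@decoder_measurable _ _ _ _ C k)).
  apply: measurable_fun_pair; last exact: measurable_jsi_upto.
  apply: measurable_fun_pair; last exact: measurable_csi_upto.
  apply/measurable_fun_tnthP => i.
  rewrite (_ : _ \o _ = fun mw => gain i mw.2 * y i); last first.
    by apply/funext => x /=; rewrite tnth_mktuple /hybrid_output ltn_ord.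
  by apply: measurable_complexM => //; exact: measurable_gain.
rewrite (_ : (\int[P]_w (hybrid_correct n y w)%:E =
    \int[P]_w f (bc_W ch (sizes C) k w, w))%E); last first.
  apply: eq_integral => w _; rewrite /hybrid_correct big_pred0 ?mulr1// => t.
  by rewrite leqNgt ltn_ord.
rewrite (independent_fubini_swap mG WG mf f0).
apply: (@le_trans _ _ (\int[P]_w ((sizes C k)%:R^-1)%:E)%E); last first.
  by rewrite integral_cst//= probability_setT mule1.
apply: ge0_le_integralT => w; first exact: integral_ge0.
apply: le_trans (message_probability_le (hybrid_decoded n y w)).
rewrite -[leRHS]/(distribution P (bc_W ch (sizes C) k) [set hybrid_decoded n y w]).
rewrite le_eqVlt; apply/orP; left; apply/eqP.
transitivity (distribution P (bc_W ch (sizes C) k) ([set hybrid_decoded n y w] `&` setT)); last by rewrite setIT.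
rewrite -integral_indic//.
apply: eq_integral => m _; rewrite /f /= indicE; congr ((nat_of_bool _)%:R%:E).
by apply/idP/idP => [/eqP <-|/set_mem ->] //; exact: mem_set.
Qed.

(** Induction on the number of outputs not yet replaced, starting from the blind decoder. In the
    hybrid without dummies, multiplying back by the nonzero gain restores the true outputs. *)
Theorem weighted_correct_le :
  (\int[P]_w ((decoded ch PT C k w == bc_W ch (sizes C) k w)%:R *
     \prod_(t < n) weight t w)%:E <= ((sizes C k)%:R^-1)%:E)%E.
Proof.
have H i : (i <= n)%N -> forall y,
    (\int[P]_w (hybrid_correct (n - i) y w)%:E <= ((sizes C k)%:R^-1)%:E)%E.
  elim: i => [_ y|i ih iN y]; first by rewrite subn0; exact: hybrid_last.
  apply: hybrid_step; first by rewrite ltn_subrL (leq_ltn_trans _ iN).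
    by rewrite invr_ge0.
  by move=> z; rewrite -subSn// subSS; apply: ih; exact: ltnW.
have := H n (leqnn n) (fun=> 0); rewrite subnn; apply: le_trans.
rewrite le_eqVlt; apply/orP; left; apply/eqP.
apply: eq_integral => w _; congr EFin; rewrite /hybrid_correct.
congr ((_ == _)%:R * _).
rewrite /decoded /hybrid_decoded; congr (decoder C k (_, _, _)).
apply: eq_from_tnth => t; rewrite !tnth_mktuple /hybrid_output /=.
by rewrite mulrCA mulfV ?mulr1//; exact: gain_neq0.
Qed.

End converse_bound.

(** * Second moment of a Gaussian *)

Section gaussian_second_moment.
Context {R : realType}.
Local Open Scope ereal_scope.

Import HBNNSimple.

(** The comparison on sets passes to the simple functions below [f], and from there to the supremum
    that defines the integral. *)
Lemma integral_density_le {d : measure_display} {T : measurableType d}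
    (m mu : {measure set T -> \bar R}) (g f : T -> \bar R) :
  measurable_fun setT g -> (forall x, 0 <= g x) ->
  (forall A, measurable A -> m A <= \int[mu]_(x in A) g x) ->
  (forall x, 0 <= f x) ->
  \int[m]_x f x <= \int[mu]_x (f x * g x).
Proof.
move=> mg g0 mle f0; rewrite [leLHS]ge0_integralTE//.
apply: ge_ereal_sup => _ [h hf <-].
apply: (@le_trans _ _ (\int[mu]_x ((h x)%:E * g x))); last first.
  apply: ge0_le_integralT => x; first by rewrite mule_ge0// lee_fin.
  by rewrite lee_wpmul2r//; exact: hf.
have mh r : measurable (h @^-1` [set r]) by [].
have rind r x : (0 <= r * \1_(h @^-1` [set r]) x)%R.
  have [[y _ <-]|nr] := pselect (range h r); first by rewrite mulr_ge0.
  by rewrite preimage10// indic0 mulr0.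
rewrite (eq_integral (fun x => \sum_(r \in range h)
   (r%:E * (g x * (\1_(h @^-1` [set r]) x)%:E)))); last first.
  move=> x _; rewrite {1}(fimfunE h x) -fsumEFin//.
  rewrite ge0_mule_fsuml//; last first.
    by move=> r; rewrite lee_fin.
  by apply: eq_fsbigr => r _; rewrite EFinM -muleA (muleC (g x)).
rewrite ge0_integral_fsum//; first last.
- by move=> r x _; rewrite muleCA -EFinM mule_ge0// lee_fin.
- move=> r; apply: measurable_funeM; apply: emeasurable_funM => //.
  by apply/measurable_EFinP; exact: measurable_indic.
rewrite sintegralE; apply: lee_fsum => // r [x _ <-].
rewrite ge0_integralZl ?lee_fin//; first last.
- by move=> y _; rewrite mule_ge0// lee_fin.
- apply: emeasurable_funM => //.
  by apply/measurable_EFinP; exact: measurable_indic.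
rewrite lee_wpmul2l ?lee_fin//.
apply: le_trans (mle _ (mh _)) _; rewrite integral_mkcond.
by under eq_integral do rewrite epatch_indic.
Qed.

(** Comparison with the density of deviation [2 * s]. The ratio of the exponentials is [expR (- u)],
    and [u * expR (- u) <= 1] absorbs the square. This gives the constant 16/3, rounded up to 6; any
    absolute constant would serve. *)
Lemma normal_second_moment_le (s : R) : (0 < s)%R ->
  \int[normal_prob 0 s]_x (x ^+ 2)%:E <= (6 * s ^+ 2)%:E.
Proof.
move=> s0.
have mpdf s' : measurable_fun setT (fun x => (normal_pdf 0 s' x)%:E : \bar R).
  by apply/measurable_EFinP; exact: measurable_normal_pdf.
have pdf0 x : 0 <= (normal_pdf 0 s x)%:E by rewrite lee_fin normal_pdf_ge0.
have sq0 (x : R) : 0 <= (x ^+ 2)%:E by rewrite lee_fin sqr_ge0.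
have Nle (A : set (measurableTypeR R)) : measurable A ->
    normal_prob 0 s A <= \int[lebesgue_measure]_(x in A) (normal_pdf 0 s x)%:E.
  by [].
apply: (le_trans (integral_density_le (m := normal_prob 0 s) (mpdf s) pdf0 Nle sq0)).
apply: (@le_trans _ _ (\int[lebesgue_measure]_x
   ((6 * s ^+ 2)%:E * (normal_pdf 0 (2 * s) x)%:E))); last first.
  rewrite ge0_integralZl//; first by rewrite integral_normal_pdf mule1.
  - exact: mpdf.
  - by move=> x _; rewrite lee_fin normal_pdf_ge0.
  - by rewrite lee_fin mulr_ge0// sqr_ge0.
apply: ge0_le_integralT => x.
  by rewrite mule_ge0// lee_fin ?sqr_ge0 ?normal_pdf_ge0.
rewrite -!EFinM lee_fin !normal_pdfE ?gt_eqF ?mulr_gt0//.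
have peak2 : (normal_peak (2 * s) = normal_peak s / 2)%R.
  rewrite /normal_peak exprMn -mulrA -mulrnAr.
  rewrite (_ : (2 ^+ 2 * (s ^+ 2 * pi *+ 2)) = (2 ^+ 2) * (s ^+ 2 * pi *+ 2))%R//.
  by rewrite sqrtrM ?sqr_ge0// sqrtr_sqr ger0_norm// invfM mulrC.
rewrite peak2.
set u : R := (3 * x ^+ 2 / (8 * s ^+ 2))%R.
have sn0 : (s != 0)%R by rewrite gt_eqF.
have -> : normal_fun 0 s x = (expR (- u) * normal_fun 0 (2 * s) x)%R.
  rewrite /normal_fun -expRD; congr expR; rewrite /u; field.
  by rewrite sn0.
have xu : (x ^+ 2 = 8 / 3 * s ^+ 2 * u)%R by rewrite /u; field; rewrite sn0.
have ue : (u * expR (- u) <= 1)%R.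
  rewrite expRN -ler_pdivlMr ?invr_gt0 ?expR_gt0// invrK mul1r.
  by apply: le_trans (expR_ge1Dx u); rewrite lerDr.
set p := normal_peak s; set e := normal_fun 0 (2 * s) x.
have p0 : (0 <= p)%R by exact: normal_peak_ge0.
have e0 : (0 <= e)%R by exact: expR_ge0.
rewrite xu (_ : _ * u * (p * (expR (- u) * e)) =
  (8 / 3 * s ^+ 2 * p * e) * (u * expR (- u)))%R; last by ring.
rewrite (_ : 6 * s ^+ 2 * (p / 2 * e) = 3 * s ^+ 2 * p * e)%R; last by field.
have spe0 : (0 <= s ^+ 2 * p * e)%R.
  by apply: mulr_ge0 => //; apply: mulr_ge0 => //; exact: sqr_ge0.
move: spe0 ue; set q := (s ^+ 2 * p * e)%R => q0 ue.
rewrite (_ : 8 / 3 * s ^+ 2 * p * e = 8 / 3 * q)%R; last by rewrite /q; ring.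
rewrite (_ : 3 * s ^+ 2 * p * e = 3 * q)%R; last by rewrite /q; ring.
apply: (@le_trans _ _ (8 / 3 * q)%R); last by lra.
by rewrite ler_piMr// mulr_ge0//; lra.
Qed.

Lemma circular_gaussian_second_moment {d : measure_display}
    {Omega : measurableType d} (P : probability Omega R) (v : R)
    (Z : {RV P >-> R[i]}) : (0 < v)%R -> circular_gaussian v Z ->
  \int[P]_w (sqr_mod (Z w))%:E <= (6 * v)%:E.
Proof.
move=> v0 gZ; set s := Num.sqrt (v / 2).
have s0 : (0 < s)%R by rewrite sqrtr_gt0 divr_gt0.
have sE : (s ^+ 2 = v / 2)%R by rewrite sqr_sqrtr// divr_ge0// ltW.
pose f z : \bar R := (@sqr_mod R z)%:E.
have mf : measurable_fun setT f.
  by apply/measurable_EFinP; exact: measurable_sqr_mod.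
have f0 z : 0 <= f z by rewrite lee_fin sqr_mod_ge0.
rewrite (_ : \int[P]_w _ = \int[distribution P Z]_z f z); last first.
  by rewrite ge0_integral_distribution.
rewrite (circular_gaussian_integral gZ)// -/s.
have moment x : \int[normal_prob 0 s]_y f (x +i* y)%C <= (x ^+ 2 + 6 * s ^+ 2)%:E.
  under eq_integral do rewrite /f /sqr_mod /= EFinD.
  rewrite ge0_integralD//=; first last.
  - by apply/measurable_EFinP; exact: measurable_funX.
  - by move=> y _; rewrite lee_fin sqr_ge0.
  - by rewrite lee_fin sqr_ge0.
  rewrite integral_cst//= probability_setT mule1 EFinD leeD2l//.
  exact: normal_second_moment_le.
apply: (@le_trans _ _ (\int[normal_prob 0 s]_x ((x ^+ 2)%:E + (6 * s ^+ 2)%:E))).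
  by apply: ge0_le_integralT => x; [exact: integral_ge0|exact: moment].
rewrite ge0_integralD//=; first last.
- by move=> x _; rewrite lee_fin mulr_ge0// sqr_ge0.
- by apply/measurable_EFinP; exact: measurable_funX.
- by move=> x _; rewrite lee_fin sqr_ge0.
rewrite integral_cst//= probability_setT mule1.
rewrite (_ : 6 * v = 6 * s ^+ 2 + 6 * s ^+ 2)%R; last by rewrite sE; field.
by rewrite EFinD leeD2r//; exact: normal_second_moment_le.
Qed.

End gaussian_second_moment.

(** * Logarithmic energy *)

Section log_gain.
Context {R : realType}.
Implicit Types (a PT : R) (z w : R[i]).

(** Controls minus the logarithm of the dummy density at scale [sqrt PT]: that is at most
    [2 * ln pi + ln PT] plus twice this quantity. *)
Definition log_gain PT z : R := ln (1 + sqr_mod z / PT).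

Lemma sqr_modM z w : sqr_mod (z * w) = sqr_mod z * sqr_mod w.
Proof. by rewrite /sqr_mod ReM ImM; ring. Qed.

Lemma sqr_modD_le z w : sqr_mod (z + w) <= 2 * (sqr_mod z + sqr_mod w).
Proof.
rewrite /sqr_mod ReD ImD.
have := sqr_ge0 (complex.Re z - complex.Re w).
have := sqr_ge0 (complex.Im z - complex.Im w).
nra.
Qed.

Lemma sqr_mod_eq0 z : (sqr_mod z == 0) = (z == 0).
Proof.
rewrite /sqr_mod paddr_eq0 ?sqr_ge0// !sqrf_eq0.
by case: z => a b; rewrite eq_complex.
Qed.

Lemma sqr_modV z : sqr_mod z^-1 = (sqr_mod z)^-1.
Proof.
have [->|z0] := eqVneq z 0.
  by rewrite invr0 /sqr_mod /= expr0n /= addr0 invr0.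
have z20 : sqr_mod z != 0 by rewrite sqr_mod_eq0.
apply: (mulfI z20); rewrite mulfV// -sqr_modM mulfV//.
by rewrite /sqr_mod /= expr1n expr0n /= addr0.
Qed.

Variable PT : R.
Hypothesis PT_ge1 : 1 <= PT.

Let PT_gt0 : 0 < PT. Proof. exact: lt_le_trans PT_ge1. Qed.

Let ratio_ge0 z : 0 <= sqr_mod z / PT.
Proof. by rewrite divr_ge0 ?sqr_mod_ge0// ltW. Qed.

Lemma log_gain_le z : log_gain PT z <= sqr_mod z / PT.
Proof. by apply: le_ln1Dx; apply: lt_le_trans (ratio_ge0 z); rewrite ltrN10. Qed.

Lemma log_gain_le_sqr_mod z : log_gain PT z <= sqr_mod z.
Proof.
apply: le_trans (log_gain_le z) _.
by rewrite ler_pdivrMr// ler_peMr// sqr_mod_ge0.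
Qed.

(** With [a] and [b] the two normalized energies, [1 + 2 * (a + b) <= 2 * (1 + a) * (1 + b)]. *)
Lemma log_gainD z w : log_gain PT (z + w) <= ln 2 + log_gain PT z + log_gain PT w.
Proof.
have z0 := ratio_ge0 z; have w0 := ratio_ge0 w; have zw0 := ratio_ge0 (z + w).
rewrite /log_gain -!lnM ?posrE ?mulr_gt0//; try by rewrite ltr_wpDr.
rewrite ler_ln ?posrE ?mulr_gt0//; try by rewrite ltr_wpDr.
have : sqr_mod (z + w) / PT <= 2 * (sqr_mod z / PT + sqr_mod w / PT).
  by rewrite -mulrDl mulrA ler_wpM2r ?sqr_modD_le// invr_ge0 ltW.
nra.
Qed.

(** The reason for working with logarithms: channel and input are dependent, yet their contributions
    separate into a sum whose terms need only their own means. *)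
Lemma log_gainM z w : log_gain PT (z * w) <= ln (1 + sqr_mod z) + log_gain PT w.
Proof.
have z0 := sqr_mod_ge0 z; have w0 := ratio_ge0 w; have zw0 := ratio_ge0 (z * w).
rewrite /log_gain -lnM ?posrE; try by rewrite ltr_wpDr.
rewrite ler_ln ?posrE ?mulr_gt0//; try by rewrite ltr_wpDr.
rewrite sqr_modM -mulrA; nra.
Qed.

Lemma log_gainM_le z w : log_gain PT (z * w) <= sqr_mod z + sqr_mod w / PT.
Proof.
apply: le_trans (log_gainM z w) _; rewrite lerD ?log_gain_le//.
by apply: le_ln1Dx; apply: lt_le_trans (sqr_mod_ge0 z); rewrite ltrN10.
Qed.

Lemma log_gain_sum (I : Type) (s : seq I) (F : I -> R[i]) :
  log_gain PT (\sum_(i <- s) F i) <=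
  (size s)%:R * ln 2 + \sum_(i <- s) log_gain PT (F i).
Proof.
elim: s => [|i s ih].
  by rewrite !big_nil /log_gain /sqr_mod /= !expr0n /= addr0 !mul0r addr0 ln1 addr0.
rewrite !big_cons /= -natr1.
have := log_gainD (F i) (\sum_(j <- s) F j); lra.
Qed.

Lemma log_gain_div z g (delta : R) : 0 < delta -> delta <= 1 -> delta <= sqr_mod g ->
  log_gain PT (z / g) <= - ln delta + log_gain PT z.
Proof.
move=> d0 d1 dg; have z0 := ratio_ge0 z; have zg0 := ratio_ge0 (z / g).
rewrite -lnV ?posrE// /log_gain -lnM ?posrE ?invr_gt0//; try by rewrite ltr_wpDr.
rewrite ler_ln ?posrE ?mulr_gt0 ?invr_gt0//; try by rewrite ltr_wpDr.
have h1 : 1 <= delta^-1 by rewrite invf_ge1.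
have h2 : (sqr_mod g)^-1 <= delta^-1 by rewrite lef_pV2 ?posrE// (lt_le_trans d0).
rewrite sqr_modM sqr_modV mulrAC.
have := ler_wpM2l z0 h2; lra.
Qed.

End log_gain.

Section bounded_mean.
Context {d : measure_display} {Omega : measurableType d} {R : realType}.
Variable P : probability Omega R.

Definition bounded_mean (f : Omega -> R) (a : R) : Prop :=
  [/\ measurable_fun setT f, forall w, 0 <= f w & (\int[P]_w (f w)%:E <= a%:E)%E].

Lemma bounded_meanD f g a b : bounded_mean f a -> bounded_mean g b ->
  bounded_mean (fun w => f w + g w) (a + b).
Proof.
move=> [mf f0 fa] [mg g0 gb]; split.
- exact: measurable_funD.
- by move=> w; rewrite addr_ge0.
- under eq_integral do rewrite EFinD.
  rewrite ge0_integralD//; first by rewrite EFinD leeD.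
  + by move=> w _; rewrite lee_fin.
  + exact/measurable_EFinP.
  + by move=> w _; rewrite lee_fin.
  + exact/measurable_EFinP.
Qed.

Lemma bounded_meanZ f a k : 0 <= k -> bounded_mean f a ->
  bounded_mean (fun w => k * f w) (k * a).
Proof.
move=> k0 [mf f0 fa]; split.
- exact: measurable_funM.
- by move=> w; rewrite mulr_ge0.
- under eq_integral do rewrite EFinM.
  rewrite ge0_integralZl ?lee_fin//; first by rewrite EFinM lee_wpmul2l ?lee_fin.
  + exact/measurable_EFinP.
  + by move=> w _; rewrite lee_fin.
Qed.

Lemma bounded_mean_cst a : 0 <= a -> bounded_mean (fun=> a) a.
Proof.
move=> a0; split => //.
by rewrite integral_cst//= probability_setT mule1.
Qed.

Lemma bounded_mean_sum (I : Type) (s : seq I) (f : I -> Omega -> R) (a : I -> R) :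
  (forall i, bounded_mean (f i) (a i)) ->
  bounded_mean (fun w => \sum_(i <- s) f i w) (\sum_(i <- s) a i).
Proof.
move=> fa; elim: s => [|i s ih].
  by under eq_fun do rewrite big_nil; rewrite big_nil; exact: bounded_mean_cst.
by under eq_fun do rewrite big_cons; rewrite big_cons; exact: bounded_meanD.
Qed.

End bounded_mean.

Section output_energy.
Context {d : measure_display} {Omega : measurableType d} {R : realType}
        {P : probability Omega R} {K : nat}.
Variable ch : jammed_broadcast_channel P K.
Context {c : configuration} {n : nat} (C : broadcast_code R K c n).
Variables (PT : R) (k : 'I_K) (delta : R).
Hypotheses (PT_ge1 : 1 <= PT) (delta_gt0 : 0 < delta) (delta_le1 : delta <= 1).

Local Notation costly := (costly ch k delta).
Local Notation weight := (weight ch C PT k delta).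

Let PT_gt0 : 0 < PT. Proof. exact: lt_le_trans PT_ge1. Qed.

(** Each term has a mean bounded independently of the power: the covariances handle [H] and [G], the
    power constraint handles the input, and the jammer variance [PT] is divided out. *)
Definition output_energy t w : R :=
  \sum_(l < K) sqr_mod (bc_H ch t k w 0 l) +
  PT^-1 * sqr_norm (channel_input ch C t w) +
  \sum_(l < K) sqr_mod (bc_G ch t k w 0 l) +
  \sum_(l < K) (PT^-1 * sqr_mod (bc_J ch PT t l w)) +
  sqr_mod (bc_N ch t k w).

(** Each of the two inner products costs [ln 2] per antenna, and the two additions forming the
    output cost [ln 2] each: hence [K * 2 + 2]. *)
Lemma log_gain_output t w :
  log_gain PT (channel_output ch PT C k t w) <=
  (K%:R * 2 + 2) * ln 2 + output_energy t w.
Proof.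
have ln2 : 0 <= ln (2 : R) by rewrite ln_ge0// ler1n.
have prod_le (x : 'rV[R[i]]_K) (z : 'cV[R[i]]_K) :
    log_gain PT ((x *m z) 0 0) <= K%:R * ln 2 +
    (\sum_(l < K) sqr_mod (x 0 l) + \sum_(l < K) PT^-1 * sqr_mod (z l 0)).
  rewrite mxE; apply: le_trans (log_gain_sum PT_ge1 _ _) _.
  rewrite /index_enum; rewrite -enumT size_enum_ord lerD2l.
  rewrite -big_split /= enumT; apply: ler_sum => l _.
  by apply: le_trans (log_gainM_le PT_ge1 _ _) _; rewrite lerD2l mulrC.
have sums0 : 0 <= \sum_(l < K) sqr_mod (bc_G ch t k w 0 l) +
    \sum_(l < K) (PT^-1 * sqr_mod (bc_J ch PT t l w)).
  by rewrite addr_ge0// sumr_ge0// => l _; rewrite ?sqr_mod_ge0 ?mulr_ge0 ?sqr_mod_ge0 ?invr_ge0 ?(ltW PT_gt0).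
have jam_le : log_gain PT ((tnth (bc_S ch t w) k)%:R *
     (bc_G ch t k w *m jammer_signal ch PT t w) 0 0) <= K%:R * ln 2 +
    (\sum_(l < K) sqr_mod (bc_G ch t k w 0 l) +
     \sum_(l < K) (PT^-1 * sqr_mod (bc_J ch PT t l w))).
  case: (tnth _ _); rewrite ?mul1r ?mul0r.
    apply: le_trans (prod_le _ _) _; rewrite !lerD2l.
    by apply: ler_sum => l _; rewrite mxE.
  rewrite /log_gain /sqr_mod /= !expr0n /= addr0 mul0r addr0 ln1.
  by rewrite addr_ge0// mulr_ge0.
have useful_le := prod_le (bc_H ch t k w) (channel_input ch C t w).
rewrite -mulr_sumr -/(sqr_norm _) in useful_le.
rewrite /channel_output /output_energy.
set u := (bc_H ch t k w *m _) 0 0 in useful_le *.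
set j := (_%:R * _) in jam_le *.
have := log_gainD PT_ge1 (u + j) (bc_N ch t k w).
have := log_gainD PT_ge1 u j.
have := log_gain_le_sqr_mod PT_ge1 (bc_N ch t k w).
move: useful_le jam_le; lra.
Qed.

(** An upper bound for minus the logarithm of the weight. Only its first term grows with the power;
    [- ln delta] pays for dividing by the gain, and the factors 2 come from the square of the energy
    in the dummy density. *)
Definition slot_cost t w : R :=
  (costly t w)%:R * ln PT + (ln pi - 2 * ln delta + 2 * ((K%:R * 2 + 2) * ln 2))
  + 2 * output_energy t w.

Lemma weight_ge_exp t w : expR (- slot_cost t w) <= weight t w.
Proof.
have pi0 := pi_gt0 R.
set z := channel_output ch PT C k t w / gain ch k delta t w.
have gd : delta <= sqr_mod (gain ch k delta t w).
  rewrite /gain /costly; case: ifPn => [_|].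
    by rewrite /sqr_mod /= expr1n expr0n /= addr0.
  by rewrite negb_or -leNgt => /andP[].
have lz : log_gain PT z <= - ln delta + ((K%:R * 2 + 2) * ln 2 + output_energy t w).
  apply: le_trans (log_gain_div PT_ge1 _ delta_gt0 delta_le1 gd) _.
  by rewrite lerD2l log_gain_output.
set m := 1 + sqr_mod z / PT.
have z0 : 0 <= sqr_mod z / PT by rewrite divr_ge0 ?sqr_mod_ge0// ltW.
have m0 : 0 < m by rewrite /m ltr_wpDr.
set v := if costly t w then 1 else PT.
have v0 : 0 < v by rewrite /v; case: ifP.
have lnv : ln v = ln PT - (costly t w)%:R * ln PT.
  by rewrite /v; case: ifP => _; rewrite ?ln1 ?mul1r ?mul0r ?subr0 ?subrr.
(* Each of [PT + x ^+ 2] and [PT + y ^+ 2] is at most [PT * m], so the dummy density is at least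
   [1 / (pi ^+ 2 * PT * m ^+ 2)]; the factor [pi * v] of the weight gives this middle term. *)
apply: (@le_trans _ _ (v / (pi * PT * m ^+ 2))).
  rewrite -[leRHS]lnK ?posrE ?divr_gt0 ?mulr_gt0 ?exprn_gt0//.
  rewrite ler_expR lnM ?posrE ?invr_gt0 ?mulr_gt0 ?exprn_gt0//.
  rewrite lnV ?posrE ?mulr_gt0 ?exprn_gt0//.
  rewrite !lnM ?posrE ?mulr_gt0 ?exprn_gt0//.
  rewrite lnv /slot_cost.
  have -> : ln m = log_gain PT z by [].
  lra.
rewrite /weight -/z -/v /cauchy2 /cauchy_density sqr_sqrtr ?(ltW PT_gt0)//.
set x := complex.Re z; set y := complex.Im z.
have mE : PT * m = PT + (x ^+ 2 + y ^+ 2).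
  by rewrite /m mulrDr mulr1 mulrC divfK ?gt_eqF.
have x0 : 0 < PT + x ^+ 2 by rewrite ltr_wpDr ?sqr_ge0.
have y0 : 0 < PT + y ^+ 2 by rewrite ltr_wpDr ?sqr_ge0.
have sPT : Num.sqrt PT * Num.sqrt PT = PT by rewrite -expr2 sqr_sqrtr// ltW.
rewrite (_ : pi * v * _ = v * PT / (pi * ((PT + x ^+ 2) * (PT + y ^+ 2)))); last first.
  rewrite -[X in v * X / _]sPT; move: (pi : R) pi0 => p p0.
  by field; rewrite !gt_eqF.
rewrite (_ : v / _ = v * PT / (pi * ((PT * m) * (PT * m)))); last first.
  by move: (pi : R) pi0 => p p0; field; rewrite !gt_eqF.
rewrite ler_pM2l ?mulr_gt0// lef_pV2 ?posrE ?mulr_gt0// ler_pM2l//.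
by rewrite mE; apply: ler_pM; rewrite ?(ltW x0) ?(ltW y0)// lerD2l ?lerDl ?lerDr sqr_ge0.
Qed.

End output_energy.

(** * Mean cost of a slot and Markov's inequality *)

Section rate_bound.
Context {d : measure_display} {Omega : measurableType d} {R : realType}
        {P : probability Omega R} {K : nat}.
Variable ch : jammed_broadcast_channel P K.
Variables (k : 'I_K) (delta lambda : R).
Hypotheses (delta_gt0 : 0 < delta) (delta_le1 : delta <= 1).
Hypothesis hlambda : forall t, P [set w | tnth (bc_S ch t w) k = false] = lambda%:E.

(** The second moment at time 0 is finite by the covariance assumption, and identical distribution
    carries it to every time. *)
Lemma mean_sqr_mod_entry (X : nat -> {RV P >-> 'rV[R[i]]_K}) l :
  (forall t, identically_distributed (X t) (X 0%N)) -> identity_covariance P (X 0%N) ->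
  exists a : R, 0 <= a /\ forall t, bounded_mean P (fun w => sqr_mod (X t w 0 l)) a.
Proof.
move=> idX [finX _].
pose f (x : 'rV[R[i]]_K) : \bar R := (sqr_mod (x 0 l))%:E.
have mfR : measurable_fun setT (fun x : 'rV[R[i]]_K => sqr_mod (x 0 l)).
  by apply: measurable_sqr_mod; exact: measurable_mx_entry.
have mf : measurable_fun setT f by exact/measurable_EFinP.
have f0 x : (0 <= f x)%E by rewrite lee_fin sqr_mod_ge0.
have E0 : (\int[P]_w f (X 0%N w) < +oo)%E by have := finX l; rewrite unlock.
have E00 : (0 <= \int[P]_w f (X 0%N w))%E by exact: integral_ge0.
exists (fine (\int[P]_w f (X 0%N w))%E); split; first exact: fine_ge0.
move=> t; split.
- exact: (measurableT_comp mfR).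
- by move=> w; exact: sqr_mod_ge0.
rewrite fineK ?ge0_fin_numE//.
rewrite -(ge0_integral_distribution (X 0%N) mf f0).
rewrite (_ : (\int[P]_w (sqr_mod (X t w 0 l))%:E)%E =
  (\int[distribution P (X t)]_x f x)%E); last by rewrite ge0_integral_distribution.
rewrite le_eqVlt; apply/orP; left; apply/eqP.
by apply: eq_measure_integral => A mA _; exact: idX.
Qed.

Definition weak_jamming : R :=
  fine (P [set w | sqr_mod (bc_G ch 0%N k w 0 k) < delta]).

Lemma measurable_weak_jamming t :
  measurable [set w | sqr_mod (bc_G ch t k w 0 k) < delta].
Proof.
rewrite -[X in measurable X]setTI.
apply: (measurable_fun_ltr _ _ measurableT) => //.
apply: measurable_sqr_mod.
exact: (measurableT_comp (@measurable_mx_entry _ _ _ _ 0 k)).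
Qed.

Lemma weak_jamming_probability t :
  P [set w | sqr_mod (bc_G ch t k w 0 k) < delta] = weak_jamming%:E.
Proof.
have mA : measurable [set x : 'rV[R[i]]_K | sqr_mod (x 0 k) < delta].
  rewrite -[X in measurable X]setTI.
  apply: (measurable_fun_ltr _ _ measurableT) => //.
  by apply: measurable_sqr_mod; exact: measurable_mx_entry.
rewrite /weak_jamming fineK ?fin_num_measure//; last exact: measurable_weak_jamming.
exact: (G_ident ch t k mA).
Qed.

Lemma mean_costly t :
  bounded_mean P (fun w => (costly ch k delta t w)%:R) (lambda + weak_jamming).
Proof.
have mc : measurable_fun setT (costly ch k delta t).
  exact: (@measurable_costly _ _ _ _ _ ch k delta _ Omega id).
split => //.
  exact: (measurable_from_bool (fun b : bool => b%:R : R) mc).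
pose A := [set w | tnth (bc_S ch t w) k = false].
pose B := [set w | sqr_mod (bc_G ch t k w 0 k) < delta].
have mB : measurable B by exact: measurable_weak_jamming.
have mA : measurable A.
  rewrite -[A]setTI.
  have mS := @measurable_jammed _ _ _ _ _ ch _ Omega id _ t k.
  exact: (mS _ measurableT [set false]).
have mAB : measurable (A `|` B) by exact: measurableU.
rewrite (eq_integral (fun w => (\1_(A `|` B) w)%:E)).
  rewrite integral_indic// setIT; apply: le_trans (measureU2 _ _ _) _ => //.
  have PA : P A = lambda%:E by exact: hlambda.
  have PB : P B = weak_jamming%:E by exact: weak_jamming_probability.
  by rewrite [X in (X + _)%E]PA [X in (_ + X)%E]PB.
move=> w _; rewrite indicE /costly; congr ((nat_of_bool _)%:R%:E).
apply/idP/idP => [/orP[/negbTE Sf|sG]|/set_mem[/= ->//|/= ->]]; last by rewrite orbT.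
  by apply/mem_set; left.
by apply/mem_set; right.
Qed.

(** [C1] precedes the code, the block length and the power, because it must become negligible
    against [ln PT]. Its summands are the moments of [H] and [G], 1 for the normalized input, and 6
    for each normalized Gaussian. *)
Lemma mean_slot_cost : exists C1 : R, 0 < C1 /\
  forall (c : configuration) n (C : broadcast_code R K c n) PT, 1 <= PT ->
    power_constraint ch PT C -> forall t, (t < n)%N ->
    bounded_mean P (slot_cost ch C PT k delta t)
      ((lambda + weak_jamming) * ln PT + C1).
Proof.
have /choice[aH HaH] := fun l => mean_sqr_mod_entry l
   (fun t => @H_ident _ _ _ _ _ ch t k) (H_covariance ch 0%N k).
have /choice[aG HaG] := fun l => mean_sqr_mod_entry l
   (fun t => @G_ident _ _ _ _ _ ch t k) (G_covariance ch 0%N k).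
pose C0 : R := ln pi - 2 * ln delta + 2 * ((K%:R * 2 + 2) * ln 2).
have pi1 : 0 < ln (pi : R) by rewrite ln_gt0// (lt_le_trans _ (pi_ge2 R))// ltr1n.
have C00 : 0 < C0.
  rewrite /C0 -addrA ltr_wpDr// addr_ge0//.
    by rewrite oppr_ge0 mulr_ge0_le0// ln_le0.
  by rewrite !mulr_ge0// ?addr_ge0 ?mulr_ge0// ln_ge0// ler1n.
pose C1 : R := C0 + 2 * (\sum_(l < K) aH l + 1 + \sum_(l < K) aG l +
   \sum_(l < K) 6 + 6 * 1).
exists C1; split.
  rewrite /C1 ltr_wpDr// mulr_ge0// !addr_ge0// ?sumr_ge0// => l _.
    by have [] := HaH l.
  by have [] := HaG l.
move=> c n C PT PT1 pow t tn.
have PT0 : 0 < PT by exact: lt_le_trans PT1.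
rewrite /C1 [X in bounded_mean _ _ X]addrA.
apply: bounded_meanD.
  apply: bounded_meanD; last exact/bounded_mean_cst/ltW.
  under eq_fun do rewrite mulrC.
  by rewrite mulrC; apply: bounded_meanZ; [exact: ln_ge0|exact: mean_costly].
apply: bounded_meanZ => //.
have gauss (Z : {RV P >-> R[i]}) v : 0 < v -> circular_gaussian v Z ->
    bounded_mean P (fun w => sqr_mod (Z w)) (6 * v).
  move=> v0 gZ; split.
  - exact: measurable_sqr_mod.
  - by move=> w; exact: sqr_mod_ge0.
  - exact: circular_gaussian_second_moment.
apply: bounded_meanD; last first.
  by apply: gauss => //; exact: N_gaussian.
apply: bounded_meanD; last first.
  apply: bounded_mean_sum => l; rewrite (_ : 6 = PT^-1 * (6 * PT)); last first.
    by field; rewrite gt_eqF.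
  apply: bounded_meanZ; first by rewrite invr_ge0 ltW.
  by apply: gauss => //; exact: J_gaussian.
apply: bounded_meanD; last first.
  by apply: bounded_mean_sum => l; have [_] := HaG l.
apply: bounded_meanD.
  by apply: bounded_mean_sum => l; have [_] := HaH l.
rewrite (_ : 1 = PT^-1 * PT); last by rewrite mulVf// gt_eqF.
apply: bounded_meanZ; first by rewrite invr_ge0 ltW.
split; last by have := pow t tn; rewrite unlock.
  have mX : measurable_fun setT (channel_input ch C t).
    exact: (@measurable_channel_input _ _ _ _ _ ch _ Omega id).
  rewrite /sqr_norm; elim: (index_enum _) => [|l s ih].
    by under eq_fun do rewrite big_nil; exact: measurable_cst.
  under eq_fun do rewrite big_cons; apply: measurable_funD => //.
  apply: measurable_sqr_mod; exact: (measurable_mxP _).1 mX l 0.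
by move=> w; rewrite sumr_ge0// => l _; exact: sqr_mod_ge0.
Qed.

Lemma measurable_decoded c n (C : broadcast_code R K c n) PT :
  measurable_fun setT (decoded ch PT C k).
Proof.
apply: (measurableT_comp (@decoder_measurable _ _ _ _ C k)).
apply: measurable_fun_pair; last exact: (@measurable_jsi_upto _ _ _ _ _ ch _ Omega id).
apply: measurable_fun_pair; last exact: (@measurable_csi_upto _ _ _ _ _ ch _ Omega id).
apply/measurable_fun_tnthP => i.
rewrite (_ : _ \o _ = channel_output ch PT C k i); last first.
  by apply/funext => x /=; rewrite tnth_mktuple.
exact: (@measurable_channel_output _ _ _ _ _ ch _ Omega id).
Qed.

Lemma measurable_error c n (C : broadcast_code R K c n) PT :
  measurable [set w | bc_W ch (sizes C) k w <> decoded ch PT C k w].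
Proof.
rewrite (_ : [set w | _] = ~` [set w | bc_W ch (sizes C) k w == decoded ch PT C k w]).
  apply: measurableC; rewrite -[X in measurable X]setTI.
  apply: (measurable_fun_eqn _ _ measurableT) => //; exact: measurable_decoded.
by apply/seteqP; split=> w /= neq /eqP /neq.
Qed.

(* Either the total cost exceeds [s], which Markov's inequality controls, or the
   product of the weights is at least [exp(-s)]. *)
Lemma markov_converse c n (C : broadcast_code R K c n) PT (B s : R) :
  1 <= PT -> 0 < s ->
  (forall t, (t < n)%N -> bounded_mean P (slot_cost ch C PT k delta t) B) ->
  (1 - error_probability ch PT C k <=
    (expR s / (sizes C k)%:R + n%:R * B / s)%:E)%E.
Proof.
move=> PT1 s0 HB.
have PT0 : 0 < PT by exact: lt_le_trans PT1.
pose E := [set w | bc_W ch (sizes C) k w <> decoded ch PT C k w].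
have mE : measurable E by exact: measurable_error.
rewrite /error_probability -/E -probability_setC//.
pose good w : R := (decoded ch PT C k w == bc_W ch (sizes C) k w)%:R *
  \prod_(t < n) weight ch C PT k delta t w.
pose cost w : R := \sum_(t < n) slot_cost ch C PT k delta t w.
have good_mean : bounded_mean P good ((sizes C k)%:R^-1).
  split; last exact: weighted_correct_le.
    apply: measurable_funM.
      apply: (measurable_from_bool (fun b : bool => b%:R : R)).
      by apply: measurable_fun_eqn => //; exact: measurable_decoded.
    elim: (index_enum _) => [|t l ih].
      by under eq_fun do rewrite big_nil; exact: measurable_cst.
    under eq_fun do rewrite big_cons; apply: measurable_funM => //.
    exact: (@measurable_weight _ _ _ _ _ ch _ _ C PT k delta PT0 _ Omega id).
  by move=> w; rewrite mulr_ge0// prodr_ge0// => t _; exact: weight_ge0.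
have cost_mean : bounded_mean P cost (n%:R * B).
  rewrite (_ : n%:R * B = \sum_(t < n) B); last first.
    by rewrite sumr_const card_ord mulr_natl.
  by apply: bounded_mean_sum => t; exact: HB.
have s10 : 0 <= s^-1 by rewrite invr_ge0 ltW.
have [_ _] := bounded_meanD (bounded_meanZ (expR_ge0 s) good_mean)
  (bounded_meanZ s10 cost_mean).
rewrite [X in (_ <= (_ + X)%:E)%E -> _](mulrC s^-1); apply: le_trans.
rewrite -(setIT (~` E)) -integral_indic//; last exact: measurableC.
apply: ge0_le_integralT => w; rewrite ?lee_fin// indicE.
have [_ good0 _] := good_mean; have [_ cost0 _] := cost_mean.
case: (boolP (w \in ~` E)) => [/set_mem wE|_] /=; last first.
  by rewrite addr_ge0// mulr_ge0// ?expR_ge0// invr_ge0 ltW.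
have [sc|cs] := leP s (cost w).
  apply: ler_wpDl; first by rewrite mulr_ge0 ?expR_ge0.
  by rewrite mulrC ler_pdivlMr// mul1r.
apply: ler_wpDr; first exact: mulr_ge0.
have -> : good w = \prod_(t < n) weight ch C PT k delta t w.
  rewrite /good (_ : _ == _) ?mul1r//.
  by apply/eqP/esym; apply: contrapT => neq; exact: wE.
apply: (@le_trans _ _ (expR s * expR (- cost w))).
  by rewrite -expRD -[X in X <= _]expR0 ler_expR subr_ge0 ltW.
rewrite ler_wpM2l ?expR_ge0// /cost -sumrN expR_sum.
by apply: ler_prod => t _; rewrite expR_ge0 /= weight_ge_exp.
Qed.

End rate_bound.

(** * Limits in the block length and in the power *)

Section converse.
Context {d : measure_display} {Omega : measurableType d} {R : realType}
        {P : probability Omega R} {K : nat}.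
Variable ch : jammed_broadcast_channel P K.

(** If the rate exceeded the mean cost [B], a cost threshold slightly above [n * B] would be passed
    with probability bounded away from 1, while below it a correct guess is exponentially unlikely.
    The error could then not tend to 0. *)
Lemma achievable_rate_le (k : 'I_K) (delta lambda : R) :
  0 < delta -> delta <= 1 ->
  (forall t, P [set w | tnth (bc_S ch t w) k = false] = lambda%:E) ->
  exists C1 : R, forall c PT r, 1 <= PT -> achievable ch c PT r ->
    r k <= (lambda + weak_jamming ch k delta) * ln PT + C1.
Proof.
move=> d0 d1 hl; have [C1 [C10 HC1]] := mean_slot_cost d1 hl.
exists C1 => c PT r PT1 [C [pow rateC errC]].
set B := (_ * _ + _).
have lam0 : 0 <= lambda.
  by rewrite -lee_fin -(hl 0%N) measure_ge0.
have B0 : 0 < B.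
  rewrite /B ltr_wpDl// mulr_ge0 ?ln_ge0// addr_ge0// /weak_jamming.
  exact: fine_ge0.
rewrite leNgt; apply/negP => Br.
(* Three equal gaps: the threshold is [n * B1] with [B1 = B + e], the actual rate eventually exceeds
   [B2 = B + 2 * e], and [r k = B + 3 * e]. *)
pose e := (r k - B) / 3.
have e0 : 0 < e by rewrite divr_gt0// subr_gt0.
pose B1 := B + e; pose B2 := B + 2 * e.
have B10 : 0 < B1 by rewrite addr_gt0.
have rB2 : B2 < r k by rewrite /B2 /e; lra.
(* Half of what Markov's inequality leaves at the threshold: an error below [theta] and a guessing
   term of at most [theta] together contradict the bound. *)
pose theta := (1 - B / B1) / 2.
have th0 : 0 < theta.
  rewrite /theta divr_gt0// subr_gt0 ltr_pdivrMr// mul1r /B1.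
  by rewrite ltrDl.
have ev_rate : \forall n \near \oo, B2 < rate (C n) k.
  exact: (cvgr_gt _ (rateC k) _ rB2).
have ev_err : \forall n \near \oo, (error_probability ch PT (C n) k < theta%:E)%E.
  have /fine_cvgP[fin cvge] := errC k.
  have lt := cvgr_lt _ cvge _ th0.
  near=> n.
  have finn : error_probability ch PT (C n) k \is a fin_num by near: n.
  have ltn : fine (error_probability ch PT (C n) k) < theta by near: n; exact: lt.
  by rewrite -(fineK finn) lte_fin.
(* Makes [expR (- (n%:R * e))] at most [theta], through [1 + x <= expR x]. *)
have ev_e : \forall n \near \oo, (theta^-1 / e) < n%:R :> R.
  exact: nbhs_infty_gtr.
have [n [[Rn En] nbig]] : exists n, ((B2 < rate (C n) k) /\
   (error_probability ch PT (C n) k < theta%:E)%E) /\ (theta^-1 / e < n%:R).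
  apply: (@filter_ex _ \oo); near=> n.
  by split; [split|]; near: n.
have te0 : 0 < theta^-1 / e by rewrite divr_gt0 ?invr_gt0.
have n0 : (0 < n%:R :> R) by exact: lt_trans nbig.
have := markov_converse d0 d1 PT1 (mulr_gt0 n0 B10) (fun t tn => HC1 c n (C n) PT PT1 (pow n) t tn).
set M := sizes (C n) k.
have M0 : 0 < M%:R :> R by rewrite ltr0n; exact: sizes_gt0.
have expM : expR (n%:R * B1) / M%:R <= theta.
  have lnM2 : n%:R * B2 <= ln (M%:R : R).
    by have := Rn; rewrite /rate -/M ltr_pdivlMr// mulrC => /ltW.
  have -> : (M%:R : R) = expR (ln M%:R) by rewrite lnK.
  rewrite -expRN -expRD.
  apply: (@le_trans _ _ (expR (- (n%:R * e)))).
    by rewrite ler_expR; move: lnM2; rewrite /B1 /B2; lra.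
  rewrite expRN -[leRHS]invrK lef_pV2 ?posrE ?invr_gt0 ?expR_gt0//.
  apply: le_trans (expR_ge1Dx _); apply: (@le_trans _ _ (n%:R * e)).
    by rewrite -ler_pdivrMr// ltW.
  by rewrite lerDr.
have -> : n%:R * B / (n%:R * B1) = B / B1.
  by field; rewrite !gt_eqF.
have errfin : error_probability ch PT (C n) k \is a fin_num.
  by rewrite fin_num_measure//; exact: measurable_error.
rewrite -(fineK errfin) -EFinB lee_fin => bound.
have errlt : fine (error_probability ch PT (C n) k) < theta.
  by rewrite -lte_fin fineK.
move: bound errlt expM; rewrite /theta -/M -/B; lra.
Unshelve. all: by end_near. Qed.

(** Continuity from above along the thresholds [1 / (n + 1)]: the events decrease to the vanishing
    of the coefficient, which is null. *)
Lemma weak_jamming_small (k : 'I_K) (eta : R) : 0 < eta ->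
  exists delta : R, [/\ 0 < delta, delta <= 1 & weak_jamming ch k delta < eta].
Proof.
move=> eta0.
pose F n := [set w | sqr_mod (bc_G ch 0%N k w 0 k) < n.+1%:R^-1].
have mF n : measurable (F n) by exact: measurable_weak_jamming.
have FI : \bigcap_n F n = [set w | bc_G ch 0%N k w 0 k = 0].
  apply/seteqP; split=> w /= Fw.
    apply/eqP; rewrite -sqr_mod_eq0 eq_le sqr_mod_ge0 andbT.
    apply/ler_addgt0Pr => e e0; rewrite add0r.
    have [n ne] := ltr_add_invr (y := 0) e0.
    by rewrite add0r in ne; apply: ltW; apply: lt_trans ne; exact: Fw.
  by move=> n _; rewrite /F /= Fw /sqr_mod /= expr0n /= addr0 invr_gt0.
have mI : measurable (\bigcap_n F n) by exact: bigcapT_measurable.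
have cv : P (F n) @[n --> \oo] --> P (\bigcap_n F n).
  apply: nonincreasing_cvg_mu => //; first by rewrite ltey_eq fin_num_measure.
  move=> m n mn; apply/subsetPset => w; rewrite /F /= => /lt_le_trans; apply.
  by rewrite lef_pV2 ?posrE// ler_nat ltnS.
rewrite FI null_G_entry in cv.
have /fine_cvgP[_ cvf] := cv.
have ev : \forall n \near \oo, fine (P (F n)) < eta by exact: (cvgr_lt _ cvf _ eta0).
have [n Hn] := filter_ex ev.
exists n.+1%:R^-1; split; rewrite ?invr_gt0//.
by rewrite invf_le1// ler1n.
Qed.

(** The order of choices matters: [delta] makes weak jamming rarer than [e / 2], the constant [C1]
    depends on [delta], and only then is [PT] taken so large that [C1] is below [e / 2 * ln PT]. *)
Lemma dof_region_converse (lambda : 'I_K -> R) (c : configuration) dof :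
  (forall k t, P [set w | tnth (bc_S ch t w) k = false] = (lambda k)%:E) ->
  dof_region ch c dof -> forall k, 0 <= dof k /\ dof k <= lambda k.
Proof.
move=> hl [r [ach lim]] k; split.
  apply: (cvgr_to_ge (lim k)); near=> PT.
  have PT1 : 1 < PT by near: PT; exact: nbhs_pinfty_gt.
  rewrite divr_ge0 ?(ltW (ln_gt0 PT1))//.
  have [|C [_ rateC _]] := ach PT; first exact: lt_trans PT1.
  apply: (cvgr_to_ge (rateC k)); near=> n.
  by rewrite /rate divr_ge0// ln_ge0// ler1n sizes_gt0.
apply/ler_addgt0Pr => e e0.
have e20 : 0 < e / 2 by rewrite divr_gt0.
have [delta [d0 d1 jd]] := weak_jamming_small k e20.
have [C1 HC1] := achievable_rate_le d0 d1 (hl k).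
apply: (cvgr_to_le (lim k)); near=> PT.
have PT1 : 1 < PT by near: PT; exact: nbhs_pinfty_gt.
have PTC : expR (C1 / (e / 2)) < PT by near: PT; exact: nbhs_pinfty_gt.
have lnPT : 0 < ln PT by exact: ln_gt0.
rewrite ler_pdivrMr//; apply: le_trans (HC1 c PT (r PT) (ltW PT1) _) _.
  by apply: ach; exact: lt_trans PT1.
have : C1 / (e / 2) < ln PT.
  by rewrite -ltr_expR lnK// posrE (lt_trans _ PT1).
rewrite ltr_pdivrMr// => C1e.
have := ler_wpM2r (ltW lnPT) (ltW jd).
move: C1e; lra.
Unshelve. all: by end_near. Qed.

End converse.

(** * Gilbert-Varshamov codes *)

Section gilbert_varshamov.
Variables (A : finType) (n : nat).
Local Open Scope nat_scope.
Local Open Scope set_scope.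

(** The block length minus the Hamming distance; the decoder counts matches, so agreement is the
    natural quantity to bound. *)
Definition agreement (x y : {ffun 'I_n -> A}) : nat := #|[set t | x t == y t]|.

Lemma card_agree_on (c : {ffun 'I_n -> A}) (B : {set 'I_n}) :
  #|[set x : {ffun 'I_n -> A} | [forall t in B, x t == c t]]| = #|A| ^ (n - #|B|).
Proof.
pose F t : pred A := if t \in B then pred1 (c t) else predT.
rewrite (eq_card (B := family F)) => [|x]; last first.
  rewrite inE; apply/forallP/familyP => H t;
    by have := H t; rewrite /F; case: (t \in B).
rewrite card_family foldrE big_map big_enum /=.
rewrite (bigID (mem B)) /= big1 => [|t tB]; last by rewrite /F tB card1.
rewrite mul1n (eq_bigr (fun=> #|A|)) => [|t tB]; last by rewrite /F (negbTE tB).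
rewrite prod_nat_const; congr (_ ^ _); apply/eqP.
have Bn : #|B| <= n by rewrite -[X in _ <= X](card_ord n) max_card.
by rewrite -(eqn_add2l #|B|) subnKC//; have /= -> := cardC (mem B); rewrite card_ord.
Qed.

(** Union over the sets of positions of agreement. Counting all [2 ^ n] of them is crude, but costs
    only [ln 2] per slot, independently of the alphabet. *)
Lemma card_agreement_ball (c : {ffun 'I_n -> A}) s : 0 < #|A| ->
  #|[set x | s <= agreement x c]| <= 2 ^ n * #|A| ^ (n - s).
Proof.
move=> A0.
have sub : [set x | s <= agreement x c] \subset
  \bigcup_(B in [set B : {set 'I_n} | s <= #|B|])
     [set x : {ffun 'I_n -> A} | [forall t in B, x t == c t]].
  apply/fintype.subsetP => x; rewrite inE => sx; apply/bigcupP.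
  exists [set t | x t == c t]; first by rewrite inE.
  by rewrite inE; apply/forallP => t; apply/implyP; rewrite inE.
apply: leq_trans (subset_leq_card sub) _.
apply: (@leq_trans (\sum_(B in [set B : {set 'I_n} | s <= #|B|]) #|A| ^ (n - s))).
  elim/big_rec2: _ => [|B u E + leEu]; first by rewrite cards0.
  rewrite inE => sB; apply: leq_trans (leq_card_setU _ _) _.
  by rewrite leq_add// card_agree_on leq_pexp2l// leq_sub2l.
rewrite sum_nat_const leq_mul2r; apply/orP; right.
by apply: leq_trans (max_card _) _; rewrite -cardsT -powersetT card_powerset cardsT card_ord.
Qed.

(** Greedy choice: while the balls around the words already chosen do not cover the space, any
    uncovered word can be added. *)
Lemma gilbert_varshamov M s : 0 < #|A| -> M * (2 ^ n * #|A| ^ (n - s)) <= #|A| ^ n ->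
  exists cw : nat -> {ffun 'I_n -> A}, forall m m', m < M -> m' < M -> m != m' ->
    agreement (cw m) (cw m') < s.
Proof.
move=> A0; elim: M => [_|M ih MA].
  have [a _] := card_gt0P A0; by exists (fun=> [ffun=> a]).
have [|cw cwP] := ih; first by apply: leq_trans MA; rewrite leq_mul2r leqnSn orbT.
pose covered := \bigcup_(m < M) [set x | s <= agreement x (cw m)].
have : #|covered| < #|{ffun 'I_n -> A}|.
  rewrite card_ffun card_ord; apply: leq_trans MA.
  rewrite mulSn -add1n leq_add ?muln_gt0 ?expn_gt0 ?A0//.
  rewrite /covered -[X in _ <= X * _](card_ord M) -sum_nat_const.
  elim/big_rec2: _ => [|m u E _ leEu]; first by rewrite cards0.
  apply: leq_trans (leq_card_setU _ _) _.
  by rewrite leq_add// card_agreement_ball.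
rewrite -(cardsC covered) -[X in X < _]addn0 ltn_add2l => /card_gt0P[x].
rewrite inE => /bigcupP xcov.
have xfar m : m < M -> agreement x (cw m) < s.
  move=> mM; rewrite ltnNge; apply/negP => sm; apply: xcov.
  by exists (Ordinal mM) => //; rewrite inE.
have agreementC y z : agreement y z = agreement z y.
  by apply: eq_card => t; rewrite !inE eq_sym.
exists (fun m => if m == M then x else cw m) => m m'.
rewrite !ltnS => mM m'M mm'.
have [mE|mM'] := eqVneq m M; have [m'E|m'M'] := eqVneq m' M.
- by rewrite mE m'E eqxx in mm'.
- by apply: xfar; rewrite ltn_neqAle m'M'.
- by rewrite agreementC; apply: xfar; rewrite ltn_neqAle mM'.
- by apply: cwP => //; rewrite ltn_neqAle ?mM' ?m'M'.
Qed.

End gilbert_varshamov.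

(** * Weak law for the losses *)

Section weak_law.
Context {d : measure_display} {Omega : measurableType d} {R : realType}.
Variable P : probability Omega R.
Variables (E : nat -> set Omega) (p : R).
Hypothesis mE : forall t, measurable (E t).
Hypothesis PE : forall t, P (E t) = p%:E.
Hypothesis PEE : forall s t, s != t -> P (E s `&` E t) = (p * p)%:E.

Definition occurrences n w : R := \sum_(t < n) \1_(E t) w.

Lemma measurable_indic_sum (I : Type) (s : seq I) (A : I -> set Omega) :
  (forall i, measurable (A i)) ->
  measurable_fun setT (fun w => \sum_(i <- s) (\1_(A i) w : R)).
Proof.
move=> mA; elim: s => [|i s ih].
  by under eq_fun do rewrite big_nil; exact: measurable_cst.
by under eq_fun do rewrite big_cons; apply: measurable_funD.
Qed.

Lemma integral_indic_sum (I : Type) (s : seq I) (A : I -> set Omega) :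
  (forall i, measurable (A i)) ->
  (\int[P]_w (\sum_(i <- s) (\1_(A i) w : R))%:E = \sum_(i <- s) P (A i))%E.
Proof.
move=> mA; under eq_integral do rewrite -sumEFin.
rewrite ge0_integral_sum//.
- by apply: eq_bigr => i _; rewrite integral_indic// setIT.
- by move=> i; apply/measurable_EFinP; exact: measurable_indic.
Qed.

Lemma ge0_integral_lin (f g : Omega -> R) (a b : R) :
  measurable_fun setT f -> measurable_fun setT g ->
  (forall w, 0 <= f w) -> (forall w, 0 <= g w) -> 0 <= a -> 0 <= b ->
  (\int[P]_w (a * f w + b * g w)%:E =
   a%:E * \int[P]_w (f w)%:E + b%:E * \int[P]_w (g w)%:E)%E.
Proof.
move=> mf mg f0 g0 a0 b0.
have scale (h : Omega -> R) e : measurable_fun setT h -> (forall w, 0 <= h w) ->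
    0 <= e -> (\int[P]_w (e * h w)%:E = e%:E * \int[P]_w (h w)%:E)%E.
  move=> mh h0 e0; under eq_integral do rewrite EFinM.
  rewrite ge0_integralZl//; first exact/measurable_EFinP.
  by move=> w _; rewrite lee_fin.
rewrite -!scale//; under eq_integral do rewrite EFinD.
rewrite ge0_integralD//.
- by move=> w _; rewrite lee_fin mulr_ge0.
- by apply/measurable_EFinP; apply: measurable_funM.
- by move=> w _; rewrite lee_fin mulr_ge0.
- by apply/measurable_EFinP; apply: measurable_funM.
Qed.

Let p_ge0 : 0 <= p. Proof. by rewrite -lee_fin -(PE 0%N) measure_ge0. Qed.

Let mean_occurrences n : (\int[P]_w (occurrences n w)%:E = (n%:R * p)%:E)%E.
Proof.
rewrite /occurrences integral_indic_sum//.
rewrite (eq_bigr (fun=> p%:E)); last by move=> t _; exact: PE.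
by rewrite sumEFin sumr_const card_ord mulr_natl.
Qed.

Let mean_occurrences_sqr n :
  (\int[P]_w ((occurrences n w) ^+ 2)%:E =
   (n%:R * p + n%:R * (n%:R - 1) * (p * p))%:E)%E.
Proof.
have -> : (\int[P]_w ((occurrences n w) ^+ 2)%:E =
    \int[P]_w (\sum_(s < n) \sum_(t < n) (\1_(E s `&` E t) w : R))%:E)%E.
  apply: eq_integral => w _; congr EFin.
  rewrite /occurrences expr2 mulr_suml; apply: eq_bigr => s _.
  by rewrite mulr_sumr; apply: eq_bigr => t _; rewrite indicI.
have mEE s t : measurable (E s `&` E t) by exact: measurableI.
under eq_integral do rewrite pair_big /=.
rewrite (integral_indic_sum _ (A := fun i : 'I_n * 'I_n => E i.1 `&` E i.2))//.
rewrite -(pair_big xpredT xpredT (fun s t : 'I_n => P (E s `&` E t)))/=.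
rewrite (eq_bigr (fun=> (p + (n%:R - 1) * (p * p))%:E)) => [|s _]; last first.
  rewrite (bigD1 s)//= setIid [X in (X + _)%E]PE.
  rewrite (eq_bigr (fun=> (p * p)%:E)) => [|t ts]; last by rewrite [LHS]PEE// eq_sym.
  rewrite sumEFin sumr_const -EFinD; congr (_ + _)%:E.
  rewrite -[LHS]mulr_natl; congr (_ * _).
  have n0 : (0 < n)%N by apply: leq_ltn_trans (ltn_ord s).
  rewrite -[RHS](@natrB _ n 1)//; congr _%:R.
  rewrite (eq_card (B := predC1 s)); last by move=> t; rewrite !inE.
  by rewrite cardC1 card_ord subn1.
rewrite sumEFin sumr_const card_ord; congr EFin.
by rewrite -[LHS]mulr_natl mulrDr mulrA.
Qed.

(** Chebyshev's inequality, with the cross term of the square moved to the other side so that only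
    nonnegative functions are integrated; the variance is at most [n] since [p - p * p <= 1]. *)
Lemma weak_law n (delta : R) : (0 < n)%N -> 0 < delta ->
  (P [set w | (occurrences n w <= n%:R * (p - delta))%R] <=
    ((n%:R * delta ^+ 2)^-1)%:E)%E.
Proof.
move=> n0 d0; set F := [set w | _].
have mocc : measurable_fun setT (occurrences n) by exact: measurable_indic_sum.
have mF : measurable F.
  rewrite -[F]setTI; apply: (measurable_fun_ler _ _ measurableT _) => //.
have occ0 w : 0 <= occurrences n w by rewrite sumr_ge0.
have n0R : 0 < n%:R :> R by rewrite ltr0n.
have pw w : n%:R ^+ 2 * delta ^+ 2 * \1_F w + 2 * n%:R * p * occurrences n w <=
    occurrences n w ^+ 2 + (n%:R * p) ^+ 2.
  rewrite indicE; have [wF|_] := boolP (w \in F); last first.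
    by rewrite mulr0 add0r -subr_ge0; have := sqr_ge0 (occurrences n w - n%:R * p); nra.
  move/set_mem: wF; rewrite /F /= mulr1 => wF.
  have h : n%:R * delta <= n%:R * p - occurrences n w by move: wF; lra.
  have nd0 : 0 <= n%:R * delta by rewrite mulr_ge0 ?ltW.
  have : (n%:R * delta) ^+ 2 <= (n%:R * p - occurrences n w) ^+ 2.
    by rewrite ler_sqr ?nnegrE// (le_trans nd0).
  nra.
have c0 : 0 <= n%:R ^+ 2 * delta ^+ 2 by rewrite mulr_ge0 ?sqr_ge0.
have c1 : 0 <= 2 * n%:R * p by rewrite !mulr_ge0.
have int_le : (\int[P]_w (n%:R ^+ 2 * delta ^+ 2 * \1_F w +
      2 * n%:R * p * occurrences n w)%:E <=
    \int[P]_w (occurrences n w ^+ 2 + (n%:R * p) ^+ 2)%:E)%E.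
  apply: ge0_le_integralT => w; last by rewrite lee_fin.
  by rewrite lee_fin; apply: addr_ge0; exact: mulr_ge0.
move: int_le.
rewrite ge0_integral_lin//.
rewrite mean_occurrences integral_indic// setIT.
under [in X in (_ <= X)%E -> _]eq_integral do rewrite -[X in X + _]mul1r -[X in _ + X]mulr1.
rewrite ge0_integral_lin//; last first.
- exact: sqr_ge0.
- by move=> w; exact: sqr_ge0.
- exact: measurable_funX.
rewrite mean_occurrences_sqr integral_cst//= probability_setT mule1 mul1e.
have PF := fin_num_measure P _ mF; rewrite -(fineK PF); set f := fine _.
rewrite mule1 -!EFinM -!EFinD !lee_fin => le.
rewrite -[leRHS]mul1r ler_pdivlMr ?mulr_gt0 ?exprn_gt0//.
have : n%:R * (f * (n%:R * delta ^+ 2)) <= n%:R * 1.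
  have pp : p - p * p <= 1 by nra.
  by have := ler_wpM2l (ltW n0R) pp; move: le; lra.
by rewrite ler_pM2l.
Qed.

End weak_law.

(** * Well-conditioned channel matrices *)

Section good_channel.
Context {d : measure_display} {Omega : measurableType d} {R : realType}
        {P : probability Omega R} {K : nat}.
Variable ch : jammed_broadcast_channel P K.
Implicit Types (L : R).

(** The lower bound on the determinant keeps the received gain above the noise threshold; the upper
    bounds on determinant and cofactors keep the transmitted power bounded. *)
Definition good_matrix L (A : 'M[R[i]]_K) : bool :=
  [&& L^-1 <= sqr_mod (\det A), sqr_mod (\det A) <= L &
      [forall i, forall j, sqr_mod (cofactor A i j) <= L]].

Lemma measurable_good_matrix L {d' : measure_display} {T : measurableType d'}
    (f : T -> 'M[R[i]]_K) : measurable_fun setT f ->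
  measurable_fun setT (fun x => good_matrix L (f x)).
Proof.
move=> mf.
have mdet : measurable_fun setT (fun x => sqr_mod (\det (f x))).
  exact/measurable_sqr_mod/measurable_det.
apply: measurable_and; first exact: measurable_fun_ler.
apply: measurable_and; first exact: measurable_fun_ler.
pose h (v : {ffun 'I_K * 'I_K -> bool}) := [forall i, forall j, v (i, j)].
pose b (ij : 'I_K * 'I_K) x := sqr_mod (cofactor (f x) ij.1 ij.2) <= L.
have mb ij : measurable_fun setT (b ij).
  apply: measurable_fun_ler => //.
  exact/measurable_sqr_mod/measurable_cofactor.
have := measurable_finite_tests h mb.
apply: eq_measurable_fun => x _; rewrite /h.
by apply: eq_forallb => i; apply: eq_forallb => j; rewrite ffunE.
Qed.

Lemma measurable_csi_id t : measurable_fun setT (csi ch t).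
Proof. exact: (@measurable_csi _ _ _ _ _ ch _ Omega id). Qed.

Let csiRV t : {RV P >-> 'M[R[i]]_K} :=
  HB.pack (csi ch t) (isMeasurableFun.Build _ _ _ _ _ (measurable_csi_id t)).

Let row_rectangles : set (set 'M[R[i]]_K) :=
  [set B | exists F : 'I_K -> set 'rV[R[i]]_K, (forall k, measurable (F k)) /\
     B = [set A | forall k, F k (row k A)]].

Let measurable_row k : measurable_fun setT (fun A : 'M[R[i]]_K => row k A).
Proof.
apply/measurable_mxP => i j; under eq_fun do rewrite mxE.
exact: measurable_mx_entry.
Qed.

Let row_rectangles_measurable : row_rectangles `<=` measurable.
Proof.
move=> _ [F [mF ->]].
rewrite (_ : [set _ | _] = \bigcap_(k in [set: 'I_K]) ((row k) @^-1` F k)); last first.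
  by apply/seteqP; split=> A /= H k; [move=> _; exact: H|exact: (H k I)].
apply: fin_bigcap_measurable; first exact: finite_finset.
by move=> k _; rewrite -[X in measurable X]setTI; exact: measurable_row.
Qed.

Let row_rectangles_generate : @measurable _ 'M[R[i]]_K `<=` <<s row_rectangles >>.
Proof.
apply: smallest_sub; first exact: smallest_sigma_algebra.
move=> _ [[k j] _ [B mB <-]]; apply: sub_sigma_algebra.
exists (fun k' => if k' == k then [set x : 'rV[R[i]]_K | B (x 0 j)] else setT); split.
  move=> k'; case: eqP => // _; rewrite -[X in measurable X]setTI.
  exact: measurable_mx_entry.
apply/seteqP; split=> A /=.
  by move=> [_ BA] k'; case: eqP => // -> /=; rewrite mxE.
by move=> /(_ k); rewrite eqxx /= mxE.
Qed.

(** Rectangles in the rows form a pi-system generating the matrix sigma-algebra, and on it the law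
    is the product over receivers of row laws that do not depend on time. *)
Lemma csi_identically_distributed t A : measurable A ->
  P (csi ch t @^-1` A) = P (csi ch 0%N @^-1` A).
Proof.
move=> mA.
apply: (@g_sigma_algebra_measure_unique _ _ _ row_rectangles _ (fun=> setT) _ _
  (distribution P (csiRV t)) (distribution P (csiRV 0%N))) => //.
- by move=> _; exists (fun=> setT); split => //; apply/seteqP; split.
- by rewrite bigcup_const.
- move=> _ _ [F [mF ->]] [F' [mF' ->]].
  exists (fun k => F k `&` F' k); split; first by move=> k; exact: measurableI.
  apply/seteqP; split=> B /= => [[HF HF'] k|H]; first by split.
  by split=> k; have [] := H k.
- move=> _ [F [mF ->]]; rewrite /distribution /pushforward.
  have prodE s : P (csiRV s @^-1` [set B | forall k, F k (row k B)]) =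
      (\prod_(k < K) P (bc_H ch s k @^-1` F k))%E.
    have us : uniq [seq (s, k) | k <- enum 'I_K].
      by rewrite map_inj_uniq ?enum_uniq// => k k' [].
    have := @H_indep _ _ _ _ _ ch _ (fun i => bc_H ch i.1 i.2 @^-1` F i.2) us.
    rewrite big_map big_enum /= => <-; last first.
      by move=> i _; exists (F i.2) => //; rewrite setTI.
    congr (P _); apply/seteqP; split=> w /= Hw.
      move=> _ /= /mapP[k _ ->] /=.
      by rewrite (_ : bc_H _ _ _ w = row k (csi ch s w))//;
        apply/rowP => j; rewrite !mxE.
    move=> k; rewrite (_ : row k _ = bc_H ch s k w); last first.
      by apply/rowP => j; rewrite !mxE.
    by apply: (Hw (s, k)); apply/mapP; exists k => //; rewrite mem_enum.
  transitivity (\prod_(k < K) P (bc_H ch t k @^-1` F k))%E; first exact: prodE.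
  transitivity (\prod_(k < K) P (bc_H ch 0%N k @^-1` F k))%E; last exact/esym/prodE.
  apply: eq_bigr => k _.
  exact: (H_ident ch t k (mF k)).
- by move=> _; rewrite ltey_eq fin_num_measure.
- exact: row_rectangles_generate.
Qed.

Definition good_probability L : R := fine (P [set w | good_matrix L (csi ch 0%N w)]).

Lemma measurable_good L t : measurable [set w | good_matrix L (csi ch t w)].
Proof.
rewrite -[X in measurable X]setTI.
exact: (measurable_good_matrix L (measurable_csi_id t) measurableT (Y := [set true])).
Qed.

Lemma good_probabilityE L t :
  P [set w | good_matrix L (csi ch t w)] = (good_probability L)%:E.
Proof.
rewrite /good_probability fineK; last by apply: fin_num_measure; exact: measurable_good.
apply: (csi_identically_distributed t (A := [set A | good_matrix L A])).
rewrite -[X in measurable X]setTI.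
exact: (measurable_good_matrix L (@measurable_id _ _ setT) measurableT (Y := [set true])).
Qed.

(** The events increase with the threshold, and their union contains every sample with an invertible
    channel matrix, hence has probability 1. *)
Lemma good_probability_cvg :
  forall eta, 0 < eta -> \forall n \near \oo, 1 - eta < good_probability n.+1%:R.
Proof.
move=> eta eta0.
pose F n := [set w | good_matrix n.+1%:R (csi ch 0%N w)].
have mF n : measurable (F n) by exact: measurable_good.
have mU : measurable (\bigcup_n F n) by exact: bigcupT_measurable.
have cv : P (F n) @[n --> \oo] --> P (\bigcup_n F n).
  apply: nondecreasing_cvg_mu => //.
  move=> m n mn; apply/subsetPset => w; rewrite /F /good_matrix /=.
  have mnR : m.+1%:R <= n.+1%:R :> R by rewrite ler_nat ltnS.
  move=> /and3P[h1 h2 /forallP h3]; apply/and3P; split.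
  - by apply: le_trans h1; rewrite lef_pV2 ?posrE.
  - exact: le_trans mnR.
  - apply/forallP => i; apply/forallP => j.
    by apply: le_trans mnR; move/forallP: (h3 i); exact.
have U1 : P (\bigcup_n F n) = 1%E.
  apply/eqP; rewrite eq_le probability_le1//=.
  have := null_det_csi ch 0%N; set D := [set w | _] => D0.
  have mD : measurable D.
    by apply: measurable_complex_eq => //; exact/measurable_det/measurable_csi_id.
  rewrite -(probability_setT P) -(setUv (\bigcup_n F n)).
  apply: le_trans (measureU2 _ _ _) _ => //; first exact: measurableC.
  rewrite [X in (_ + X <= _)%E](_ : _ = 0%E) ?adde0//.
  apply/eqP; rewrite eq_le measure_ge0 andbT -D0.
  apply: le_measure; rewrite ?inE//; first exact: measurableC.
  move=> w /= nF; apply: contrapT => det0; apply: nF.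
  have det_gt0 : 0 < sqr_mod (\det (csi ch 0%N w)).
    by rewrite lt_neqAle sqr_mod_ge0 andbT eq_sym sqr_mod_eq0; apply/eqP.
  (* Dominates at once the inverse of the squared determinant, the squared determinant and every
     squared cofactor, so any threshold above [b] makes the matrix good. *)
  pose b : R := (sqr_mod (\det (csi ch 0%N w)))^-1 + sqr_mod (\det (csi ch 0%N w)) +
    \sum_(ij : 'I_K * 'I_K) sqr_mod (cofactor (csi ch 0%N w) ij.1 ij.2).
  have s0 : 0 <= \sum_(ij : 'I_K * 'I_K) sqr_mod (cofactor (csi ch 0%N w) ij.1 ij.2).
    by apply: sumr_ge0 => ij _; exact: sqr_mod_ge0.
  have [n nb] : exists n, b <= n.+1%:R.
    exists (Num.truncn b); apply/ltW/truncnS_gt.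
  have dV0 : 0 <= (sqr_mod (\det (csi ch 0%N w)))^-1 by rewrite invr_ge0 ltW.
  exists n => //; rewrite /F /good_matrix /=; apply/and3P; split.
  - rewrite -[leRHS]invrK lef_pV2 ?posrE ?invr_gt0//.
    by apply: le_trans nb; rewrite /b -addrA lerDl addr_ge0// ltW.
  - by apply: le_trans nb; rewrite /b; lra.
  - apply/forallP => i; apply/forallP => j; apply: le_trans nb.
    have : sqr_mod (cofactor (csi ch 0%N w) i j) <=
        \sum_(ij : 'I_K * 'I_K) sqr_mod (cofactor (csi ch 0%N w) ij.1 ij.2).
      rewrite (bigD1 (i, j))//= lerDl; apply: sumr_ge0 => ij _; exact: sqr_mod_ge0.
    rewrite /b; lra.
rewrite U1 in cv; have /fine_cvgP[_ cvf] := cv.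
by apply: (cvgr_gt _ cvf); rewrite ltrBlDr ltrDl.
Qed.

End good_channel.

(** * Counting the slots without losses *)

Section slot_events.
Context {d : measure_display} {Omega : measurableType d} {R : realType}
        {P : probability Omega R} {K : nat}.
Variable ch : jammed_broadcast_channel P K.
Variables (L : R) (k : 'I_K) (lambda : R).
Hypothesis hlambda : forall t, P [set w | tnth (bc_S ch t w) k = false] = lambda%:E.

Local Notation generated := (generated_by ch 1 (fun=> 1%N)).
Local Notation index := ('I_6 * (nat * option 'I_K))%type.

Definition clear_slot t : set Omega :=
  [set w | ~~ tnth (bc_S ch t w) k && good_matrix L (csi ch t w)].

Definition quiet_slot t : set Omega :=
  [set w | (`|complex.Re (bc_N ch t k w)| < L) && (`|complex.Im (bc_N ch t k w)| < L)].

Definition quiet_probability : R :=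
  fine (normal_prob 0 (Num.sqrt (1 / 2)) [set x : R | `|x| < L]) ^+ 2.

Let H_indices t : set index := [set i | exists l, i = index_H t l].
Let slot_indices t : set index := [set index_S t] `|` H_indices t.

Let measurable_csi_generated t (B : set index) : H_indices t `<=` B ->
  measurable_fun setT (csi ch t : g_sigma_algebraType (generated B) -> _).
Proof.
move=> HB; apply/measurable_mxP => l j.
have mH : measurable_fun setT (bc_H ch t l : g_sigma_algebraType (generated B) -> _).
  apply: measurable_sub_sigma; apply: (sub_generated_by (i := index_H t l)) => //.
  by apply: HB; exists l.
rewrite (_ : (fun x => _) = fun w => bc_H ch t l w 0 j) => [|].
  exact: (measurable_mxP _).1 mH 0 j.
by apply/funext => w; rewrite mxE.
Qed.

Let unjammed_generated t (B : set index) : B (index_S t) ->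
  <<s generated B >> [set w | tnth (bc_S ch t w) k = false].
Proof.
move=> SB.
have mS : measurable_fun setT (bc_S ch t : g_sigma_algebraType (generated B) -> _).
  by apply: measurable_sub_sigma; apply: (sub_generated_by SB).
have := measurableT_comp (@measurable_tnth _ _ _ k) mS measurableT (Y := [set false]) _.
by rewrite setTI; apply.
Qed.

Let good_generated t (B : set index) : H_indices t `<=` B ->
  <<s generated B >> [set w | good_matrix L (csi ch t w)].
Proof.
move=> HB.
have := measurable_good_matrix L (measurable_csi_generated HB) measurableT (Y := [set true]) _.
by rewrite setTI; apply.
Qed.

Let clear_slotE t : clear_slot t = [set w | tnth (bc_S ch t w) k = false] `&`
  [set w | good_matrix L (csi ch t w)].
Proof.
apply/seteqP; split=> w; rewrite /clear_slot /=; first by move=> /andP[/negbTE].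
by move=> [S0 ->]; rewrite S0.
Qed.

Let clear_slot_generated t : <<s generated (slot_indices t) >> (clear_slot t).
Proof.
rewrite clear_slotE.
apply: (@measurableI _ (g_sigma_algebraType (generated (slot_indices t)))).
  by apply: unjammed_generated; left.
by apply: good_generated => i Hi; right.
Qed.

Let independent B1 B2 := @generated_by_independent _ _ _ _ _ ch 1 (fun=> 1%N)
  ltr01 (fun=> isT) B1 B2.

Lemma measurable_clear_slot t : measurable (clear_slot t).
Proof.
have := @clear_slot_generated t; apply: g_sigma_algebra_sub_measurable.
exact: generated_by_measurable.
Qed.

Lemma clear_slot_probability t :
  P (clear_slot t) = (lambda * good_probability ch L)%:E.
Proof.
rewrite clear_slotE EFinM -(hlambda t) -(good_probabilityE ch L t).
apply: (independent (B1 := [set index_S t]) (B2 := H_indices t)).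
- by apply/seteqP; split=> i //= [->] [l].
- exact: unjammed_generated.
- exact: good_generated.
Qed.

Lemma clear_slot_independent s t : s != t ->
  P (clear_slot s `&` clear_slot t) =
  (lambda * good_probability ch L * (lambda * good_probability ch L))%:E.
Proof.
move=> st; rewrite EFinM -{1}(clear_slot_probability s) -(clear_slot_probability t).
apply: (independent (B1 := slot_indices s) (B2 := slot_indices t)) => //.
apply/seteqP; split=> i //= [[->|[l ->]]] [|[l']] // [] /eqP; by rewrite (negbTE st).
Qed.

Let measurable_interval : measurable [set x : R | `|x| < L].
Proof.
rewrite -[X in measurable X]setTI; exact: (measurable_fun_ltr _ _ measurableT).
Qed.

Lemma measurable_quiet_slot t : measurable (quiet_slot t).
Proof.
rewrite -[X in measurable X]setTI.
apply: (measurable_and _ _ measurableT (Y := [set true])) => //.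
  apply: measurable_fun_ltr => //; apply: measurableT_comp => //.
  exact: measurable_RefT.
apply: measurable_fun_ltr => //; apply: measurableT_comp => //.
exact: measurable_ImfT.
Qed.

Lemma quiet_slot_probability t : P (quiet_slot t) = quiet_probability%:E.
Proof.
rewrite /quiet_probability expr2 EFinM fineK; last by rewrite fin_num_measure.
rewrite -(N_gaussian ch t k)//; congr (P _).
apply/seteqP; split=> w; rewrite /quiet_slot /=; first by move=> /andP.
by move=> [h1 h2]; apply/andP.
Qed.

Lemma quiet_slot_independent s t : s != t ->
  P (quiet_slot s `&` quiet_slot t) = (quiet_probability * quiet_probability)%:E.
Proof.
move=> st; rewrite EFinM -{1}(quiet_slot_probability s) -(quiet_slot_probability t).
pose E (i : nat * 'I_K) := if i.1 == s then quiet_slot s else quiet_slot t.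
have us : uniq [:: (s, k); (t, k)].
  by rewrite /= inE andbT; apply/negP => /eqP[/eqP]; rewrite (negbTE st).
pose Q : set R[i] := [set z | (`|complex.Re z| < L) && (`|complex.Im z| < L)].
have mQ : measurable Q.
  rewrite -[X in measurable X]setTI.
  apply: (measurable_and _ _ measurableT (Y := [set true])) => //.
    by apply: measurable_fun_ltr => //; apply: measurableT_comp => //; exact: measurable_Re.
  by apply: measurable_fun_ltr => //; apply: measurableT_comp => //; exact: measurable_Im.
have := @N_indep _ _ _ _ _ ch _ E us.
rewrite !big_cons big_nil mule1 /E /= eqxx eq_sym (negbTE st) => <-.
  congr (P _); apply/seteqP; split=> w /=.
    move=> [ws wt] i /=; rewrite !inE => /orP[] /eqP -> /=; first by rewrite eqxx.
    by rewrite eq_sym (negbTE st).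
  move=> H; split; first by have := H (s, k); rewrite /= eqxx !inE eqxx; exact.
  by have := H (t, k); rewrite /= eq_sym (negbTE st) !inE eqxx orbT; exact.
move=> i; rewrite !inE => /orP[] /eqP -> /=; rewrite ?eqxx; last rewrite eq_sym (negbTE st).
  by exists Q => //; rewrite setTI.
by exists Q => //; rewrite setTI.
Qed.

(** A slot that is not clear merely loses a match of the codeword sent. A noisy one may also give a
    match to a competitor, hence the factor 2. *)
Definition slot_score n w : R :=
  occurrences clear_slot n w + 2 * occurrences quiet_slot n w.

Lemma measurable_slot_score n : measurable_fun setT (slot_score n).
Proof.
apply: measurable_funD; last apply: measurable_funM => //.
  by apply: measurable_indic_sum => t; exact: measurable_clear_slot.
by apply: measurable_indic_sum => t; exact: measurable_quiet_slot.
Qed.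

(** Union bound over two weak laws: a deficit [delta] for the clear slots and [delta], counted
    twice, for the quiet ones. *)
Lemma slot_score_le n (delta : R) : (0 < n)%N -> 0 < delta ->
  (P [set w | (slot_score n w <=
        n%:R * (lambda * good_probability ch L + 2 * quiet_probability - 3 * delta))%R] <=
   (2 * (n%:R * delta ^+ 2)^-1)%:E)%E.
Proof.
move=> n0 d0; set p := lambda * _; set q := quiet_probability.
pose A := [set w | occurrences clear_slot n w <= n%:R * (p - delta)].
pose B := [set w | occurrences quiet_slot n w <= n%:R * (q - delta)].
have PA : (P A <= ((n%:R * delta ^+ 2)^-1)%:E)%E.
  apply: weak_law => //.
  - exact: measurable_clear_slot.
  - exact: clear_slot_probability.
  - exact: clear_slot_independent.
have PB : (P B <= ((n%:R * delta ^+ 2)^-1)%:E)%E.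
  apply: weak_law => //.
  - exact: measurable_quiet_slot.
  - exact: quiet_slot_probability.
  - exact: quiet_slot_independent.
have mA : measurable A.
  rewrite -[A]setTI; apply: (measurable_fun_ler _ _ measurableT _) => //.
  by apply: measurable_indic_sum => t; exact: measurable_clear_slot.
have mB : measurable B.
  rewrite -[B]setTI; apply: (measurable_fun_ler _ _ measurableT _) => //.
  by apply: measurable_indic_sum => t; exact: measurable_quiet_slot.
have -> : (2 * (n%:R * delta ^+ 2)^-1)%:E =
    ((n%:R * delta ^+ 2)^-1%:E + (n%:R * delta ^+ 2)^-1%:E)%E.
  by rewrite -EFinD mulr2n mulrDl mul1r.
apply: le_trans (leeD PA PB).
apply: (@le_trans _ _ (P (A `|` B))); last exact: measureU2.
apply: le_measure; rewrite ?inE.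
- rewrite -[X in measurable X]setTI; apply: (measurable_fun_ler _ _ measurableT _) => //.
  exact: measurable_slot_score.
- exact: measurableU.
move=> w; rewrite /slot_score /A /B /= => H.
have [wA|wA] := leP (occurrences clear_slot n w) (n%:R * (p - delta)); [by left|right].
rewrite leNgt; apply/negP => wB; move: H; rewrite leNgt => /negP; apply.
move: wA wB; lra.
Qed.

End slot_events.

Lemma quiet_probability_cvg {R : realType} (eta : R) : 0 < eta ->
  \forall n \near \oo, 1 - eta < quiet_probability n.+1%:R.
Proof.
move=> eta0; pose N := normal_prob 0 (Num.sqrt (1 / 2)) : probability (measurableTypeR R) R.
pose F n : set (measurableTypeR R) := [set x : R | `|x| < n.+1%:R].
have mF n : measurable (F n).
  rewrite -[X in measurable X]setTI.
  exact: (measurable_fun_ltr (@normr_measurable R setT) (measurable_cst _) measurableT (Y := [set true])).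
have U1 : \bigcup_n F n = setT.
  apply/seteqP; split=> // x _; exists (Num.truncn `|x : R|) => //.
  exact: truncnS_gt.
have cv : N (F n) @[n --> \oo] --> N (\bigcup_n F n).
  apply: nondecreasing_cvg_mu => //; first exact: bigcupT_measurable.
  move=> m n mn; apply/subsetPset => x; rewrite /F /= => /lt_le_trans; apply.
  by rewrite ler_nat ltnS.
rewrite U1 probability_setT in cv; have /fine_cvgP[_ cvN] := cv.
have cv2 : fine (N (F n)) ^+ 2 @[n --> \oo] --> (1 : R).
  by rewrite -[X in _ --> X](expr1n _ 2) !expr2; exact: (cvgM cvN cvN).
by apply: (cvgr_gt _ cv2); rewrite ltrBlDr ltrDl.
Qed.

(** * Zero-forcing code *)

Section zero_forcing_code.
Context {R : realType} {K : nat} (c : configuration) (n q : nat).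
Variables (L : R) (M : 'I_K -> nat).
Variable cb : 'I_K -> nat -> {ffun 'I_n -> 'I_q * 'I_q}.
Hypotheses (L_ge1 : 1 <= L) (M_gt0 : forall k, (0 < M k)%N).

Local Notation A := ('I_q * 'I_q)%type.

Let L_gt0 : 0 < L. Proof. exact: lt_le_trans L_ge1. Qed.

Definition qam_point (a : A) : R[i] := ((a.1 : nat)%:R +i* (a.2 : nat)%:R)%C.

(** The value 0 fills the times beyond the block, where the encoder must still be defined. *)
Definition transmitted (k : 'I_K) (m t : nat) : R[i] :=
  if insub t is Some i then qam_point (cb k m i) else 0.

(** An amplitude. Since the squared determinant is at least [1 / L] on a good matrix, the received
    gain is at least [2 * L], twice the noise threshold, and the unit spacing of the grid
    survives. *)
Definition zf_power : R := 2 * L ^+ 2.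

(* The adjugate times the conjugate determinant diagonalizes the channel into the
   real gain [zf_power * |det|^2]; on ill-conditioned channels nothing is sent. *)
Definition zf_encoder t
    (x : K.-tuple nat * (t.+1).-tuple 'M[R[i]]_K * (jsit c t).-tuple (K.-tuple bool))
    : 'cV[R[i]]_K :=
  let A := tnth x.1.2 ord_max in
  if good_matrix L A then
    ((zf_power +i* 0)%C * conjc (\det A)) *:
      (\adj A *m \col_k transmitted k (tnth x.1.1 k) t)
  else 0.

Lemma measurable_zf_encoder t : measurable_fun setT (@zf_encoder t).
Proof.
pose T : measurableType _ :=
  (K.-tuple nat * (t.+1).-tuple 'M[R[i]]_K * (jsit c t).-tuple (K.-tuple bool))%type.
have mA : measurable_fun setT (fun x : T => tnth x.1.2 ord_max).
  have m2 : measurable_fun setT (fun x : T => x.1.2) by exact: measurableT_comp.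
  exact: (measurableT_comp (@measurable_tnth _ _ _ ord_max) m2).
apply: measurable_fun_ifT; last exact: measurable_cst.
  exact: measurable_good_matrix.
apply/measurable_mxP => i j; under eq_fun do rewrite mxE.
apply: measurable_complexM.
  apply: measurable_complexM => //; apply: measurable_complex_conj.
  exact: measurable_det.
rewrite (_ : (fun x => _) = (fun x : T => \sum_(l < K)
  cofactor (tnth x.1.2 ord_max) l i * transmitted l (tnth x.1.1 l) t)); last first.
  by apply/funext => x; rewrite mxE; apply: eq_bigr => l _; rewrite !mxE.
apply: measurable_complex_sum => l; apply: measurable_complexM.
  exact: measurable_cofactor.
apply: (measurable_from_nat (fun m => transmitted l m t)).
have m1 : measurable_fun setT (fun x : T => x.1.1) by exact: measurableT_comp.
exact: (measurableT_comp (@measurable_tnth _ _ _ l) m1).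
Qed.

Local Notation received := (n.-tuple R[i] * n.-tuple 'M[R[i]]_K * n.-tuple (K.-tuple bool))%type.

(** Fails for every symbol when the slot is jammed or the matrix is bad, both known to the receiver;
    such slots are thereby erased. *)
Definition zf_test (k : 'I_K) (ta : 'I_n * A) (x : received) : bool :=
  let H := tnth x.1.2 ta.1 in
  let e := tnth x.1.1 ta.1 - (zf_power * sqr_mod (\det H) +i* 0)%C * qam_point ta.2 in
  [&& ~~ tnth (tnth x.2 ta.1) k, good_matrix L H,
      `|complex.Re e| < L & `|complex.Im e| < L].

Lemma measurable_zf_test k ta : measurable_fun setT (zf_test k ta).
Proof.
have mH : measurable_fun setT (fun x : received => tnth x.1.2 ta.1).
  have m2 : measurable_fun setT (fun x : received => x.1.2) by exact: measurableT_comp.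
  exact: (measurableT_comp (@measurable_tnth _ _ _ ta.1) m2).
have mY : measurable_fun setT (fun x : received => tnth x.1.1 ta.1).
  have m1 : measurable_fun setT (fun x : received => x.1.1) by exact: measurableT_comp.
  exact: (measurableT_comp (@measurable_tnth _ _ _ ta.1) m1).
have me : measurable_fun setT (fun x : received => tnth x.1.1 ta.1 -
    (zf_power * sqr_mod (\det (tnth x.1.2 ta.1)) +i* 0)%C * qam_point ta.2).
  apply: measurable_complexD => //.
  rewrite (_ : (fun x => _) = (fun x : received =>
    (zf_power * sqr_mod (\det (tnth x.1.2 ta.1)) +i* 0)%C * - qam_point ta.2)).
    apply: measurable_complexM => //; apply: measurable_complex => //.
    by apply: measurable_funM => //; exact/measurable_sqr_mod/measurable_det.
  by apply/funext => x; rewrite mulrN.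
apply: measurable_and.
  apply: measurable_neg.
  have m3 : measurable_fun setT (fun x : received => tnth x.2 ta.1).
    exact: (measurableT_comp (@measurable_tnth _ _ _ ta.1) measurable_snd).
  exact: (measurableT_comp (@measurable_tnth _ _ _ k) m3).
apply: measurable_and; first exact: measurable_good_matrix.
apply: measurable_and; apply: measurable_fun_ltr => //; apply: measurableT_comp => //.
  exact: measurable_RefT.
exact: measurable_ImfT.
Qed.

Definition matches k (v : {ffun 'I_n * A -> bool}) (m : nat) : nat :=
  \sum_(t < n) v (t, cb k m t).

(** Demanding a strict maximizer makes the answer unique; in a tie the value 0 is a mere default. *)
Definition best_match k (v : {ffun 'I_n * A -> bool}) : nat :=
  if [pick m : 'I_(M k) | [forall m' : 'I_(M k),
        (m' != m) ==> (matches k v m' < matches k v m)%N]] is Some m then m else 0.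

Definition zf_decoder k (x : received) : nat :=
  best_match k [ffun ta => zf_test k ta x].

Lemma measurable_zf_decoder k : measurable_fun setT (zf_decoder k).
Proof.
exact: (measurable_finite_tests (best_match k) (measurable_zf_test k)).
Qed.

Definition zf_code : broadcast_code R K c n :=
  BroadcastCode M_gt0 measurable_zf_encoder measurable_zf_decoder.

Lemma best_matchE k v (m : 'I_(M k)) :
  (forall m' : 'I_(M k), m' != m -> (matches k v m' < matches k v m)%N) ->
  best_match k v = m.
Proof.
move=> mbest; rewrite /best_match; case: pickP => [m2 /forallP m2best|none].
  have [->//|m2m] := eqVneq m2 m.
  have := m2best m; rewrite eq_sym m2m /= => lt1.
  by have := ltn_trans lt1 (mbest _ m2m); rewrite ltnn.
have := none m; rewrite (_ : [forall _, _])//.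
by apply/forallP => m'; apply/implyP; exact: mbest.
Qed.

(** Holds pointwise. Each of the [K] entries has a scalar factor of squared modulus at most
    [4 * L ^+ 5] and a sum of [K] terms of squared modulus at most [L * (2 * q.-1%:R ^+ 2)];
    applying [sqr_modD_le] repeatedly costs [2 ^+ K]. *)
Lemma zf_encoder_power t x : sqr_norm (@zf_encoder t x) <=
  8 * K%:R ^+ 2 * 2 ^+ K * L ^+ 6 * q.-1%:R ^+ 2.
Proof.
have bound0 : 0 <= 8 * K%:R ^+ 2 * 2 ^+ K * L ^+ 6 * q.-1%:R ^+ 2.
  by rewrite !mulr_ge0 ?exprn_ge0// ltW.
rewrite /zf_encoder; case: ifPn => [/and3P[_ detL /forallP adjL]|_]; last first.
  rewrite /sqr_norm big1 => [|j _]; first exact: bound0.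
  by rewrite mxE /sqr_mod /= !expr0n /= addr0.
set H := tnth x.1.2 ord_max in detL adjL *.
have sqr_sum (I : Type) (s : seq I) (F : I -> R[i]) :
    sqr_mod (\sum_(i <- s) F i) <= 2 ^+ size s * \sum_(i <- s) sqr_mod (F i).
  elim: s => [|i s ih]; first by rewrite !big_nil /sqr_mod /= !expr0n /= addr0 mulr0.
  rewrite !big_cons /=; apply: le_trans (sqr_modD_le _ _) _.
  rewrite exprS -mulrA ler_wpM2l// mulrDr lerD//.
  by rewrite ler_peMl ?sqr_mod_ge0// exprn_ege1// ler1n.
have pointq a : sqr_mod (qam_point a) <= 2 * q.-1%:R ^+ 2.
  case: a => a b; have q0 := leq_ltn_trans (leq0n a) (ltn_ord a).
  rewrite /sqr_mod /= mulrDl mul1r; apply: lerD;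
    by rewrite ler_sqr ?nnegrE// ler_nat -ltnS prednK.
have transq l m : sqr_mod (transmitted l m t) <= 2 * q.-1%:R ^+ 2.
  rewrite /transmitted; case: insub => [i|]; first exact: pointq.
  by rewrite /sqr_mod /= expr0n /= addr0 mulr_ge0 ?sqr_ge0.
have entry j : sqr_mod ((((zf_power +i* 0)%C * conjc (\det H)) *:
      (\adj H *m \col_k transmitted k (tnth x.1.1 k) t)) j 0) <=
    (4 * L ^+ 4 * L) * (2 ^+ K * (K%:R * (L * (2 * q.-1%:R ^+ 2)))).
  rewrite mxE !sqr_modM; apply: ler_pM; rewrite ?mulr_ge0 ?sqr_mod_ge0//.
    rewrite (_ : sqr_mod _ = 4 * L ^+ 4); last first.
      by rewrite /sqr_mod /= expr0n /= addr0 /zf_power; ring.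
    rewrite ler_wpM2l ?mulr_ge0 ?exprn_ge0 ?(ltW L_gt0)//.
    by move: detL; case: (\det H) => a b; rewrite /sqr_mod /= sqrrN.
  rewrite mxE; apply: le_trans (sqr_sum _ _ _) _.
  rewrite /index_enum -enumT size_enum_ord ler_wpM2l ?exprn_ge0//.
  rewrite enumT (_ : K%:R * _ = \sum_(l < K) (L * (2 * q.-1%:R ^+ 2))); last first.
    by rewrite sumr_const card_ord -[RHS]mulr_natl.
  apply: ler_sum => l _; rewrite sqr_modM !mxE; apply: ler_pM;
    rewrite ?sqr_mod_ge0//.
  by have /forallP := adjL l; exact.
rewrite /sqr_norm; apply: (@le_trans _ _ (\sum_(j < K)
    (4 * L ^+ 4 * L) * (2 ^+ K * (K%:R * (L * (2 * q.-1%:R ^+ 2)))))).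
  by apply: ler_sum => j _; exact: entry.
rewrite sumr_const card_ord -[leLHS]mulr_natl.
by rewrite le_eqVlt; apply/orP; left; apply/eqP; ring.
Qed.

End zero_forcing_code.

(** * Reception of the zero-forcing code *)

Section zero_forcing_performance.
Context {d : measure_display} {Omega : measurableType d} {R : realType}
        {P : probability Omega R} {K : nat}.
Variable ch : jammed_broadcast_channel P K.
Variables (c : configuration) (n q : nat) (L PT : R) (M : 'I_K -> nat).
Variable cb : 'I_K -> nat -> {ffun 'I_n -> 'I_q * 'I_q}.
Hypotheses (L_ge1 : 1 <= L) (M_gt0 : forall k, (0 < M k)%N).

Local Notation C := (zf_code c L cb M_gt0).

Let L_gt0 : 0 < L. Proof. exact: lt_le_trans L_ge1. Qed.

Lemma zf_power_constraint : (8 * K%:R ^+ 2 * 2 ^+ K * L ^+ 6 * q.-1%:R ^+ 2 <= PT)%R ->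
  power_constraint ch PT C.
Proof.
move=> hPT t tn; rewrite unlock.
apply: (@le_trans _ _ (\int[P]_w (PT%:E))%E); last first.
  by rewrite integral_cst//= probability_setT mule1.
apply: ge0_le_integralT => w; rewrite lee_fin.
  by apply: sumr_ge0 => j _; exact: sqr_mod_ge0.
by apply: le_trans hPT; exact: zf_encoder_power.
Qed.

(** A matrix times its adjugate is its determinant times the identity, so row [k] picks out the
    symbol of receiver [k] alone; the conjugate factor makes the gain real. *)
Lemma zf_useful_signal (k : 'I_K) (t : 'I_n) w : good_matrix L (csi ch t w) ->
  (bc_H ch t k w *m channel_input ch C t w) 0 0 =
  (zf_power L * sqr_mod (\det (csi ch t w)) +i* 0)%C *
    qam_point (cb k (bc_W ch M k w) t).
Proof.
move=> gt; rewrite /channel_input /= /zf_encoder /=.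
have -> : tnth (csi_upto ch t.+1 w) ord_max = csi ch t w by rewrite tnth_mktuple.
rewrite gt.
set u := \col_l _.
have -> : bc_H ch t k w = row k (csi ch t w).
  by apply/rowP => j; rewrite !mxE.
rewrite -row_mul -scalemxAr mulmxA mul_mx_adj mul_scalar_mx scalerA 2!mxE.
rewrite mxE /transmitted valK tnth_mktuple; congr (_ * _).
case: (\det (csi ch t w)) => a b; rewrite /sqr_mod /=.
by apply/eqP; rewrite eq_complex /=; apply/andP; split; apply/eqP; ring.
Qed.

Definition observed_test k w (ta : 'I_n * ('I_q * 'I_q)) : bool :=
  zf_test L k ta
    ([tuple channel_output ch PT C k t w | t < n], csi_upto ch n w, jsi_upto ch n w).

Lemma observed_testE k w (t : 'I_n) a : observed_test k w (t, a) =
  [&& ~~ tnth (bc_S ch t w) k, good_matrix L (csi ch t w),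
   `|complex.Re (channel_output ch PT C k t w -
       (zf_power L * sqr_mod (\det (csi ch t w)) +i* 0)%C * qam_point a)| < L &
   `|complex.Im (channel_output ch PT C k t w -
       (zf_power L * sqr_mod (\det (csi ch t w)) +i* 0)%C * qam_point a)| < L].
Proof.
rewrite /observed_test /zf_test /=.
by rewrite !tnth_mktuple.
Qed.

Lemma clear_output k (t : 'I_n) w : clear_slot ch L k t w ->
  channel_output ch PT C k t w =
  (zf_power L * sqr_mod (\det (csi ch t w)) +i* 0)%C *
    qam_point (cb k (bc_W ch M k w) t) + bc_N ch t k w.
Proof.
move=> /andP[/negbTE St gt].
by rewrite /channel_output zf_useful_signal// St mul0r addr0.
Qed.

Lemma clear_quiet_test k (t : 'I_n) w : clear_slot ch L k t w -> quiet_slot ch L k t w ->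
  observed_test k w (t, cb k (bc_W ch M k w) t).
Proof.
move=> ct qt; rewrite observed_testE (clear_output ct) addrAC subrr add0r.
by move: ct qt; rewrite /clear_slot /quiet_slot /= => /andP[-> ->] /andP[-> ->].
Qed.

(** If the noise were quiet, noise and residual would both be below [L], so the gain times the
    difference of grid coordinates would be below [2 * L], itself at most the gain. Integers at
    distance less than 1 coincide. *)
Lemma wrong_test k (t : 'I_n) w a : observed_test k w (t, a) ->
  a != cb k (bc_W ch M k w) t -> clear_slot ch L k t w /\ ~ quiet_slot ch L k t w.
Proof.
rewrite observed_testE => /and4P[St gt].
have ct : clear_slot ch L k t w by rewrite /clear_slot /= St gt.
rewrite (clear_output ct); set g := zf_power L * _; set b := cb k _ t.
set N := bc_N ch t k w.
have g2L : 2 * L <= g.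
  move: gt => /and3P[detL _ _].
  rewrite /g /zf_power; have := ler_wpM2l (ltW L_gt0) detL.
  by rewrite mulfV ?gt_eqF// => h; have := L_gt0; nra.
case: a => a1 a2; case: b => b1 b2 => hRe hIm ab; split => // /andP[nRe nIm].
have cancel_sum (x y e : R) : `|g * (x - y) + e| < L -> `|e| < L -> `|x - y| < 1.
  move=> h1 h2; rewrite ltNge; apply/negP => h3.
  have g0 : 0 < g by apply: lt_le_trans g2L; rewrite mulr_gt0.
  have : `|g * (x - y)| < 2 * L.
    rewrite (_ : g * (x - y) = g * (x - y) + e - e); last by rewrite addrK.
    by apply: le_lt_trans (ler_normB _ _) _; lra.
  rewrite normrM (gtr0_norm g0) ltNge => /negP; apply.
  by apply: le_trans g2L _; rewrite ler_peMr// ltW.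
have nat_dist (i j : nat) : `|i%:R - j%:R : R| < 1 -> i = j.
  wlog ij : i j / (i <= j)%N.
    move=> wl; have [ij|/ltnW ji] := leqP i j; first exact: wl.
    by rewrite distrC => /wl ->.
  rewrite distrC -natrB// normr_nat (ltr_nat _ _ 1) ltnS leqn0 subn_eq0 => ji.
  by apply/eqP; rewrite eqn_leq ij ji.
have E1 : b1 = a1 :> nat.
  apply: nat_dist; apply: cancel_sum nRe; move: hRe.
  rewrite !raddfB /= !raddfD /= !mul0r !subr0 mulrBr.
  rewrite (_ : _ + _ + _ = g * b1%:R - g * a1%:R + complex.Re N)//; ring.
have E2 : b2 = a2 :> nat.
  apply: nat_dist; apply: cancel_sum nIm; move: hIm.
  rewrite !raddfB /= !raddfD /= mulrBr.
  by rewrite (_ : _ + _ + _ = g * b2%:R - g * a2%:R + complex.Im N)//; ring.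
by move/eqP: ab; apply; congr pair; apply: val_inj.
Qed.

End zero_forcing_performance.

Section zero_forcing_error.
Context {d : measure_display} {Omega : measurableType d} {R : realType}
        {P : probability Omega R} {K : nat}.
Variable ch : jammed_broadcast_channel P K.
Variables (c : configuration) (n q : nat) (L PT : R) (M : 'I_K -> nat).
Variable cb : 'I_K -> nat -> {ffun 'I_n -> 'I_q * 'I_q}.
Hypotheses (L_ge1 : 1 <= L) (M_gt0 : forall k, (0 < M k)%N).

Local Notation C := (zf_code c L cb M_gt0).

(* Only a clear slot that is not quiet can confirm a symbol other than the one sent,
   so a competing codeword collects at most [agreement + n - nQ] matches, against at
   least [nC + nQ - n] for the codeword sent ([nC] clear and [nQ] quiet slots). *)
Lemma decoded_correct (k : 'I_K) (s : nat) w :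
  (forall m m', (m < M k)%N -> (m' < M k)%N -> m != m' ->
     (agreement (cb k m) (cb k m') < s)%N) ->
  (bc_W ch M k w < M k)%N ->
  s%:R + 2 * n%:R <= slot_score ch L k n w ->
  decoded ch PT C k w = bc_W ch M k w.
Proof.
move=> far WM score.
pose m0 := Ordinal WM.
pose cl (t : nat) : bool := w \in clear_slot ch L k t.
pose qu (t : nat) : bool := w \in quiet_slot ch L k t.
pose nC := (\sum_(t < n) cl t)%N; pose nQ := (\sum_(t < n) qu t)%N.
have scoreE : (s + 2 * n <= nC + 2 * nQ)%N.
  rewrite -(ler_nat R) natrD (natrM _ 2 n) [in leRHS]natrD (natrM _ 2 nQ) /nC /nQ !natr_sum.
  apply: le_trans score _; rewrite /slot_score /occurrences.
  by rewrite le_eqVlt; apply/orP; left; apply/eqP; congr (_ + _ * _);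
    apply: eq_bigr => t _; rewrite indicE.
pose v : {ffun 'I_n * ('I_q * 'I_q) -> bool} :=
  [ffun ta => observed_test ch c L PT cb M_gt0 k w ta].
apply: (@best_matchE K n q M cb k v m0) => m mm0.
have sent : (nC + nQ <= n + matches cb k v m0)%N.
  rewrite /nC /nQ /matches -big_split /= -[X in (_ <= X + _)%N](card_ord n) -sum1_card -big_split /=.
  apply: leq_sum => t _; rewrite ffunE.
  case: (boolP (cl t)) => [/set_mem ct|_]; case: (boolP (qu t)) => [/set_mem qt|_] //.
    by rewrite (clear_quiet_test c PT cb M_gt0 ct qt).
have other : (matches cb k v m + nQ <= agreement (cb k m) (cb k m0) + n)%N.
  have -> : agreement (cb k m) (cb k m0) = (\sum_(t < n) (cb k m t == cb k m0 t))%N.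
    by rewrite /agreement -sum1_card big_mkcond /=; apply: eq_bigr => t _; rewrite inE; case: ifP.
  rewrite /nQ /matches -big_split /= -[X in (_ <= _ + X)%N](card_ord n) -sum1_card -big_split /=.
  apply: leq_sum => t _; rewrite ffunE.
  case: (boolP (observed_test _ _ _ _ _ _ _ _ _)) => [vt|_] /=; last first.
    by rewrite add0n; apply: leq_trans (leq_addl _ _); case: (qu t).
  have [//|neq] := eqVneq (cb k m t) (cb k m0 t); first by rewrite leq_add2l; case: (qu t).
  have [_ nq] := wrong_test L_ge1 vt neq.
  by rewrite /qu (memNset nq).
have := far m m0 (ltn_ord m) (ltn_ord m0) mm0.
move: sent other scoreE; lia.
Qed.

Lemma measurable_received_message (k : 'I_K) (A : set nat) :
  measurable (bc_W ch M k @^-1` A).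
Proof. by rewrite -[X in measurable X]setTI; exact: measurable_funPT. Qed.

Lemma message_outside_null (k : 'I_K) :
  P (bc_W ch M k @^-1` [set i | ~ (i < M k)%N]) = 0%E.
Proof.
rewrite (_ : _ @^-1` _ = ~` (bc_W ch M k @^-1` [set i | (i < M k)%N])).
  rewrite probability_setC; last exact: measurable_received_message.
  by rewrite message_lt_size// subee.
by [].
Qed.

Lemma error_probability_le (k : 'I_K) (E : set Omega) : measurable E ->
  (forall w, (bc_W ch M k w < M k)%N -> ~ E w ->
     decoded ch PT C k w = bc_W ch M k w) ->
  (error_probability ch PT C k <= P E)%E.
Proof.
move=> mE HE; rewrite -[leRHS]adde0 -(message_outside_null k).
have mO := measurable_received_message k [set i | ~ (i < M k)%N].
apply: (@le_trans _ _ (P (E `|` (bc_W ch M k @^-1` [set i | ~ (i < M k)%N])))).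
  apply: le_measure; rewrite ?inE; [exact: measurable_error|exact: measurableU|].
  move=> w /= Werr; have [wE|nE] := pselect (E w); [by left|right => WM].
  by apply: Werr; exact/esym/HE.
exact: measureU2.
Qed.

(** Serves receivers of rate 0: the only message is decoded correctly except on the null event that
    it lies outside its alphabet. *)
Lemma error_probability_single (k : 'I_K) : M k = 1%N ->
  error_probability ch PT C k = 0%E.
Proof.
move=> M1; apply/eqP; rewrite eq_le measure_ge0 andbT -(measure0 P).
apply: error_probability_le => // w WM _.
apply: (@best_matchE K n q M cb k _ (Ordinal WM)) => m.
suff -> : m = Ordinal WM by rewrite eqxx.
apply: val_inj => /=; have := ltn_ord m; have := WM; move: (nat_of_ord m) => i.
by rewrite M1 !ltnS !leqn0 => /eqP -> /eqP ->.
Qed.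

(** The condition on [s] is the score needed for correct decoding, [s + 2 * n], compared with the
    score guaranteed by the weak laws; the [2 * n] turns [2 * quiet_probability L] into the loss
    [2 * (1 - quiet_probability L)]. *)
Lemma error_probability_multi (k : 'I_K) (s : nat) (lambda delta : R) :
  (forall t, P [set w | tnth (bc_S ch t w) k = false] = lambda%:E) ->
  (0 < n)%N -> 0 < delta ->
  (forall m m', (m < M k)%N -> (m' < M k)%N -> m != m' ->
     (agreement (cb k m) (cb k m') < s)%N) ->
  s%:R <= n%:R * (lambda * good_probability ch L -
                  2 * (1 - quiet_probability L) - 3 * delta) ->
  (error_probability ch PT C k <= (2 * (n%:R * delta ^+ 2)^-1)%:E)%E.
Proof.
move=> hl n0 d0 far sn; apply: le_trans (slot_score_le L hl n0 d0).
apply: error_probability_le.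
  rewrite -[X in measurable X]setTI; apply: (measurable_fun_ler _ _ measurableT _) => //.
  exact: measurable_slot_score.
move=> w WM /negP; rewrite -ltNge => score.
apply: (decoded_correct far WM); apply: le_trans (ltW score).
move: sn; lra.
Qed.

End zero_forcing_error.

(** * Achievable rates *)

Section codebooks.
Context {R : realType}.

Lemma truncn_ge_half (x : R) : 1 <= x -> x / 2 <= (Num.truncn x)%:R.
Proof.
move=> x1; have x0 : 0 <= x by exact: le_trans x1.
have [t0|t1] := posnP (Num.truncn x).
  by have := truncnS_gt x; rewrite t0 ltNge x1.
have := truncnS_gt x; rewrite -natr1.
have : 1 <= (Num.truncn x)%:R :> R by rewrite ler1n.
lra.
Qed.

Definition code_size (n : nat) (rho : R) : nat := Num.truncn (expR (n%:R * rho)).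

Lemma code_size_gt0 n rho : 0 <= rho -> (0 < code_size n rho)%N.
Proof.
move=> rho0; rewrite truncn_gt0 -[leLHS]expR0 ler_expR mulr_ge0//.
Qed.

(** The hypothesis is the logarithm of the counting condition for agreements below [n * sigma]; the
    additional [ln (q * q)] pays for rounding that number down. *)
Lemma codebook_exists (n q : nat) (sigma rho : R) : (0 < q)%N -> 0 <= rho ->
  0 <= sigma -> sigma <= 1 ->
  n%:R * rho + n%:R * ln 2 + ln (q * q)%:R <= n%:R * sigma * ln (q * q)%:R ->
  exists cb : nat -> {ffun 'I_n -> 'I_q * 'I_q}, forall m m',
    (m < code_size n rho)%N -> (m' < code_size n rho)%N -> m != m' ->
    (agreement (cb m) (cb m') < Num.truncn (n%:R * sigma))%N.
Proof.
move=> q0 rho0 s0 s1 cond.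
have QE : #|{: 'I_q * 'I_q}| = (q * q)%N by rewrite card_prod !card_ord.
have Q0 : (0 < q * q)%N by rewrite muln_gt0 q0.
have lnQ : 0 <= ln (q * q)%:R :> R by rewrite ln_ge0// ler1n.
apply: gilbert_varshamov; rewrite QE//.
set s := Num.truncn (n%:R * sigma).
have ns0 : 0 <= n%:R * sigma by rewrite mulr_ge0.
have sn : (s <= n)%N.
  rewrite -(ler_nat R); apply: (@le_trans _ _ (n%:R * sigma)).
    by rewrite truncn_le.
  by rewrite ler_piMr.
rewrite mulnA -[X in (_ <= _ ^ X)%N](subnKC sn) expnD leq_mul2r; apply/orP; right.
rewrite -(ler_nat R) natrM !natrX.
have e0 : 0 <= expR (n%:R * rho) :> R by exact: expR_ge0.
apply: (@le_trans _ _ (expR (n%:R * rho) * expR (n%:R * ln 2))).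
  rewrite ler_pM ?exprn_ge0 ?truncn_le//.
  by rewrite (expRM_natl n (ln 2)) lnK// posrE.
rewrite -expRD -[X in X ^+ s](@lnK R) ?posrE ?ltr0n// -expRM_natl ler_expR.
have := truncnS_gt (n%:R * sigma); rewrite -/s -natr1 => /ltW/(ler_wpM2r lnQ).
rewrite mulr_natl in cond *; move: cond; rewrite mulrDl mul1r.
lra.
Qed.

End codebooks.

Section achievable_rates.
Context {d : measure_display} {Omega : measurableType d} {R : realType}
        {P : probability Omega R} {K : nat}.
Variables (ch : jammed_broadcast_channel P K) (c : configuration).
Variable lambda : 'I_K -> R.
Hypothesis hlambda : forall k t,
  P [set w | tnth (bc_S ch t w) k = false] = (lambda k)%:E.

(** The fraction of positions in which two codewords may agree without spoiling the decoding. It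
    approaches [lambda k] as [L] grows and [delta] shrinks, and multiplies [ln (q * q)] in the
    rate. *)
Definition slot_margin (L delta : R) (k : 'I_K) : R :=
  lambda k * good_probability ch L - 2 * (1 - quiet_probability L) - 3 * delta.

Lemma slot_margin_le1 (L delta : R) k : 0 <= delta -> slot_margin L delta k <= 1.
Proof.
move=> d0; have c1 : lambda k * good_probability ch L <= 1.
  rewrite -lee_fin -(clear_slot_probability L (hlambda k) 0).
  by apply: probability_le1; exact: measurable_clear_slot.
have q1 : quiet_probability L <= 1.
  rewrite -lee_fin -(quiet_slot_probability ch L k 0).
  by apply: probability_le1; exact: measurable_quiet_slot.
rewrite /slot_margin; lra.
Qed.

Lemma cvg_div_natr (a : R) : a / n%:R @[n --> \oo] --> (0 : R).
Proof.
rewrite -(mulr0 a); apply: cvgMr; apply/gtr0_cvgV0; last exact: cvgr_idn.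
by near=> n; rewrite ltr0n; near: n; exact: nbhs_infty_gt.
Unshelve. all: by end_near. Qed.

Lemma near_mulr_ge (a b : R) : 0 < a -> \forall n \near \oo, b <= n%:R * a.
Proof.
move=> a0; near=> n; rewrite -ler_pdivrMr//; near: n.
exact: nbhs_infty_ger.
Unshelve. all: by end_near. Qed.

(** The rate condition has strict slack per slot, which exceeds the constant overhead [ln (q * q)]
    of the codebook count once [n] is large. Receivers of rate 0 are treated apart, since no margin
    is assumed for them. *)
Lemma achievable_rates (L PT delta : R) (q : nat) (rho : 'I_K -> R) :
  1 <= L -> (0 < q)%N -> 0 < delta ->
  8 * K%:R ^+ 2 * 2 ^+ K * L ^+ 6 * q.-1%:R ^+ 2 <= PT ->
  (forall k, rho k = 0 \/
     0 < rho k /\ rho k + ln 2 < slot_margin L delta k * ln (q * q)%:R) ->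
  achievable ch c PT rho.
Proof.
move=> L1 q0 d0 power hrho.
have lnQ : 0 <= ln (q * q)%:R :> R by rewrite ln_ge0// ler1n muln_gt0 q0.
have s_ge0 k : 0 < rho k -> rho k + ln 2 < slot_margin L delta k * ln (q * q)%:R ->
    0 <= slot_margin L delta k.
  move=> r0 hr; rewrite leNgt; apply/negP => s0.
  have l20 : 0 <= ln 2 :> R by rewrite ln_ge0// ler1n.
  have := mulr_le0_ge0 (ltW s0) lnQ; lra.
pose cond (n : nat) k := n%:R * rho k + n%:R * ln 2 + ln (q * q)%:R <=
  n%:R * slot_margin L delta k * ln (q * q)%:R.
(* A one-message alphabet fills in for rate 0 and for blocks too short for the counting condition;
   the latter are finitely many and do not affect the limits. *)
have ex n k : exists Mcb : nat * (nat -> {ffun 'I_n -> 'I_q * 'I_q}),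
    [/\ (0 < Mcb.1)%N, rho k = 0 -> Mcb.1 = 1%N &
     rho k != 0 -> cond n k -> Mcb.1 = code_size n (rho k) /\
       forall m m', (m < Mcb.1)%N -> (m' < Mcb.1)%N -> m != m' ->
       (agreement (Mcb.2 m) (Mcb.2 m') < Num.truncn (n%:R * slot_margin L delta k))%N].
  pose cst : nat -> {ffun 'I_n -> 'I_q * 'I_q} := fun=> [ffun=> (Ordinal q0, Ordinal q0)].
  case: (hrho k) => [r0|[r0 hr]].
    by exists (1%N, cst); split => //; rewrite r0 eqxx.
  have [cnd|ncnd] := boolP (cond n k); last first.
    by exists (1%N, cst); split => // _ cnd; rewrite cnd in ncnd.
  have [cb hcb] := codebook_exists q0 (ltW r0) (s_ge0 k r0 hr) (slot_margin_le1 L k (ltW d0)) cnd.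
  exists (code_size n (rho k), cb); split => //=; first exact/code_size_gt0/ltW.
  by move=> r00; rewrite r00 ltxx in r0.
pose M n k := (sval (cid (ex n k))).1.
pose cb n k := (sval (cid (ex n k))).2.
have M_gt0 n k : (0 < M n k)%N by rewrite /M; case: cid => ? [].
have M_one n k : rho k = 0 -> M n k = 1%N by rewrite /M; case: cid => ? [].
have M_code n k : rho k != 0 -> cond n k -> M n k = code_size n (rho k) /\
    forall m m', (m < M n k)%N -> (m' < M n k)%N -> m != m' ->
       (agreement (cb n k m) (cb n k m') < Num.truncn (n%:R * slot_margin L delta k))%N.
  by rewrite /M /cb; case: cid => ? [].
have near_cond k : rho k != 0 -> \forall n \near \oo, cond n k.
  move=> r0; case: (hrho k) => [r00|[_ hr]]; first by rewrite r00 eqxx in r0.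
  near=> n.
  have : ln (q * q)%:R <= n%:R * (slot_margin L delta k * ln (q * q)%:R - (rho k + ln 2)).
    by near: n; apply: near_mulr_ge; rewrite subr_gt0.
  rewrite /cond mulrBr mulrDr mulrA; lra.
exists (fun n => zf_code c L (cb n) (M_gt0 n)); split.
- by move=> n; exact: zf_power_constraint.
- move=> k; have [r0|r0] := eqVneq (rho k) 0.
    rewrite r0; apply: cvg_near_cst; near=> n.
    by rewrite /rate /= M_one// ln1 mul0r.
  have rgt0 : 0 < rho k by case: (hrho k) => [r00|[]//]; rewrite r00 eqxx in r0.
  (* Rounding the codebook size down loses at most a factor 2, that is [ln 2 / n] of the rate. *)
  apply: (@squeeze_cvgr _ _ _ _ (fun n => rho k - ln 2 / n%:R) (fun=> rho k)); last first.
  + exact: cvg_cst.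
  + rewrite -[X in _ --> X]subr0; apply: cvgB; first exact: cvg_cst.
    exact: cvg_div_natr.
  near=> n.
  have n0 : (0 < n)%N by near: n; exact: nbhs_infty_gt.
  have cnd : cond n k by near: n; exact: near_cond.
  rewrite /rate /= (proj1 (M_code n k r0 cnd)).
  have e1 : 1 <= expR (n%:R * rho k) :> R.
    by rewrite -expR0 ler_expR mulr_ge0// ltW.
  have lo := truncn_ge_half e1.
  have hi : (code_size n (rho k))%:R <= expR (n%:R * rho k) :> R.
    by rewrite truncn_le expR_ge0.
  have s0 : 0 < (code_size n (rho k))%:R :> R by rewrite ltr0n code_size_gt0// ltW.
  have nR : 0 < n%:R :> R by rewrite ltr0n.
  apply/andP; split.
    rewrite ler_pdivlMr// mulrBl divfK ?gt_eqF// [rho k * _]mulrC.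
    rewrite -[X in X - _]expRK -lnV ?posrE// -lnM ?posrE ?expR_gt0// ?invr_gt0//.
    by rewrite ler_ln ?posrE ?divr_gt0 ?expR_gt0.
  rewrite ler_pdivrMr// [rho k * _]mulrC -[leRHS]expRK.
  by rewrite ler_ln ?posrE ?expR_gt0.
- move=> k; have [r0|r0] := eqVneq (rho k) 0.
    by apply: cvg_near_cst; near=> n; rewrite error_probability_single// M_one.
  apply: (@squeeze_cvge _ _ _ _ (fun=> 0%E) _
    (fun n => (2 * (n%:R * delta ^+ 2)^-1)%:E)); last first.
  + apply: cvg_EFin; first exact: nearW.
    rewrite (_ : _ \o _ = fun n => 2 / delta ^+ 2 / n%:R); first exact: cvg_div_natr.
    by rewrite funeqE => n; rewrite /comp /= -mulrA -invfM [X in X^-1]mulrC.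
  + exact: cvg_cst.
  near=> n.
  have n0 : (0 < n)%N by near: n; exact: nbhs_infty_gt.
  have cnd : cond n k by near: n; exact: near_cond.
  rewrite measure_ge0 /=.
  have [_ far] := M_code n k r0 cnd.
  apply: (error_probability_multi c PT L1 (M_gt0 n) (hlambda k) n0 d0 far).
  rewrite truncn_le mulr_ge0//; have [r00|[rk hr]] := hrho k; last exact: s_ge0 rk hr.
  by case/eqP: (r0).
Unshelve. all: by end_near. Qed.

End achievable_rates.

(** * From achievable rates to the region *)

Section achievability.
Context {d : measure_display} {Omega : measurableType d} {R : realType}
        {P : probability Omega R} {K : nat}.
Variables (ch : jammed_broadcast_channel P K) (c : configuration).
Variables lambda dof : 'I_K -> R.
Hypothesis hlambda : forall k t,
  P [set w | tnth (bc_S ch t w) k = false] = (lambda k)%:E.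
Hypothesis dof_le : forall k, 0 <= dof k /\ dof k <= lambda k.

Lemma lambda_le1 k : lambda k <= 1.
Proof.
rewrite -lee_fin -(hlambda k 0); apply: probability_le1.
have := measurableT_comp (@measurable_tnth _ _ _ k) (measurable_funPT (bc_S ch 0%N))
  measurableT (Y := [set false]) _.
by rewrite setTI; apply.
Qed.

(** The decrease by [eps] leaves room for the losses; clipping at 0 keeps the rates non-negative
    when a coordinate is too small. *)
Definition truncated_dof (eps : R) k : R := Num.max 0 (dof k - eps).

Lemma truncated_dof_dist eps k : 0 <= eps -> `|dof k - truncated_dof eps k| <= eps.
Proof.
have [d0 _] := dof_le k; rewrite /truncated_dof => e0.
by case: (leP 0 (dof k - eps)) => h; rewrite ler_norml; apply/andP; split; lra.
Qed.

(** A one-point grid sends the zero signal, which respects any power. This is needed because the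
    region asks for achievable rates at every positive power, not only at large ones. *)
Lemma achievable_zero PT : 0 < PT -> achievable ch c PT (fun=> 0).
Proof.
move=> PT0; apply: (@achievable_rates _ _ _ _ _ ch c lambda hlambda 1 PT 1 1) => //.
  by rewrite expr0n mulr0 ltW.
by move=> k; left.
Qed.

(** Half of [eps] pays for the slots lost, which fixes [L]; the other half, times [ln PT],
    eventually exceeds the constants [ln 2] of the codebook and [ln (B0 + 1)] of the power
    normalization. *)
Lemma achievable_near_dof (eps : R) : 0 < eps ->
  \forall PT \near +oo, achievable ch c PT (fun k => truncated_dof eps k * ln PT).
Proof.
move=> eps0.
have : \forall n \near \oo, 1 - eps / 4 < good_probability ch n.+1%:R /\
    1 - eps / 16 < quiet_probability n.+1%:R.
  near=> n; split; near: n.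
    by apply: good_probability_cvg; rewrite divr_gt0.
  by apply: quiet_probability_cvg; rewrite divr_gt0.
move=> /filter_ex[n [good quiet]]; set L : R := n.+1%:R in good quiet.
have L1 : 1 <= L by rewrite /L ler1n.
have L0 : 0 < L by exact: lt_le_trans L1.
pose B0 : R := 8 * K%:R ^+ 2 * 2 ^+ K * L ^+ 6.
have B00 : 0 <= B0 by rewrite !mulr_ge0 ?exprn_ge0// ltW.
have lnB : 0 <= ln (B0 + 1) by rewrite ln_ge0// lerDr.
have Bgt : 0 < B0 + 1 by lra.
near=> PT.
have PT0 : 0 < PT by near: PT; apply: nbhs_pinfty_gt; exact: num_real.
have PTln : (ln 2 + ln (B0 + 1)) * 2 / eps + 1 <= ln PT.
  by rewrite -[leLHS]expRK ler_ln ?posrE ?expR_gt0.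
have ln2 : 0 <= ln 2 :> R by rewrite ln_ge0// ler1n.
have {}PTln : ln 2 + ln (B0 + 1) < eps / 2 * ln PT.
  have e2 : 0 < eps / 2 by rewrite divr_gt0.
  have := ler_wpM2l (ltW e2) PTln; rewrite mulrDr mulr1.
  rewrite (_ : eps / 2 * ((ln 2 + ln (B0 + 1)) * 2 / eps) = ln 2 + ln (B0 + 1)); first lra.
  by field; rewrite gt_eqF.
(* Sizes the grid to the power: with [q.-1] the integer part of [x], [B0 * q.-1%:R ^+ 2 <= PT],
   while [ln (q * q)] stays above [ln PT - ln (B0 + 1)]. The added 1 keeps the divisor positive when
   [K] is 0. *)
pose x := Num.sqrt (PT / (B0 + 1)).
have x2 : x ^+ 2 = PT / (B0 + 1) by rewrite sqr_sqrtr// divr_ge0// ltW.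
have x0 : 0 < x by rewrite sqrtr_gt0 divr_gt0.
have e24 : 0 < eps / 24 by rewrite divr_gt0.
apply: (@achievable_rates _ _ _ _ _ ch c lambda hlambda L PT (eps / 24)
  (Num.truncn x).+1) => //.
  rewrite -/B0 succnK; apply: (@le_trans _ _ (B0 * x ^+ 2)).
    by rewrite ler_wpM2l// ler_sqr ?nnegrE ?(ltW x0)// truncn_le ltW.
  rewrite x2 mulrCA ler_piMr ?(ltW PT0)// ler_pdivrMr// mul1r; lra.
move=> k; rewrite /truncated_dof.
case: (leP 0 (dof k - eps)) => [de|_]; last by left; rewrite mul0r.
have [de0|de1] := eqVneq (dof k - eps) 0; first by left; rewrite de0 mul0r.
right; have de0 : 0 < dof k - eps by rewrite lt_neqAle eq_sym de1.
have lnPT0 : 0 < ln PT.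
  have e2 : 0 < eps / 2 by rewrite divr_gt0.
  by rewrite -(pmulr_rgt0 _ e2); lra.
split; first by rewrite mulr_gt0.
have [_ dl] := dof_le k; have l1 := lambda_le1 k.
(* The losses add up to [eps / 4 + 2 * (eps / 16) + 3 * (eps / 24) = eps / 2]. *)
have margin : dof k - eps / 2 <= slot_margin ch lambda L (eps / 24) k.
  have l0 : 0 <= lambda k by lra.
  have h1 := ler_wpM2l l0 (ltW good).
  have h2 : lambda k * (eps / 4) <= eps / 4 by rewrite ler_piMl// ltW// divr_gt0.
  rewrite /slot_margin; move: h1; rewrite mulrBr mulr1; lra.
set q := (Num.truncn x).+1.
have lnq : ln PT - ln (B0 + 1) <= ln (q * q)%:R.
  rewrite -ln_div ?posrE// -x2 expr2 ler_ln ?posrE ?mulr_gt0// ?ltr0n ?muln_gt0//.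
  by rewrite natrM; apply: ler_pM; rewrite ?ltW// truncnS_gt.
have lnq0 : 0 <= ln (q * q)%:R :> R by rewrite ln_ge0// ler1n muln_gt0.
apply: lt_le_trans (ler_wpM2r lnq0 margin).
have de20 : 0 <= dof k - eps / 2 by lra.
apply: lt_le_trans (ler_wpM2l de20 lnq).
have : (dof k - eps / 2) * ln (B0 + 1) <= ln (B0 + 1) by rewrite ler_piMl//; lra.
move: PTln; rewrite !mulrBr !mulrBl; lra.
Unshelve. all: by end_near. Qed.

(* [f] truncates at the smallest [1 / (m + 1)], [m <= PT], that is achievable at power
   [PT]: a diagonal choice, since how large [PT] must be depends on [m]. *)
Lemma truncated_dof_choice (PT : R) : 0 < PT -> exists f : 'I_K -> R,
  achievable ch c PT (fun k => f k * ln PT) /\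
  forall m, (m <= Num.truncn PT)%N ->
    achievable ch c PT (fun k => truncated_dof m.+1%:R^-1 k * ln PT) ->
    forall k, `|dof k - f k| <= m.+1%:R^-1.
Proof.
move=> PT0.
pose A m := `[< achievable ch c PT (fun k => truncated_dof m.+1%:R^-1 k * ln PT) >]
  && (m <= Num.truncn PT)%N.
(* When no index is admissible at this power, rate 0 is used and the second claim is vacuous;
   otherwise the bound by [PT] guarantees a largest admissible index. *)
have [exA|nA] := pselect (exists m, A m); last first.
  exists (fun=> 0); split.
    rewrite (_ : (fun=> _) = fun=> 0); first exact: achievable_zero.
    by apply/funext => k; rewrite mul0r.
  by move=> m mPT am; exfalso; apply: nA; exists m; apply/andP; split => //; apply/asboolP.
have bndA m : A m -> (m <= Num.truncn PT)%N by move=> /andP[].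
have [i /andP[/asboolP ai _] imax] := ex_maxnP exA bndA.
exists (truncated_dof i.+1%:R^-1); split => // m mPT am k.
have mi : (m <= i)%N by apply: imax; apply/andP; split => //; apply/asboolP.
apply: le_trans (truncated_dof_dist k _) _; first by rewrite invr_ge0.
by rewrite lef_pV2 ?posrE// ler_nat.
Qed.

Lemma dof_region_achievability : dof_region ch c dof.
Proof.
have ex PT : exists f : 'I_K -> R, 0 < PT ->
    achievable ch c PT (fun k => f k * ln PT) /\
    forall m, (m <= Num.truncn PT)%N ->
      achievable ch c PT (fun k => truncated_dof m.+1%:R^-1 k * ln PT) ->
      forall k, `|dof k - f k| <= m.+1%:R^-1.
  have [PT0|PT0] := ltP 0 PT; last by exists (fun=> 0).
  by have [f hf] := truncated_dof_choice PT0; exists f.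
have [f hf] := choice ex.
exists (fun PT k => f PT k * ln PT); split; first by move=> PT /hf[].
move=> k; apply/cvgrPdist_le => eps eps0.
(* This index stays fixed while [PT] grows. Eventually it is admissible, and the diagonal choice is
   then at least as accurate as [1 / (m + 1)], which is at most [eps]. *)
pose m := Num.truncn eps^-1.
have meps : m.+1%:R^-1 <= eps.
  by rewrite -[leRHS]invrK lef_pV2 ?posrE ?invr_gt0// ltW// truncnS_gt.
near=> PT.
have PT1 : 1 < PT by near: PT; apply: nbhs_pinfty_gt; exact: num_real.
have PT0 : 0 < PT by exact: lt_trans PT1.
rewrite mulfK ?gt_eqF ?ln_gt0//; apply: le_trans meps.
apply: (proj2 (hf PT PT0)).
  rewrite truncn_ge_nat ?(ltW PT0)//; near: PT; apply: nbhs_pinfty_ge; exact: num_real.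
near: PT; apply: achievable_near_dof.
by rewrite invr_gt0.
Unshelve. all: by end_near. Qed.

End achievability.

Theorem theorem8 (R : realType) (d : measure_display)
    (Omega : measurableType d) (P : probability Omega R) (K : nat)
    (ch : jammed_broadcast_channel P K)
    (lambda : 'I_K -> R)
    (hlambda : forall (k : 'I_K) (t : nat),
       P [set w | tnth (bc_S ch t w) k = false] = (lambda k)%:E)
    (c : configuration) :
  dof_region ch c =
    [set dof : 'I_K -> R | forall k : 'I_K, 0 <= dof k /\ dof k <= lambda k].
Proof.
apply/seteqP; split => dof; first exact: dof_region_converse.
exact: dof_region_achievability.
Qed.
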